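(* Let $G$ be a finite group and $\mathcal Y\to\mathcal B$ a $G$-gerbe over an orbifold, presented by an extension of proper étale groupoids $M\times G\to\mathfrak H\xrightarrow{j}\mathfrak Q$ as in the context, and let $c$ be the associated locally constant $U(1)$-valued groupoid $2$-cocycle on $\widehat G\rtimes\mathfrak Q$. Let $\mathcal A$ be a $\mathfrak Q$-sheaf of unital algebras on $\mathfrak Q_0=M$, regarded also as an $\mathfrak H$-sheaf via $j$, and let $\widetilde{\mathcal A}$ be the induced $\widehat G\rtimes\mathfrak Q$-sheaf on $\widehat G\times M$. Then the crossed product algebra $\mathcal A\rtimes\mathfrak H$ is Morita equivalent to the $c$-twisted crossed product algebra $\widetilde{\mathcal A}\rtimes_c(\widehat G\rtimes\mathfrak Q)$.
   Context: Groupoid presentation: $\mathfrak H,\mathfrak Q$ are proper étale Lie groupoids with $\mathfrak H_0=\mathfrak Q_0=M$, presenting $\mathcal Y$ and $\mathcal B$; $M\times G\to\mathfrak H\xrightarrow{j}\mathfrak Q$ is exact ($j$ is a surjective groupoid morphism, the kernel of $j$ is the trivial bundle of groups $M\times G$), and both maps are the identity on $M$. One assumes (possible after refining by an open cover) that every level of the nerve of $\mathfrak Q$ is a disjoint union of contractible open sets. An arrow $q$ has source $s(q)$ and target $t(q)$; $q_1q_2$ is defined when $t(q_1)=s(q_2)$ and has source $s(q_1)$, target $t(q_2)$. Fix a smooth section $\sigma:\mathfrak Q\to\mathfrak H$ of $j$ that is the identity on $M$, and put $\tau(q_1,q_2)=\sigma(q_1)\sigma(q_2)\sigma(q_1q_2)^{-1}\in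 G$, $\mathrm{Ad}_{\sigma(q)}(g)=\sigma(q)g\sigma(q)^{-1}\in G$. Cocycle: $\widehat G$ is the finite set of isomorphism classes of irreducible unitary $G$-representations, with fixed representatives $\rho:G\to\mathrm{End}(V_\rho)$. For $q\in\mathfrak Q$, $q([\rho])$ is the class of $\rho\circ\mathrm{Ad}_{\sigma(q)}$, so $(q_1q_2)([\rho])=q_2(q_1([\rho]))$; the chosen representative of this class is also written $q([\rho])$. Choose unitary $T_q^{[\rho]}:V_\rho\to V_{q([\rho])}$, locally constant in $q$, with $\rho(\mathrm{Ad}_{\sigma(q)}(g))=(T_q^{[\rho]})^{-1}q([\rho])(g)T_q^{[\rho]}$ and $T_q^{[\rho]}=\mathrm{id}$ for units $q$. Then $c^{[\rho]}(q_1,q_2)\in U(1)$ is defined by $T_{q_2}^{q_1([\rho])}T_{q_1}^{[\rho]}=c^{[\rho]}(q_1,q_2)T_{q_1q_2}^{[\rho]}\rho(\tau(q_1,q_2))^{-1}$; it is locally constant. The groupoid $\widehat G\rtimes\mathfrak Q$ has objects $\widehat G\times M$ and arrows $([\rho],q)$ from $([\rho],s(q))$ to $(q([\rho]),t(q))$, with $([\rho],q_1)(q_1([\rho]),q_2)=([\rho],q_1q_2)$. It presents the dual orbifold $\widehat{\mathcal Y}$. Sheaves and algebras: for an étale groupoid $\mathcal G$, a $\mathcal G$-sheaf is a sheaf $\mathcal S$ on $\mathcal G_0$ on which each arrow $g:x\to y$ acts by $\mathcal S_y\to\mathcal S_x$, compatibly with products (and continuously). For a $\mathcal G$-sheaf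 $\mathcal A$ of unital algebras, $\mathcal A\rtimes\mathcal G=\Gamma_{\mathrm{cpt}}(\mathcal G,s^*\mathcal A)$ (compactly supported sections) with product $(a_1*a_2)(g)=\sum_{g_1g_2=g}a_1(g_1)\,g_1(a_2(g_2))$. For a locally constant $U(1)$-valued $2$-cocycle $c$, $\mathcal A\rtimes_c\mathcal G$ is the same space with product $(a_1*_ca_2)(g)=\sum_{g_1g_2=g}c(g_1,g_2)a_1(g_1)g_1(a_2(g_2))$. $\widetilde{\mathcal A}$ is the pull-back of $\mathcal A$ along $\widehat G\times M\to M$. These algebras are in general only quasi-unital; Morita equivalence of such algebras $A,B$ means that there are an $A$-$B$ bimodule $P$ and a $B$-$A$ bimodule $P'$ with bimodule isomorphisms $P\otimes_BP'\cong A$, $P'\otimes_AP\cong B$ (completed bornological tensor products when the algebras are regarded as bornological algebras).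
   Formalization: The crossed product 𝒜⋊ℌ is additionally assumed self-induced (its multiplication induces an isomorphism of its tensor square over itself with itself), a consequence of quasi-unitality; for arbitrary sheaves of unital algebras the claim fails. *)

(* Defs.v *)
From HB Require Import structures.
From mathcomp Require Import all_boot all_order all_algebra all_fingroup.
From mathcomp Require Import mxrepresentation spectral complex.
From mathcomp Require Import all_classical all_reals all_analysis.

Set Implicit Arguments.
Unset Strict Implicit.
Unset Printing Implicit Defensive.

Import Order.TTheory GRing.Theory Num.Theory.
Import numFieldNormedType.Exports.

Local Open Scope classical_set_scope.
Local Open Scope ring_scope.
Local Open Scope complex_scope.
Local Open Scope sesquilinear_scope.

Section Smooth.
Context {R : realType}.

(* C^k on an open set U; for finite-dimensional E, existence and continuity of
   all iterated directional derivatives is the usual notion. *)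
Fixpoint Ck (E F : normedModType R) (k : nat) (U : set E) (f : E -> F) : Prop :=
  (forall x, U x -> {for x, continuous f}) /\
  match k with
  | 0%N => True
  | k'.+1 => forall v : E,
      (forall x, U x -> derivable f x v) /\ Ck k' U (fun x => 'D_v f x)
  end.

Definition Cinfty (E F : normedModType R) (U : set E) (f : E -> F) : Prop :=
  forall k, Ck k U f.

(* [cinv] is the inverse of [cmap : cdom -> cmap @` cdom]; both maps are
   irrelevant outside these sets. *)
Record chart (E : normedModType R) (X : topologicalType) := Chart {
  cdom : set X;
  cmap : X -> E;
  cinv : E -> X }.

Definition is_chart (E : normedModType R) (X : topologicalType)
    (phi : chart E X) : Prop :=
  [/\ open (cdom phi), open (cmap phi @` cdom phi),
      (forall x, cdom phi x -> cinv phi (cmap phi x) = x),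
      (forall x, cdom phi x -> {for x, continuous (cmap phi)}) &
      (forall y, (cmap phi @` cdom phi) y -> {for y, continuous (cinv phi)})].

Definition atlas (E : normedModType R) (X : topologicalType) := set (chart E X).

Definition is_manifold (E : normedModType R) (X : topologicalType)
    (AX : atlas E X) : Prop :=
  [/\ hausdorff_space X, @second_countable X,
      (forall phi, AX phi -> is_chart phi),
      (forall x, exists2 phi, AX phi & cdom phi x) &
      forall phi psi, AX phi -> AX psi ->
        Cinfty (cmap phi @` (cdom phi `&` cdom psi)) (cmap psi \o cinv phi)].

Definition prod_chart (E F : normedModType R) (X Y : topologicalType)
    (phi : chart E X) (psi : chart F Y) : chart (E * F)%type (X * Y)%type :=
  Chart (cdom phi `*` cdom psi)
    (fun z => (cmap phi z.1, cmap psi z.2))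
    (fun w => (cinv phi w.1, cinv psi w.2)).

Definition prod_atlas (E F : normedModType R) (X Y : topologicalType)
    (AX : atlas E X) (AY : atlas F Y) : atlas (E * F)%type (X * Y)%type :=
  [set chi | exists phi psi, [/\ AX phi, AY psi & chi = prod_chart phi psi]].

Section Maps.
Context {E F : normedModType R} {X Y : topologicalType}.
Variables (AX : atlas E X) (AY : atlas F Y).

Definition smooth_on (U : set X) (f : X -> Y) : Prop :=
  (forall x, U x -> {for x, continuous f}) /\
  forall phi psi, AX phi -> AY psi ->
    Cinfty (cmap phi @` (cdom phi `&` U `&` f @^-1` cdom psi))
           (cmap psi \o f \o cinv phi).

Definition smooth (f : X -> Y) : Prop := smooth_on setT f.

(* Smoothness of the restriction of f to a submanifold S of X: local smooth
   extendability to open sets of X. *)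
Definition smooth_within (S : set X) (f : X -> Y) : Prop :=
  forall x, S x -> exists U f', [/\ open U, U x, smooth_on U f' &
    forall y, U y -> S y -> f' y = f y].

End Maps.

Definition local_diffeo (E F : normedModType R) (X Y : topologicalType)
    (AX : atlas E X) (AY : atlas F Y) (f : X -> Y) : Prop :=
  forall x, exists U g, [/\ open U /\ U x, open (f @` U),
    smooth_on AX AY U f, smooth_on AY AX (f @` U) g &
    forall y, U y -> g (f y) = y].

End Smooth.

(* [gmul g h] is the product gh, meaningful when [tgt g = src h]. *)
Record groupoid (X0 X1 : Type) := Groupoid {
  src : X1 -> X0;
  tgt : X1 -> X0;
  gunit : X0 -> X1;
  ginv : X1 -> X1;
  gmul : X1 -> X1 -> X1 }.

Section Groupoids.
Context {X0 X1 : Type} (G : groupoid X0 X1).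

Definition composable (g h : X1) : Prop := tgt G g = src G h.

Definition is_groupoid : Prop :=
  [/\ (forall x, src G (gunit G x) = x /\ tgt G (gunit G x) = x),
      (forall g h, composable g h ->
         src G (gmul G g h) = src G g /\ tgt G (gmul G g h) = tgt G h),
      (forall g h k, composable g h -> composable h k ->
         gmul G g (gmul G h k) = gmul G (gmul G g h) k),
      (forall g, gmul G (gunit G (src G g)) g = g /\
                 gmul G g (gunit G (tgt G g)) = g) &
      (forall g, [/\ src G (ginv G g) = tgt G g, tgt G (ginv G g) = src G g,
         gmul G g (ginv G g) = gunit G (src G g) &
         gmul G (ginv G g) g = gunit G (tgt G g)])].

End Groupoids.

Definition proper_etale_Lie_groupoid (R : realType) (n : nat)
    (X0 X1 : topologicalType)
    (A0 : atlas 'rV[R]_n X0) (A1 : atlas 'rV[R]_n X1)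
    (G : groupoid X0 X1) : Prop :=
  [/\ is_manifold A0 /\ is_manifold A1,
      is_groupoid G,
      local_diffeo A1 A0 (src G) /\ local_diffeo A1 A0 (tgt G),
      [/\ smooth A0 A1 (gunit G), smooth A1 A1 (ginv G) &
          smooth_within (prod_atlas A1 A1) A1
            [set p | composable G p.1 p.2] (fun p => gmul G p.1 p.2)] &
      forall K : set (X0 * X0), compact K ->
        compact [set g | K (src G g, tgt G g)]].

Definition contractible_set (R : realType) (Z : topologicalType)
    (U : set Z) : Prop :=
  exists z0 (h : R * Z -> Z), [/\ U z0,
    {within `[0, 1]%classic `*` U, continuous h},
    (forall t z, `[0, 1]%classic t -> U z -> U (h (t, z))),
    (forall z, U z -> h (0, z) = z) &
    (forall z, U z -> h (1, z) = z0)].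

Definition disjoint_union_of_contractibles (R : realType)
    (Z : topologicalType) (S : set Z) : Prop :=
  exists F : set (set Z),
    [/\ (forall U, F U -> contractible_set R U),
        (forall U, F U -> exists2 O, open O & U = S `&` O),
        trivIset F id &
        \bigcup_(U in F) U = S].

(* Composable strings of k arrows, k >= 1, as a subspace of X1^k. *)
Definition nerve (X0 : Type) (X1 : topologicalType) (G : groupoid X0 X1)
    (k : nat) : set (prod_topology (fun _ : 'I_k => X1)) :=
  [set w | forall i i' : 'I_k, i' = i.+1 :> nat -> composable G (w i) (w i')].

Definition good_nerve (R : realType) (X0 X1 : topologicalType)
    (G : groupoid X0 X1) : Prop :=
  disjoint_union_of_contractibles R [set: X0] /\
  forall k, disjoint_union_of_contractibles R (nerve G (k := k.+1)).

Section Extension.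
Context {R : realType} {n : nat} {gT : finGroupType} {M H Q : topologicalType}.
Variables (AM : atlas 'rV[R]_n M) (AH : atlas 'rV[R]_n H)
  (AQ : atlas 'rV[R]_n Q).
Variables (GH : groupoid M H) (GQ : groupoid M Q).
Variables (iota : M -> gT -> H) (j : H -> Q).

Definition is_extension : Prop :=
  [/\ [/\ (forall x g, src GH (iota x g) = x /\ tgt GH (iota x g) = x),
          (forall x g h, iota x (g * h)%g = gmul GH (iota x g) (iota x h)),
          (forall x, injective (iota x)) &
          (forall g, smooth AM AH (iota^~ g))],
      [/\ (forall h, src GQ (j h) = src GH h /\ tgt GQ (j h) = tgt GH h),
          (forall x, j (gunit GH x) = gunit GQ x),
          (forall h k, composable GH h k ->
             j (gmul GH h k) = gmul GQ (j h) (j k)),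
          smooth AH AQ j & (forall q, exists h, j h = q)] &
      forall h, (exists x, j h = gunit GQ x) <-> (exists x g, h = iota x g)].

Variable sigma : Q -> H.

Definition is_section : Prop :=
  [/\ smooth AQ AH sigma, (forall q, j (sigma q) = q) &
      (forall x, sigma (gunit GQ x) = gunit GH x)].

(* The element g of G with [iota x g = h], for h in the kernel of j. *)
Definition fiber_elt (h : H) : gT :=
  xget 1%g [set g | iota (src GH h) g = h].

Definition tau (q1 q2 : Q) : gT :=
  fiber_elt (gmul GH (gmul GH (sigma q1) (sigma q2))
                     (ginv GH (sigma (gmul GQ q1 q2)))).

Definition Ad (q : Q) (g : gT) : gT :=
  fiber_elt (gmul GH (gmul GH (sigma q) (iota (tgt GQ q) g))
                     (ginv GH (sigma q))).

End Extension.

(* V_r is C^(rdim r); matrices act on column vectors. *)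
Record unitary_dual (R : realType) (gT : finGroupType) := UnitaryDual {
  irreps :> finType;
  rdim : irreps -> nat;
  rep : forall r, mx_representation R[i] [set: gT]%G (rdim r);
  rep_unitary : forall r g, rep r g \is unitarymx;
  rep_irr : forall r, mx_irreducible (rep r);
  rep_inj : forall r r', mx_rsim (rep r) (rep r') -> r = r';
  rep_complete : forall m (rG : mx_representation R[i] [set: gT]%G m),
    (forall g, rG g \is unitarymx) -> mx_irreducible rG ->
    exists r, mx_rsim rG (rep r) }.

Section Cocycle.
Context {R : realType} {gT : finGroupType} {M H Q : topologicalType}.
Variables (GH : groupoid M H) (GQ : groupoid M Q).
Variables (iota : M -> gT -> H) (sigma : Q -> H).
Variable D : unitary_dual R gT.
(* [qact q r] is q([r]); [T q r r'] : V_r -> V_r' only matters for r' = q([r]),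
   the free index r' avoids casts along (q1 q2)([r]) = q2(q1([r])). *)
Variable qact : Q -> D -> D.
Variable T : forall (q : Q) (r r' : D), 'M[R[i]]_(rdim r', rdim r).

(* The third clause also says that q([r]) is the class of r o Ad_sigma(q). *)
Definition is_intertwiner : Prop :=
  [/\ (forall q r, T q r (qact q r) *m (T q r (qact q r))^t* = 1%:M),
      (forall q r, (T q r (qact q r))^t* *m T q r (qact q r) = 1%:M),
      (forall q r g, rep r (Ad GH GQ iota sigma q g) =
         (T q r (qact q r))^t* *m rep (qact q r) g *m T q r (qact q r)),
      (forall q r, \forall q' \near q,
         qact q' r = qact q r /\ T q' r (qact q r) = T q r (qact q r)) &
      (forall x r, T (gunit GQ x) r r = 1%:M)].

Definition is_cocycle_of (c : D -> Q -> Q -> R[i]) : Prop :=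
  forall r q1 q2, composable GQ q1 q2 ->
    let r1 := qact q1 r in let r2 := qact q2 r1 in
    `|c r q1 q2| = 1 /\
    T q2 r1 r2 *m T q1 r r1 =
      c r q1 q2 *: (T (gmul GQ q1 q2) r r2 *m
                    invmx (rep r (tau GH GQ iota sigma q1 q2))).

Definition dual_groupoid :
    groupoid (discrete_topology D * M)%type (discrete_topology D * Q)%type :=
  Groupoid
    (fun a => (a.1, src GQ a.2))
    (fun a => (qact a.2 a.1, tgt GQ a.2))
    (fun o => (o.1, gunit GQ o.2))
    (fun a => (qact a.2 a.1, ginv GQ a.2))
    (fun a b => (a.1, gmul GQ a.2 b.2)).

Definition dual_cocycle (c : D -> Q -> Q -> R[i])
    (a b : discrete_topology D * Q) : R[i] := c a.1 a.2 b.2.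

End Cocycle.

(* A unital K-algebra as a ring with a central morphism from K. Unlike in
   [algType K], the zero algebra is allowed, so that stalks may vanish. *)
Record unital_algebra (K : pzRingType) := UnitalAlgebra {
  ualg_ring :> pzRingType;
  ualg_in : {rmorphism K -> ualg_ring};
  ualg_central : forall k a, ualg_in k * a = a * ualg_in k }.

Definition ascale (K : pzRingType) (B : unital_algebra K) (k : K) (a : B) : B :=
  ualg_in B k * a.

Section Sheaves.
Context {K : pzRingType}.

(* A sheaf is given through its stalks: [sections U a] says that a restricted
   to U is the family of germs of a section over the open set U; the values of
   a outside U are irrelevant. The third and fourth laws say that the stalk at
   x is the colimit of the section spaces over the neighbourhoods of x. *)
Record alg_sheaf (X : topologicalType) := AlgSheaf {
  stalk : X -> unital_algebra K;
  sections : set X -> (forall x, stalk x) -> Prop }.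

Arguments sections {X} _ _ _.

Definition is_alg_sheaf (X : topologicalType) (A : alg_sheaf X) : Prop :=
  [/\ (forall U V (a b : forall x, stalk A x), open U -> open V -> V `<=` U ->
         (forall x, V x -> a x = b x) -> sections A U a -> sections A V b),
      (forall U (a : forall x, stalk A x), open U ->
         (forall x, U x ->
            exists V, [/\ open V, V x, V `<=` U & sections A V a]) ->
         sections A U a),
      (forall x (a0 : stalk A x), exists V a,
         [/\ open V, V x, sections A V a & a x = a0]),
      (forall U (a b : forall x, stalk A x) x, open U -> U x ->
         sections A U a -> sections A U b -> a x = b x ->
         \forall y \near x, a y = b y) &
      (forall U, open U ->
        [/\ sections A U (fun x => 1 : stalk A x),
            (forall (k : K) a b, sections A U a -> sections A U b ->
               sections A U (fun x => ascale k (a x) + b x)) &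
            (forall a b, sections A U a -> sections A U b ->
               sections A U (fun x => a x * b x))])].

Definition pullback (X Y : topologicalType) (f : Y -> X) (A : alg_sheaf X) :
    alg_sheaf Y :=
  @AlgSheaf Y (fun y => stalk A (f y)) (fun U a =>
    forall y, U y -> exists V b, [/\ open V, V (f y), sections A V b &
      \forall y' \near y, a y' = b (f y')]).

(* Transport between equal stalks; junk value 0 when x <> y. *)
Definition tr (X : topologicalType) (A : alg_sheaf X) (x y : X)
    (a : stalk A x) : stalk A y :=
  match x =P y with
  | ReflectT e => eq_rect x (fun z => stalk A z) a y e
  | ReflectF _ => 0
  end.

Arguments tr {X A x} y a.

Section GSheaf.
Context {X0 X1 : topologicalType} (G : groupoid X0 X1) (A : alg_sheaf X0).

Definition arrow_action :=
  forall g : X1, stalk A (tgt G g) -> stalk A (src G g).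

Definition is_gsheaf (act : arrow_action) : Prop :=
  [/\ is_alg_sheaf A,
      (forall g, [/\ act g 1 = 1,
         (forall (k : K) a b,
            act g (ascale k a + b) = ascale k (act g a) + act g b) &
         (forall a b, act g (a * b) = act g a * act g b)]),
      (forall x (a : stalk A x), tr x (act (gunit G x) (tr _ a)) = a),
      (forall g h, composable G g h -> forall a : stalk A (tgt G h),
         tr (src G g) (act (gmul G g h) (tr _ a)) =
         act g (tr _ (act h a))) &
      (forall V b, open V -> sections A V b ->
         sections (pullback (src G) A) (tgt G @^-1` V)
           (fun g => act g (b (tgt G g))))].

End GSheaf.

Definition action_via (M H Q : topologicalType) (GH : groupoid M H)
    (GQ : groupoid M Q) (j : H -> Q) (A : alg_sheaf M)
    (act : arrow_action GQ A) : arrow_action GH A :=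
  fun h a => tr (src GH h) (act (j h) (tr (tgt GQ (j h)) a)).

End Sheaves.

Arguments tr {K X A x} y a.
Arguments sections {K X} _ _ _.

(* All vector spaces are presented as subspaces of an ambient vector space;
   operations are only relevant on the subspaces. *)
Section Morita.
Context {K : pzRingType}.

Record space := Space {
  ambient :> lmodType K;
  carrier : set ambient }.

Definition is_space (V : space) : Prop :=
  carrier (0 : V) /\
  forall (k : K) (u v : V), carrier u -> carrier v -> carrier (k *: u + v).

Definition linear_on (V W : space) (f : V -> W) : Prop :=
  (forall v, carrier v -> carrier (f v)) /\
  forall (k : K) (u v : V), carrier u -> carrier v ->
    f (k *: u + v) = k *: f u + f v.

Definition bilinear_on (U V W : space) (b : U -> V -> W) : Prop :=
  (forall u, carrier u -> linear_on (b u)) /\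
  (forall v, carrier v -> linear_on (b^~ v)).

Record algebra := Algebra {
  alg_space :> space;
  amul : alg_space -> alg_space -> alg_space }.

Definition is_algebra (A : algebra) : Prop :=
  [/\ is_space A, bilinear_on (@amul A) &
      forall a b c : A, carrier a -> carrier b -> carrier c ->
        amul a (amul b c) = amul (amul a b) c].

Record bimodule (A B : algebra) := Bimodule {
  bim_space :> space;
  lact : A -> bim_space -> bim_space;
  ract : bim_space -> B -> bim_space }.

Definition is_bimodule (A B : algebra) (P : bimodule A B) : Prop :=
  [/\ is_space P,
      bilinear_on (lact (b := P)) /\ bilinear_on (ract (b := P)),
      (forall (a a' : A) (p : P), carrier a -> carrier a' -> carrier p ->
         lact a (lact a' p) = lact (amul a a') p),
      (forall (p : P) (b b' : B), carrier p -> carrier b -> carrier b' ->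
         ract (ract p b) b' = ract p (amul b b')) &
      (forall (a : A) (p : P) (b : B), carrier a -> carrier p -> carrier b ->
         ract (lact a p) b = lact a (ract p b))].

Definition regular_bimodule (A : algebra) : bimodule A A :=
  @Bimodule A A A (@amul A) (@amul A).

Definition balanced (A B C : algebra) (P : bimodule A B) (P' : bimodule B C)
    (V : space) (t : P -> P' -> V) : Prop :=
  bilinear_on t /\
  forall (p : P) (b : B) (p' : P'), carrier p -> carrier b -> carrier p' ->
    t (ract p b) p' = t p (lact b p').

(* Among balanced maps on P x P'; the uniqueness is on the carrier of V. *)
Definition is_universal (A B C : algebra) (P : bimodule A B)
    (P' : bimodule B C) (V : space) (t : P -> P' -> V) : Prop :=
  forall (W : space) (u : P -> P' -> W), is_space W -> balanced u ->
    exists f : V -> W,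
      [/\ linear_on f,
          (forall p p', carrier p -> carrier p' -> f (t p p') = u p p') &
          forall f' : V -> W, linear_on f' ->
            (forall p p', carrier p -> carrier p' -> f' (t p p') = u p p') ->
            forall v, carrier v -> f' v = f v].

(* (V, t) is the tensor product of P and P' over B with its A-C-bimodule
   structure *)
Definition is_tensor_product (A B C : algebra) (P : bimodule A B)
    (P' : bimodule B C) (V : bimodule A C) (t : P -> P' -> V) : Prop :=
  [/\ is_bimodule V, balanced t,
      (forall (a : A) (p : P) (p' : P'), carrier a -> carrier p -> carrier p' ->
         t (lact a p) p' = lact a (t p p')),
      (forall (p : P) (p' : P') (c : C), carrier p -> carrier p' -> carrier c ->
         t p (ract p' c) = ract (t p p') c) &
      is_universal t].

Definition bimodule_iso (A B : algebra) (P P' : bimodule A B) : Prop :=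
  exists (f : P -> P') (g : P' -> P),
    [/\ linear_on f /\ linear_on g,
        (forall p, carrier p -> g (f p) = p),
        (forall p', carrier p' -> f (g p') = p'),
        (forall (a : A) p, carrier a -> carrier p ->
           f (lact a p) = lact a (f p)) &
        (forall p (b : B), carrier p -> carrier b ->
           f (ract p b) = ract (f p) b)].

Definition morita_equivalent (A B : algebra) : Prop :=
  [/\ is_algebra A, is_algebra B &
      exists (P : bimodule A B) (P' : bimodule B A)
             (V : bimodule A A) (t : P -> P' -> V)
             (W : bimodule B B) (u : P' -> P -> W),
        [/\ is_bimodule P /\ is_bimodule P',
            is_tensor_product t /\ bimodule_iso V (regular_bimodule A) &
            is_tensor_product u /\ bimodule_iso W (regular_bimodule B)]].

(* The multiplication induces an isomorphism of A (x)_A A onto A. This is the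
   algebraic part of quasi-unitality, and holds for algebras with local
   units. *)
Definition self_induced (A : algebra) : Prop :=
  is_universal (P := regular_bimodule A) (P' := regular_bimodule A)
    (@amul A).

End Morita.

Arguments space : clear implicits.
Arguments algebra : clear implicits.

Section CrossedProduct.
Context {K : pzRingType}.

Definition germ_family (X : topologicalType) (A : alg_sheaf (K := K) X) :
    Type := forall x, stalk A x.

Section Lmod.
Context {X : topologicalType} (A : alg_sheaf (K := K) X).
Local Notation F := (germ_family A).

HB.instance Definition _ := gen_eqMixin F.
HB.instance Definition _ := gen_choiceMixin F.

Let add (a b : F) : F := fun x => a x + b x.
Let opp (a : F) : F := fun x => - a x.
Let zero : F := fun x => 0.
Let scale (k : K) (a : F) : F := fun x => ascale k (a x).

Let addA : associative add.
Proof.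
move=> a b c; apply: functional_extensionality_dep => x; exact: addrA.
Qed.
Let addC : commutative add.
Proof.
move=> a b; apply: functional_extensionality_dep => x; exact: addrC.
Qed.
Let add0 : left_id zero add.
Proof.
move=> a; apply: functional_extensionality_dep => x; exact: add0r.
Qed.
Let addN : left_inverse zero opp add.
Proof.
move=> a; apply: functional_extensionality_dep => x; exact: addNr.
Qed.

HB.instance Definition _ := GRing.isZmodule.Build F addA addC add0 addN.

Let scaleA k l a : scale k (scale l a) = scale (k * l) a.
Proof.
apply: functional_extensionality_dep => x.
by rewrite /scale /ascale rmorphM mulrA.
Qed.
Let scale1 : left_id 1 scale.
Proof.
move=> a; apply: functional_extensionality_dep => x.
by rewrite /scale /ascale rmorph1 mul1r.
Qed.
Let scaleDr : right_distributive scale +%R.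
Proof.
move=> k a b; apply: functional_extensionality_dep => x; exact: mulrDr.
Qed.
Let scaleDl a : {morph scale^~ a : k l / k + l}.
Proof.
move=> k l; apply: functional_extensionality_dep => x.
by rewrite /scale /ascale rmorphD mulrDl.
Qed.

HB.instance Definition _ :=
  GRing.Zmodule_isLmodule.Build K F scaleA scale1 scaleDr scaleDl.

End Lmod.

Section Product.
Context {X0 X1 : topologicalType} (G : groupoid X0 X1).
Variables (A : alg_sheaf (K := K) X0) (act : arrow_action G A)
  (c : X1 -> X1 -> K).

Definition cpt_sections : space K :=
  @Space K (germ_family (pullback (src G) A))
    [set a | sections (pullback (src G) A) setT a /\
             compact (closure [set g | a g <> 0])].

Definition convolution (a1 a2 : cpt_sections) : cpt_sections :=
  fun g => \sum_(p \in [set p : X1 * X1 |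
                        composable G p.1 p.2 /\ gmul G p.1 p.2 = g])
    ascale (c p.1 p.2)
      ((tr (src G g) (a1 p.1 : stalk A (src G p.1)) : stalk A (src G g)) *
       tr (src G g) (@act p.1
         (tr (tgt G p.1) (a2 p.2 : stalk A (src G p.2))))).

Definition twisted_crossed_product : algebra K := Algebra convolution.

End Product.

Definition crossed_product (X0 X1 : topologicalType) (G : groupoid X0 X1)
    (A : alg_sheaf (K := K) X0) (act : arrow_action G A) : algebra K :=
  twisted_crossed_product act (fun _ _ => 1).

End CrossedProduct.

Section DualSheaf.
Context {K : pzRingType} {R : realType} {gT : finGroupType}.
Context {M Q : topologicalType} (GQ : groupoid M Q).
Variables (D : unitary_dual R gT) (qact : Q -> D -> D).
Variables (A : alg_sheaf (K := K) M) (act : arrow_action GQ A).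

Definition dual_sheaf : alg_sheaf (K := K) (discrete_topology D * M)%type :=
  pullback snd A.

Definition dual_action : arrow_action (dual_groupoid GQ qact) dual_sheaf :=
  fun a => @act a.2.

End DualSheaf.

(* Main.v *)
Require Import Defs.
From mathcomp Require Import all_boot all_order all_algebra all_fingroup.
From mathcomp Require Import mxrepresentation spectral complex.
From mathcomp Require Import finmap all_classical all_reals all_analysis.
From mathcomp Require Import ring.

(** The extension M x G -> H -> Q splits over the arrows: through sigma, every
    arrow of H is g sigma(q) for a unique g in G and q = j(h). So a function on
    H is a function of (g, q), and the Fourier transform of the finite group G in
    the variable g turns it into a family of matrices a(r, q) in End(V_r), r
    running over the irreducible representations. After multiplication by
    T_q^-1 the matrix a(r, q) becomes a map V_(q r) -> V_r, and the defining
    relations of T and of the cocycle c say exactly that the convolution of H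
    becomes matrix multiplication combined with the c-twisted convolution of
    the dual groupoid. The crossed product by H is thus an algebra of matrices,
    of sizes the dimensions of the V_r, over the twisted crossed product B.

    It is convenient to express this without matrices. The group algebra C[G]
    acts on A = A x H by multipliers, through left and right translation by the
    kernel. Choose a line in every V_r and let e in C[G] be the idempotent that
    projects every V_r onto its line. Then B is the corner e A e: the maps phi and
    psi are the Fourier inversion formula and the Fourier transform for the
    coefficient of the chosen line. The facts used are psi phi = id
    (psi_phi), phi psi = e (-) e (phi_psi) and that phi is multiplicative
    (phi_mul), all consequences of Schur orthogonality (orthogonality,
    orthogonality_eq). The corner is full, because the identity of C[G] is a sum
    of products u_i e v_i (sum_to_from_corner); this is the completeness of the
    irreducible unitary representations (unitary_rep_separates, sum_characters).

    A full corner of a ring with unit is Morita equivalent to the ring, through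
    P = A e and P' = e A. Here A need not have a unit; self-inducedness replaces
    it: bilinear maps that are balanced over e A e on A e x e A extend to
    balanced maps on A x A, which factor through A (corner_morita).

    What remains is that everything stays inside compactly supported sections.
    The convolution of two sections is a finite sum locally, because src is
    a local homeomorphism and the supports are compact (fibre_near,
    sec_groupoid_conv). All other maps are finite sums of pullbacks along proper
    continuous maps over M with locally constant coefficients (csec_pull); for
    phi this uses that the group part of an arrow is locally constant
    (gpart_locally_constant). *)

Set Implicit Arguments.
Unset Strict Implicit.
Unset Printing Implicit Defensive.

Import Order.TTheory GRing.Theory Num.Theory.

Local Open Scope classical_set_scope.
Local Open Scope ring_scope.
Local Open Scope complex_scope.
Local Open Scope sesquilinear_scope.

Local Notation space := Defs.space.
Local Notation algebra := Defs.algebra.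

(** * Linear maps between subspaces *)

Section SubspaceMaps.
Context {K : pzRingType}.
Implicit Types U V W : space K.

Lemma space0 V : is_space V -> carrier (0 : V).
Proof. by case. Qed.

Lemma spaceD V (u v : V) : is_space V ->
  carrier u -> carrier v -> carrier (u + v).
Proof. by case=> _ h cu cv; have := h 1 u v cu cv; rewrite scale1r. Qed.

Lemma space_sum V (I : finType) (u : I -> V) : is_space V ->
  (forall i, carrier (u i)) -> carrier (\sum_i u i).
Proof.
move=> sV cu; elim/big_ind: _ => //; first exact: space0.
by move=> x y; exact: spaceD.
Qed.

Lemma linear_on0 V W (f : V -> W) : is_space V -> linear_on f -> f 0 = 0.
Proof.
move=> sV [_ f_lin]; have := f_lin 1 0 0 (space0 sV) (space0 sV).
rewrite !scale1r addr0 => f00.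
by apply: (@addrI _ (f 0)); rewrite addr0 -f00.
Qed.

Lemma linear_onD V W (f : V -> W) (u v : V) : linear_on f ->
  carrier u -> carrier v -> f (u + v) = f u + f v.
Proof. by case=> _ h cu cv; have := h 1 u v cu cv; rewrite !scale1r. Qed.

Lemma linear_on_sum V W (f : V -> W) (I : finType) (u : I -> V) :
  is_space V -> linear_on f -> (forall i, carrier (u i)) ->
  f (\sum_i u i) = \sum_i f (u i).
Proof.
move=> sV lf cu.
suff [] : carrier (\sum_i u i) /\ f (\sum_i u i) = \sum_i f (u i) by [].
elim/big_rec2: _ => [|i y x _ [cx fx]].
  by split; [exact: space0 | exact: linear_on0].
by split; [exact: spaceD | rewrite linear_onD // fx].
Qed.

Lemma linear_on_comp U V W (f : V -> W) (g : U -> V) :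
  linear_on f -> linear_on g -> linear_on (f \o g).
Proof.
move=> [cf lf] [cg lg]; split=> [u /cg/cf //|k u v cu cv] /=.
by rewrite lg // lf //; exact: cg.
Qed.

Lemma bilinear_on_sum U V W (I : finType) (b : I -> U -> V -> W) :
  is_space W -> (forall i, bilinear_on (b i)) ->
  bilinear_on (fun u v => \sum_i b i u v).
Proof.
move=> sW hb; split=> [u cu|v cv]; split.
- by move=> v cv; apply: space_sum => // i; case: ((hb i).1 u cu) => + _; apply.
- move=> k v v' cv cv'; rewrite scaler_sumr -big_split /=.
  by apply: eq_bigr => i _; case: ((hb i).1 u cu) => _; apply.
- by move=> u cu; apply: space_sum => // i; case: ((hb i).2 v cv) => + _; apply.
- move=> k u u' cu cu'; rewrite scaler_sumr -big_split /=.
  by apply: eq_bigr => i _; case: ((hb i).2 v cv) => _; apply.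
Qed.

Lemma bilinear_on_comp U V W U' V' (b : U -> V -> W) (f : U' -> U)
    (g : V' -> V) :
  bilinear_on b -> linear_on f -> linear_on g ->
  bilinear_on (fun u v => b (f u) (g v)).
Proof.
move=> [b1 b2] lf lg; split=> [u cu|v cv].
  by apply: linear_on_comp lg; apply: b1; apply: lf.1.
by apply: (@linear_on_comp _ _ _ (b^~ (g v)) f) => //; apply: b2; apply: lg.1.
Qed.

(** Self-inducedness replaces a unit: it makes the products span, in the form
    that a linear map is determined by its values on products. *)
Lemma self_induced_ext (A : algebra K) (W : space K) (f g : A -> W) :
  is_algebra A -> self_induced A -> is_space W ->
  linear_on f -> linear_on g ->
  (forall a b, carrier a -> carrier b -> f (amul a b) = g (amul a b)) ->
  forall a, carrier a -> f a = g a.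
Proof.
move=> [sA bilA assA] siA sW lf lg fg a ca.
have bal : @balanced _ A A A (regular_bimodule A) (regular_bimodule A) W
    (fun x y => f (amul x y)).
  split; last by move=> x b y cx cb cy /=; rewrite assA.
  split=> [u cu|v cv].
    by apply: linear_on_comp lf _; apply: bilA.1.
  exact: (@linear_on_comp A A W f (fun x => amul x v) lf (bilA.2 v cv)).
have [h [lh hE huniq]] := siA W _ sW bal.
have := huniq f lf (fun x y _ _ => erefl) a ca.
by move=> ->; rewrite -(huniq g lg) // => x y cx cy; rewrite fg.
Qed.

End SubspaceMaps.

(** * A full corner of a self-induced algebra *)

Section Corner.
Context {K : pzRingType} (A B : algebra K).
(** The elements of X act on A as multipliers, from the left by L and from the
    right by Rt. The algebra B is identified with the corner e A e by phi, and
    psi is the compression to the corner followed by the inverse of phi. *)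
Variables (X : Type) (op : X -> X -> X) (L : X -> A -> A) (Rt : A -> X -> A).
Variables (e : X) (I : finType) (u v : I -> X).
Variables (phi : B -> A) (psi : A -> B).

Hypothesis algA : is_algebra A.
Hypothesis siA : self_induced A.
Hypothesis linL : forall x, linear_on (L x).
Hypothesis linR : forall x, linear_on (Rt^~ x).
Hypothesis L_op : forall x y a, carrier a -> L (op x y) a = L x (L y a).
Hypothesis R_op : forall x y a, carrier a -> Rt a (op x y) = Rt (Rt a x) y.
Hypothesis L_R : forall x y a, carrier a -> L x (Rt a y) = Rt (L x a) y.
Hypothesis L_mul : forall x a b, carrier a -> carrier b ->
  L x (amul a b) = amul (L x a) b.
Hypothesis R_mul : forall y a b, carrier a -> carrier b ->
  Rt (amul a b) y = amul a (Rt b y).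
Hypothesis LR_mul : forall x a b, carrier a -> carrier b ->
  amul (Rt a x) b = amul a (L x b).
Hypothesis ee : op e e = e.
Hypothesis ue : forall i, op (u i) e = u i.
Hypothesis ev : forall i, op e (v i) = v i.
Hypothesis uv : forall a, carrier a -> \sum_i L (op (u i) (v i)) a = a.
Hypothesis lin_phi : linear_on phi.
Hypothesis lin_psi : linear_on psi.
Hypothesis psi_phi : forall b, carrier b -> psi (phi b) = b.
Hypothesis phi_psi : forall a, carrier a -> phi (psi a) = L e (Rt a e).
Hypothesis sB : is_space B.
Hypothesis phi_mul : forall b b', carrier b -> carrier b' ->
  psi (amul (phi b) (phi b')) = amul b b'.

Let sA : is_space A. Proof. by case: algA. Qed.
Let bilA : bilinear_on (@amul _ A). Proof. by case: algA. Qed.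
Let assA (a b c : A) : carrier a -> carrier b -> carrier c ->
  amul a (amul b c) = amul (amul a b) c.
Proof. by case: algA => _ _; apply. Qed.
Let cL x a : carrier a -> carrier (L x a). Proof. exact: (linL x).1. Qed.
Let cR x a : carrier a -> carrier (Rt a x). Proof. exact: (linR x).1. Qed.
Let cM (a b : A) : carrier a -> carrier b -> carrier (amul a b).
Proof. by move=> ca; apply: (bilA.1 a ca).1. Qed.
Let cphi b : carrier b -> carrier (phi b). Proof. exact: lin_phi.1. Qed.
Let cpsi a : carrier a -> carrier (psi a). Proof. exact: lin_psi.1. Qed.

Let LeLe a : carrier a -> L e (L e a) = L e a.
Proof. by move=> ca; rewrite -L_op // ee. Qed.
Let ReRe a : carrier a -> Rt (Rt a e) e = Rt a e.
Proof. by move=> ca; rewrite -R_op // ee. Qed.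

Let phiE b : carrier b -> L e (Rt (phi b) e) = phi b.
Proof. by move=> cb; rewrite -phi_psi ?psi_phi//; exact: cphi. Qed.
Let Le_phi b : carrier b -> L e (phi b) = phi b.
Proof. by move=> cb; rewrite -{1}phiE// LeLe ?phiE//; exact/cR/cphi. Qed.
Let Re_phi b : carrier b -> Rt (phi b) e = phi b.
Proof.
move=> cb; have cb' := cphi cb.
by rewrite -{1}phiE// L_R// ReRe ?L_R -?L_R ?phiE//; exact: cL.
Qed.

Let phi_amul b b' : carrier b -> carrier b' ->
  phi (amul b b') = amul (phi b) (phi b').
Proof.
move=> cb cb'; have [cp cp'] := (cphi cb, cphi cb').
rewrite -phi_mul // phi_psi; last exact: cM.
by rewrite R_mul // Re_phi // L_mul // Le_phi.
Qed.

Let bil_comp (V W : space K) (f : V -> A) (g : W -> A) :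
  linear_on f -> linear_on g -> bilinear_on (fun x y => amul (f x) (g y)).
Proof. by move=> lf lg; exact: (@bilinear_on_comp _ A A A V W _ f g). Qed.

Let lin_id (V : space K) : linear_on (fun x : V => x). Proof. by []. Qed.

(** The product of B is that of A, compressed; so the laws of B are inherited. *)
Lemma corner_is_algebra : is_algebra B.
Proof.
have cB (b b' : B) : carrier b -> carrier b' -> carrier (amul b b').
  by move=> cb cb'; rewrite -phi_mul //; apply/cpsi/cM; exact: cphi.
have [b1 b2] := bil_comp lin_phi lin_phi.
split=> //; last first.
  move=> a b c ca cb cc.
  rewrite -(psi_phi (cB _ _ ca (cB _ _ cb cc))).
  rewrite -(psi_phi (cB _ _ (cB _ _ ca cb) cc)).
  rewrite !phi_amul ?assA //; by [exact: cphi|exact: cB].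
split=> [u0 cu|v0 cv]; split.
- by move=> w cw; exact: cB.
- move=> k w w' cw cw'; have [cl ll] := linear_on_comp lin_psi (b1 _ cu).
  by have := ll k w w' cw cw'; rewrite /= !phi_mul //; apply: sB.2.
- by move=> w cw; exact: cB.
- move=> k w w' cw cw'; have [cl ll] := linear_on_comp lin_psi (b2 _ cv).
  by have := ll k w w' cw cw'; rewrite /= !phi_mul //; apply: sB.2.
Qed.

Let P_space : space K := Defs.Space [set a : A | carrier a /\ Rt a e = a].
Let P : bimodule A B :=
  @Bimodule _ A B P_space (@amul _ A) (fun p b => amul p (phi b)).
Let P'_space : space K := Defs.Space [set a : A | carrier a /\ L e a = a].
Let P' : bimodule B A :=
  @Bimodule _ B A P'_space (fun b p => amul (phi b) p) (@amul _ A).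

Let linP : linear_on (fun x : P => x : A).
Proof. by split=> // x []. Qed.
Let linP' : linear_on (fun x : P' => x : A).
Proof. by split=> // x []. Qed.

Let sP : is_space P.
Proof.
split=> [|k a b [ca ea] [cb eb]].
  by split; [exact: space0 | exact: (linear_on0 sA (linR e))].
by split; [exact: sA.2 | rewrite (linR e).2 // ea eb].
Qed.
Let sP' : is_space P'.
Proof.
split=> [|k a b [ca ea] [cb eb]].
  by split; [exact: space0 | exact: (linear_on0 sA (linL e))].
by split; [exact: sA.2 | rewrite (linL e).2 // ea eb].
Qed.

Let bimP : is_bimodule P.
Proof.
have [a1 a2] := bil_comp (lin_id A) linP.
have [b1 b2] := bil_comp linP lin_phi.
have cl (a : A) (p : P) : carrier a -> carrier p -> carrier (amul a p : P).
  by move=> ca [cp ep]; split; [exact: cM | rewrite R_mul // ep].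
have cr (p : P) (b : B) : carrier p -> carrier b ->
    carrier (amul p (phi b) : P).
  by move=> [cp ep] cb; apply: cl => //; split; [exact: cphi | exact: Re_phi].
split=> //.
- split; split=> [x cx|x cx]; split.
  + by move=> y cy; exact: cl.
  + by move=> k y y' cy cy'; apply: (a1 x cx).2.
  + by move=> y cy; exact: cl.
  + by move=> k y y' cy cy'; apply: (a2 x cx).2.
  + by move=> y cy; exact: cr.
  + by move=> k y y' cy cy'; apply: (b1 x cx).2.
  + by move=> y cy; exact: cr.
  + by move=> k y y' cy cy'; apply: (b2 x cx).2.
- by move=> a a' p ca ca' [cp _] /=; rewrite assA.
- move=> p b b' [cp _] cb cb' /=.
  by rewrite phi_amul // assA //; exact: cphi.
- by move=> a p b ca [cp _] cb /=; rewrite assA //; exact: cphi.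
Qed.

Let bimP' : is_bimodule P'.
Proof.
have [a1 a2] := bil_comp linP' (lin_id A).
have [b1 b2] := bil_comp lin_phi linP'.
have cr (p : P') (a : A) : carrier p -> carrier a -> carrier (amul p a : P').
  by move=> [cp ep] ca; split; [exact: cM | rewrite L_mul // ep].
have cl (b : B) (p : P') : carrier b -> carrier p ->
    carrier (amul (phi b) p : P').
  move=> cb [cp _]; apply: cr => //.
  by split; [exact: cphi | exact: Le_phi].
split=> //.
- split; split=> [x cx|x cx]; split.
  + by move=> y cy; exact: cl.
  + by move=> k y y' cy cy'; apply: (b1 x cx).2.
  + by move=> y cy; exact: cl.
  + by move=> k y y' cy cy'; apply: (b2 x cx).2.
  + by move=> y cy; exact: cr.
  + by move=> k y y' cy cy'; apply: (a1 x cx).2.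
  + by move=> y cy; exact: cr.
  + by move=> k y y' cy cy'; apply: (a2 x cx).2.
- move=> b b' p cb cb' [cp _] /=.
  by rewrite phi_amul // assA //; exact: cphi.
- by move=> p a a' [cp _] ca ca' /=; rewrite assA.
- by move=> b p a cb [cp _] ca /=; rewrite assA //; exact: cphi.
Qed.

(** Fullness of the corner factors every product of A through P and P'. *)
Let split_mul a b : carrier a -> carrier b ->
  \sum_i amul (Rt a (u i)) (L (v i) b) = amul a b.
Proof.
move=> ca cb; rewrite -[in RHS](uv cb) (linear_on_sum sA (bilA.1 a ca)).
  by apply: eq_bigr => i _; rewrite LR_mul ?L_op //; exact: cL.
by move=> i; exact: cL.
Qed.

Let cRu a i : carrier a -> carrier (Rt a (u i) : P).
Proof. by move=> ca; split; [exact: cR | rewrite -R_op // ue]. Qed.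
Let cLv a i : carrier a -> carrier (L (v i) a : P').
Proof. by move=> ca; split; [exact: cL | rewrite -L_op // ev]. Qed.

(** A map w that is balanced on P x P' extends to the A-balanced map
    (a, b) |-> sum_i w (a u_i) (v_i b) on A x A, which factors through the
    product of A. That the factorisation restricts to w on P x P' is checked on
    products, where b can be moved across w. *)
Let t_univ : @is_universal _ A B A P P' A (@amul _ A).
Proof.
move=> W w sW [bw balw].
pose w' (a b : A) : W := \sum_i w (Rt a (u i)) (L (v i) b).
have bw' : bilinear_on w'.
  apply: bilinear_on_sum => // i.
  apply: (@bilinear_on_comp _ P P' W A A w (Rt^~ (u i)) (L (v i))) => //.
    by split=> [a ca|]; [exact: cRu | exact: (linR (u i)).2].
  by split=> [a ca|]; [exact: cLv | exact: (linL (v i)).2].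
have balw' a x b : carrier a -> carrier x -> carrier b ->
    w' (amul a x) b = w' a (amul x b).
  move=> ca cx cb; pose be l i := L (v l) (Rt x (u i)).
  have cbe l i : carrier (be l i) by exact/cL/cR.
  have phibe l i : phi (psi (be l i)) = be l i.
    rewrite phi_psi // /be -L_R; last exact: cR.
    by rewrite -R_op // ue -L_op ?ev //; exact: cR.
  have cRbe l i : carrier (amul (Rt a (u l)) (be l i) : P).
    by rewrite -phibe; have [_ [_ [+ _]] _ _ _] := bimP;
       move=> /(_ _ (cRu l ca)) [+ _]; apply; exact/cpsi.
  have cbeL l i : carrier (amul (be l i) (L (v i) b) : P').
    by rewrite -phibe; have [_ [[+ _] _] _ _ _] := bimP';
       move=> /(_ _ (cpsi (cbe l i))) [+ _]; apply; exact/cLv.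
  have -> : w' (amul a x) b = \sum_i \sum_l
      w (amul (Rt a (u l)) (be l i)) (L (v i) b).
    apply: eq_bigr => i _; rewrite R_mul // -(split_mul ca (cR _ cx)).
    exact: (linear_on_sum sP (bw.2 _ (cLv i cb)) (cRbe^~ i)).
  rewrite exchange_big /=; apply: eq_bigr => l _.
  have -> : L (v l) (amul x b) = \sum_i amul (be l i) (L (v i) b).
    rewrite -(split_mul cx cb) (linear_on_sum sA (linL (v l))); last first.
      by move=> i; apply: cM; [exact: cR | exact: cL].
    by apply: eq_bigr => i _; rewrite L_mul //; [exact: cR | exact: cL].
  rewrite (linear_on_sum sP' (bw.1 _ (cRu l ca))) //.
  apply: eq_bigr => i _; rewrite -phibe.
  by apply: balw; [exact: cRu | exact: cpsi | exact: cLv].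
have [f [lf fE funiq]] := siA sW (conj bw' balw').
have linRe : linear_on (fun a : A => Rt a e : P).
  by split=> [a ca|]; [split; [exact: cR | exact: ReRe] | exact: (linR e).2].
exists f; split=> // [p p' cp cp'|g lg gE].
  have [[cAp ep] [cAp' ep']] := (cp, cp').
  rewrite -[in LHS]ep -[in RHS]ep.
  apply: (self_induced_ext (f := fun a => f (amul (Rt a e) p'))
    (g := fun a => w (Rt a e) p') algA siA sW) => //.
  - have := bil_comp (linR e) (lin_id A) => -[_ h].
    exact: linear_on_comp lf (h p' cAp').
  - exact: (linear_on_comp (bw.2 _ cp') linRe).
  move=> a b ca cb /=; rewrite R_mul // -assA //; last exact: cR.
  rewrite fE //; last by apply: cM => //; exact: cR.
  have -> : w (amul a (Rt b e)) p' =
      \sum_i w (amul (Rt a (u i)) (L (v i) (Rt b e))) p'.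
    rewrite -(split_mul ca (cR _ cb)).
    apply: (linear_on_sum sP (bw.2 _ cp')) => i.
    have cLR := cL (v i) (cR e cb); have cRa := cR (u i) ca.
    by split; [exact: cM | rewrite R_mul // -L_R ?ReRe //; exact: cR].
  apply: eq_bigr => i _.
  have phiz : phi (psi (L (v i) (Rt b e))) = L (v i) (Rt b e).
    rewrite phi_psi; last exact/cL/cR.
    rewrite -L_R; last exact: cR.
    by rewrite ReRe // -L_op ?ev //; exact: cR.
  rewrite L_mul //; last exact: cR.
  rewrite -phiz; symmetry; apply: balw => //; first exact: cRu.
  by apply: cpsi; exact/cL/cR.
apply: (self_induced_ext algA siA sW) => // a b ca cb.
rewrite fE // -(split_mul ca cb) (linear_on_sum sA lg).
  by apply: eq_bigr => i _; apply: gE; [exact: cRu | exact: cLv].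
by move=> i; apply: cM; [exact: cR | exact: cL].
Qed.

(** Here (a, b) |-> w (e a) (b e) is balanced over all of A at once. *)
Let u_univ : @is_universal _ B A B P' P B (fun p' p => psi (amul p' p)).
Proof.
move=> W w sW [bw balw].
have cLe a : carrier a -> carrier (L e a : P').
  by move=> ca; split; [exact: cL | exact: LeLe].
have cRe a : carrier a -> carrier (Rt a e : P).
  by move=> ca; split; [exact: cR | exact: ReRe].
have linLe : linear_on (fun a : A => L e a : P').
  by split=> //; exact: (linL e).2.
have linRe : linear_on (fun a : A => Rt a e : P).
  by split=> //; exact: (linR e).2.
have bw' := @bilinear_on_comp _ P' P W A A w _ _ bw linLe linRe.
have balw' (a x b : A) : carrier a -> carrier x -> carrier b ->
    w (L e (amul a x)) (Rt b e) = w (L e a) (Rt (amul x b) e).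
  by move=> ca cx cb; rewrite L_mul // R_mul //; apply: balw;
     [exact: cLe | | exact: cRe].
have [f [lf fE funiq]] := siA sW (conj bw' balw').
exists (fun b => f (phi b)); split.
- exact: linear_on_comp lf lin_phi.
- move=> p' p [cp' ep'] [cp ep]; have cpp := cM cp' cp.
  by rewrite phi_psi // R_mul // ep L_mul // ep' fE // ep ep'.
move=> g lg gE b cb.
have -> : g b = g (psi (L e (Rt (phi b) e))) by rewrite phiE // psi_phi.
apply: (self_induced_ext (f := fun a => g (psi (L e (Rt a e)))) (g := f)
  algA siA sW) => //; last exact: cphi.
  have lin1 := linear_on_comp (linL e) (linR e).
  exact: (linear_on_comp lg (linear_on_comp lin_psi lin1)).
move=> a1 a2 ca1 ca2 /=; rewrite fE // R_mul // L_mul ?gE //; last exact: cR.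
- exact: cLe.
- exact: cRe.
Qed.

Let t_tensor : @is_tensor_product _ A B A P P' (regular_bimodule A)
  (@amul _ A).
Proof.
split=> //.
- by split=> //; move=> *; rewrite /= assA.
- split; first exact: (bil_comp linP linP').
  by move=> p b p' [cp _] cb [cp' _] /=; rewrite assA //; exact: cphi.
- by move=> a p p' ca [cp _] [cp' _] /=; rewrite assA.
- by move=> p p' c [cp _] [cp' _] cc /=; rewrite assA.
Qed.

Let u_tensor : @is_tensor_product _ B A B P' P (regular_bimodule B)
  (fun p' p => psi (amul p' p)).
Proof.
have [_ bilB assB] := corner_is_algebra.
have phiu (p' : P') (p : P) : carrier p' -> carrier p ->
    phi (psi (amul p' p)) = amul p' p.
  move=> [cp' ep'] [cp ep]; have cpp := cM cp' cp.
  by rewrite phi_psi // R_mul // ep L_mul // ep'.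
split=> //.
- by split=> //; move=> *; rewrite /= assB.
- split.
    have [b1 b2] := bil_comp linP' linP.
    split=> [x cx|x cx]; first exact: (linear_on_comp lin_psi (b1 x cx)).
    exact: (linear_on_comp lin_psi (b2 x cx)).
  by move=> p' a p [cp' _] ca [cp _] /=; rewrite assA.
- move=> b p' p cb cp' cp; have [[cAp _] [cAp' _]] := (cp, cp').
  rewrite /= -phi_mul //; last by apply: cpsi; exact: cM.
  by rewrite phiu // assA //; exact: cphi.
- move=> p' p b cp' cp cb; have [[cAp _] [cAp' _]] := (cp, cp').
  rewrite /= -phi_mul //; last by apply: cpsi; exact: cM.
  by rewrite phiu // assA //; exact: cphi.
Qed.

(** The bimodules are A e and e A; both tensor products are realised by the
    product of A. *)
Lemma corner_morita : morita_equivalent A B.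
Proof.
have iso (C : algebra K) : bimodule_iso (regular_bimodule C) (regular_bimodule C).
  by exists id, id.
split=> //; first exact: corner_is_algebra.
exists P, P', (regular_bimodule A), (@amul _ A), (regular_bimodule B),
  (fun p' p => psi (amul p' p)); split=> //.
Qed.

End Corner.

(** * Schur orthogonality and completeness *)

Section Schur.
Context {C : numClosedFieldType} {gT : finGroupType}.
Local Notation reprG := (mx_representation C [set: gT]%G).

(** The kernel and the image of an intertwiner are invariant. *)
Lemma schur_rsim m n (rU : reprG m) (rV : reprG n) (f : 'M[C]_(m, n)) :
  mx_irreducible rU -> mx_irreducible rV ->
  (forall g, rU g *m f = f *m rV g) -> f != 0 -> mx_rsim rU rV.
Proof.
move=> /mx_irrP[_ irrU] /mx_irrP[_ irrV] fE f0.
have ffree : row_free f.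
  rewrite -kermx_eq0; apply: contraNT f0 => k0.
  have /irrU/(_ k0) : mxmodule rU (kermx f).
    apply/mxmoduleP => g _; apply/sub_kermxP.
    by rewrite -mulmxA fE mulmxA mulmx_ker mul0mx.
  by rewrite -sub1mx => /sub_kermxP; rewrite mul1mx => ->.
have ffull : row_full f.
  have f0' : <<f>>%MS != 0.
    by rewrite -submx0 genmxE submx0.
  have : mxmodule rV <<f>>%MS.
    apply/mxmoduleP => g _; rewrite genmxE.
    by rewrite (eqmxMr _ (genmxE f)) -fE submxMl.
  by move=> /irrV/(_ f0'); rewrite -!col_leq_rank genmxE.
exists f => //; apply/eqP; rewrite eqn_leq.
by move: (rank_leq_row f) (rank_leq_col f); rewrite (eqP ffree) => _ ->;
   rewrite -(eqP ffull) rank_leq_row.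
Qed.

(** An eigenspace of an intertwiner is invariant. *)
Lemma schur_scalar n (rU : reprG n) (f : 'M[C]_n) :
  mx_irreducible rU -> (forall g, rU g *m f = f *m rU g) ->
  f = (\tr f / n%:R)%:M.
Proof.
move=> irrU fE; have [n_gt0 irr] := (mx_irrP _).1 irrU.
have [a a_eig] := eigenvalue_closed f n_gt0.
suff fa : f = a%:M.
  by rewrite fa mxtrace_scalar -[X in _ = (X / _)%:M]mulr_natr mulfK//
     pnatr_eq0 -lt0n.
have /irr : mxmodule rU (eigenspace f a).
  apply/mxmoduleP => g _; apply/eigenspaceP.
  rewrite -mulmxA fE mulmxA (eigenspaceP (submx_refl _)).
  by rewrite -scalemxAl.
by move=> /(_ a_eig); rewrite -sub1mx => /eigenspaceP;
   rewrite mul1mx scalemx1.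
Qed.

End Schur.

Section Orthogonality.
Context {R : realType} {gT : finGroupType} (D : unitary_dual R gT).
Local Notation C := R[i].
Implicit Types r s : D.
Local Notation order := (#|gT|%:R : C).

Lemma rdim_gt0 r : (0 < rdim r)%N.
Proof. by have [] := (mx_irrP _).1 (rep_irr r). Qed.

Lemma rep_mul r g h : rep r (g * h)%g = rep r g *m rep r h.
Proof. by rewrite repr_mxM ?inE. Qed.

Lemma rep1 r : rep r 1%g = 1%:M. Proof. exact: repr_mx1. Qed.

Lemma average_intertwines r s (N : 'M[C]_(rdim r, rdim s)) g :
  rep r g *m (\sum_h rep r h *m N *m rep s h^-1%g) =
  (\sum_h rep r h *m N *m rep s h^-1%g) *m rep s g.
Proof.
rewrite mulmx_sumr mulmx_suml (reindex_inj (mulgI g^-1%g)).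
apply: eq_bigr => h _ /=; rewrite !mulmxA -rep_mul mulKVg.
by rewrite -[RHS]mulmxA -rep_mul invMg invgK.
Qed.

(** Schur's lemma for the averages of rank one matrices, in the shape in which
    it is applied to products of matrix coefficients. *)
Lemma orthogonality r s p1 p2 p3 p4 (A : 'M[C]_(p1, rdim r))
    (B : 'M[C]_(rdim r, p2)) (A' : 'M[C]_(p3, rdim s))
    (B' : 'M[C]_(rdim s, p4)) i j k l : r != s ->
  \sum_g (A *m rep r g *m B) i j * (A' *m rep s g^-1%g *m B') k l = 0.
Proof.
move=> rs.
have E g : (A *m rep r g *m B) i j * (A' *m rep s g^-1%g *m B') k l =
    (A *m (rep r g *m (col j B *m row k A') *m rep s g^-1%g) *m B') i l.
  transitivity ((col j (A *m rep r g *m B) *m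
                 row k (A' *m rep s g^-1%g *m B')) i l).
    by rewrite [RHS]mxE big_ord1 [col _ _ _ _]mxE [row _ _ _ _]mxE.
  by rewrite !colE !rowE !mulmxA.
under eq_bigr do rewrite E.
rewrite -summxE -mulmx_suml -mulmx_sumr.
set S := \sum_h _; have [->|S0] := eqVneq S 0.
  by rewrite mulmx0 mul0mx mxE.
have := schur_rsim (rep_irr r) (rep_irr s) (average_intertwines _) S0.
by move/rep_inj => E'; rewrite E' eqxx in rs.
Qed.

Lemma orthogonality_eq r p1 p2 p3 p4 (A : 'M[C]_(p1, rdim r))
    (B : 'M[C]_(rdim r, p2)) (A' : 'M[C]_(p3, rdim r))
    (B' : 'M[C]_(rdim r, p4)) i j k l :
  \sum_g (A *m rep r g *m B) i j * (A' *m rep r g^-1%g *m B') k l =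
  order / (rdim r)%:R * (A' *m B) k j * (A *m B') i l.
Proof.
have E g : (A *m rep r g *m B) i j * (A' *m rep r g^-1%g *m B') k l =
    (A *m (rep r g *m (col j B *m row k A') *m rep r g^-1%g) *m B') i l.
  transitivity ((col j (A *m rep r g *m B) *m
                 row k (A' *m rep r g^-1%g *m B')) i l).
    by rewrite [RHS]mxE big_ord1 [col _ _ _ _]mxE [row _ _ _ _]mxE.
  by rewrite !colE !rowE !mulmxA.
under eq_bigr do rewrite E.
rewrite -summxE -mulmx_suml -mulmx_sumr.
rewrite (schur_scalar (rep_irr r) (average_intertwines _)).
rewrite raddf_sum /=; under eq_bigr => g _.
  rewrite mxtrace_mulC mulmxA -rep_mul mulVg rep1 mul1mx mxtrace_mulC.
  rewrite colE rowE -mulmxA [_ *m (_ *m delta_mx _ _)]mulmxA -colE -rowE.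
  rewrite trace_mx11 mxE [_ k _]mxE.
over.
rewrite sumr_const -[X in (X / _)%:M]mulr_natl cardT -cardE.
rewrite mul_mx_scalar -scalemxAl mxE.
by congr (_ * _); rewrite mulrAC.
Qed.

(** A group algebra element that vanishes in all irreducible unitary
    representations vanishes in all unitary ones: a proper invariant subspace
    of a unitary representation and its orthogonal complement are again
    unitary representations, of smaller dimension. *)
Lemma unitary_rep_separates (x : gT -> C) :
  (forall r, \sum_g x g *: rep r g = 0) ->
  forall n (rG : mx_representation C [set: gT]%G n),
  (forall g, rG g \is unitarymx) -> \sum_g x g *: rG g = 0.
Proof.
move=> x0 n; have [k] := ubnP n; elim: k n => // k IHk n le_nk rG uG.
have sub0 (U : 'M[C]_n) : mxmodule rG U -> (\rank U < n)%N ->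
    U *m (\sum_g x g *: rG g) = 0.
  move=> /mxmoduleP modU ltUn.
  pose S := schmidt (row_base U).
  have uS : S \is unitarymx by rewrite schmidt_unitarymx // rank_leq_col.
  have SU : (S :=: U)%MS.
    apply: eqmx_trans (eq_row_base U).
    by apply: eqmx_schmidt_free; exact: row_base_free.
  pose r1 g := S *m rG g *m S^t*.
  have r1S g : r1 g *m S = S *m rG g.
    have /submxP[Z E] : (S *m rG g <= S)%MS.
      by rewrite (eqmxMr _ SU) SU modU ?inE.
    by rewrite /r1 E -[Z *m S *m _]mulmxA (unitarymxP uS) mulmx1.
  have r1_repr : mx_repr [set: gT]%G r1.
    split=> [|g h _ _]; first by rewrite /r1 repr_mx1 mulmx1; apply/unitarymxP.
    by rewrite {2}/r1 !mulmxA r1S /r1 repr_mxM ?inE // !mulmxA.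
  pose rS := MxRepresentation r1_repr.
  have urS g : rS g \is unitarymx.
    apply/unitarymxP; rewrite /= {2}/r1 !trmx_mul !map_mxM trmxCK.
    rewrite !mulmxA r1S -[S *m _ *m _]mulmxA (unitarymxP (uG g)) mulmx1.
    exact/unitarymxP.
  have /IHk/(_ rS urS) rS0 : (\rank U < k)%N by rewrite (leq_trans ltUn).
  (* S is an isometry onto U, so g |-> S (rG g) S^* is the subrepresentation *)
  have SX0 : S *m (\sum_g x g *: rG g) = 0.
    rewrite mulmx_sumr -[RHS](mul0mx _ S) -rS0 mulmx_suml.
    by apply: eq_bigr => g _; rewrite -scalemxAr -scalemxAl r1S.
  have /submxP[Z ZE] : (U <= S)%MS by rewrite SU.
  by rewrite [in LHS]ZE -mulmxA SX0 mulmx0.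
have [n0|n_gt0] := posnP n; first by subst n; rewrite [LHS]flatmx0 [RHS]flatmx0.
have [irr|] := pselect (mx_irreducible rG).
  have [r /mx_rsim_def[B [B' B'B rE]]] := rep_complete D uG irr.
  under eq_bigr => g _ do rewrite rE ?inE //.
  have := congr1 (fun M => B *m M *m B') (x0 r).
  rewrite mulmx0 mul0mx mulmx_sumr mulmx_suml; apply: etrans.
  by apply: eq_bigr => g _; rewrite -scalemxAr -scalemxAl.
rewrite mx_irrP => /not_andP[//|/existsNP[U /not_implyP[modU /not_implyP[U0 nU]]]].
have ltU : (\rank U < n)%N by rewrite ltn_neqAle rank_leq_col andbT; apply/negP.
pose Uo := orthomx Num.conj (mx_of_hermitian (hermitian1mx _)) U.
have modUo : mxmodule rG Uo.
  apply/mxmoduleP => g _; rewrite orthomx1E.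
  have /submxP[Z ZE] : (U *m rG g^-1%g <= U)%MS by rewrite (mxmoduleP modU) ?inE.
  have -> : rG g = (rG g^-1%g)^t*.
    rewrite -[RHS](mulKmx (unitarymx_unit (uG g^-1%g))) (unitarymxP (uG _)).
    by rewrite mulmx1 repr_mxV ?inE // invmxK.
  rewrite -mulmxA -map_mxM -trmx_mul ZE trmx_mul map_mxM mulmxA.
  have -> : Uo *m U^t* = 0 by apply/orthomx1P; exact: submx_refl.
  by rewrite mul0mx.
have ltUo : (\rank Uo < n)%N.
  by rewrite rank_ortho ltn_subrL n_gt0 andbT lt0n mxrank_eq0.
have := addsmx_ortho U => /eqmxP/andP[_].
have /sub_kermxP kU := sub0 U modU ltU.
have /sub_kermxP kUo := sub0 Uo modUo ltUo.
move=> /submx_trans /(_ (_ : _ <= kermx (\sum_g x g *: rG g))%MS).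
rewrite addsmx_sub kU kUo => /(_ isT) /sub_kermxP.
by rewrite mul1mx.
Qed.

(** By orthogonality the difference of the two sides, as an element of the
    group algebra, vanishes in every irreducible representation. It therefore
    vanishes in the regular representation, which is faithful. *)
Lemma sum_characters g :
  \sum_(r : D) (rdim r)%:R / order * \tr (rep r g) = (g == 1%g)%:R.
Proof.
have order0 : order != 0 by rewrite pnatr_eq0 -lt0n -cardsT cardG_gt0.
have dim0 (r : D) : (rdim r)%:R != 0 :> C by rewrite pnatr_eq0 -lt0n rdim_gt0.
pose z (h : gT) : C := (h == 1%g)%:R -
  \sum_(r : D) (rdim r)%:R / order * \tr (rep r h^-1%g).
suff z0 h : z h = 0.
  by have /eqP := z0 g^-1%g; rewrite subr_eq0 invgK eq_invg1 => /eqP.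
have zrep (r : D) : \sum_h z h *: rep r h = 0.
  apply/matrixP => i j; rewrite summxE mxE.
  under eq_bigr => k _ do rewrite mxE mulrBl.
  rewrite sumrB (bigD1 1%g) //= eqxx mul1r rep1 big1 => [|k /negPf->]; last first.
    by rewrite mul0r.
  under eq_bigr => k _ do rewrite mulr_suml.
  rewrite exchange_big /= (bigD1 r) //= [X in _ - (_ + X)]big1; last first.
    move=> s sr; under eq_bigr => k _ do rewrite -!mulrA /mxtrace mulr_suml.
    rewrite -!mulr_sumr exchange_big big1 ?mulr0 // => l _.
    under eq_bigr => k _ do rewrite mulrC.
    have := orthogonality (1%:M) (1%:M) (1%:M) (1%:M) i j l l.
    rewrite eq_sym => /(_ sr); apply: etrans.
    by apply: eq_bigr => k _; rewrite !mul1mx !mulmx1.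
  under eq_bigr => k _ do rewrite -!mulrA /mxtrace mulr_suml.
  rewrite -!mulr_sumr exchange_big /=.
  under eq_bigr => l _.
    rewrite (_ : \sum_k _ = order / (rdim r)%:R * (l == j)%:R * (i == l)%:R).
      over.
    have := orthogonality_eq (1%:M : 'M[C]_(rdim r)) 1%:M 1%:M 1%:M i j l l.
    rewrite !mul1mx !mxE => <-.
    by apply: eq_bigr => k _; rewrite !mul1mx !mulmx1 mulrC.
  rewrite (bigD1 j) //= eqxx mulr1 big1 => [|l /negPf->]; last first.
    by rewrite mulr0 mul0r.
  by rewrite !addr0 !mulrA divfK // mulfV // mul1r mxE subrr.
pose reg := regular_repr C [set: gT]%G.
have /(unitary_rep_separates zrep) reg0 : forall k, reg k \is unitarymx.
  move=> k; apply/row_unitarymxP => i j; rewrite !rowK dotmxE.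
  rewrite trmx_delta map_delta_mx mul_delta_mx_cond mulrb.
  have -> : (gring_index [set: gT] (enum_val i * k) ==
             gring_index [set: gT] (enum_val j * k)) = (i == j).
    rewrite (can_in_eq (gring_indexK (G := [set: gT]%G))) ?inE //.
    by rewrite (inj_eq (mulIg k)) (inj_eq enum_val_inj).
  by case: eqP => _; rewrite ?mxE.
have /rowP/(_ (gring_index [set: gT] h)) :
    row (gring_index [set: gT] 1%g) (\sum_g z g *: reg g) = 0.
  by rewrite reg0 row0.
rewrite mxE [X in X = _]summxE mxE; apply: etrans.
rewrite (bigD1 h) //= big1 => [|k kh].
  by rewrite mxE mxE gring_indexK ?inE // mul1g mxE !eqxx mulr1 addr0.
rewrite mxE mxE gring_indexK ?inE // mul1g mxE eqxx /=.
rewrite (can_in_eq (gring_indexK (G := [set: gT]%G))) ?inE //.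
by rewrite eq_sym (negPf kh) mulr0.
Qed.

End Orthogonality.

(** * Matrix units of the group algebra *)

Section MatrixUnits.
Context {R : realType} {gT : finGroupType} (D : unitary_dual R gT).
Local Notation C := R[i].
Implicit Types r s : D.
Local Notation order := (#|gT|%:R : C).

Definition group_conv (x y : gT -> C) : gT -> C :=
  fun g => \sum_h x h * y (h^-1 * g)%g.

(** Acts in the representation r as the elementary matrix (k, l), and as zero
    in the other irreducible representations. *)
Definition matrix_unit r (k l : 'I_(rdim r)) : gT -> C :=
  fun g => (rdim r)%:R / order * rep r g^-1%g l k.

Definition base_index r : 'I_(rdim r) := Ordinal (rdim_gt0 r).

(** Cuts every irreducible representation down to a line. *)
Definition corner : gT -> C := fun g => \sum_r matrix_unit (base_index r) (base_index r) g.

Definition to_corner (i : {r : D & 'I_(rdim r)}) : gT -> C :=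
  matrix_unit (tagged i) (base_index (tag i)).

Definition from_corner (i : {r : D & 'I_(rdim r)}) : gT -> C :=
  matrix_unit (base_index (tag i)) (tagged i).

Lemma order_neq0 : order != 0.
Proof. by rewrite pnatr_eq0 -lt0n -cardsT cardG_gt0. Qed.

Lemma rdim_neq0 r : (rdim r)%:R != 0 :> C.
Proof. by rewrite pnatr_eq0 -lt0n rdim_gt0. Qed.

Lemma matrix_unitM r (k l m n : 'I_(rdim r)) g :
  group_conv (matrix_unit k l) (matrix_unit m n) g = (l == m)%:R * matrix_unit k n g.
Proof.
have := orthogonality_eq (rep r g^-1%g) 1%:M 1%:M 1%:M n m l k.
rewrite !mulmx1 mxE.
under eq_bigr => h _ do rewrite !mulmx1 mul1mx.
move=> orth; rewrite /group_conv /matrix_unit.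
transitivity (((rdim r)%:R / order) ^+ 2 *
  \sum_h (rep r g^-1%g *m rep r h) n m * rep r h^-1%g l k).
  rewrite mulr_sumr; apply: eq_bigr => h _.
  rewrite mulrACA -expr2 invMg invgK rep_mul; congr (_ * _); exact: mulrC.
have unit2 : (rdim r)%:R / order * (order / (rdim r)%:R) = 1.
  by rewrite mulrA divfK ?order_neq0 // divff ?rdim_neq0.
rewrite orth; set a := _ / order in unit2 *; set b := order / _ in unit2 *.
by rewrite -[RHS]mul1r -unit2; ring.
Qed.

Lemma matrix_unitM_neq r s (k l : 'I_(rdim r)) (m n : 'I_(rdim s)) g :
  r != s -> group_conv (matrix_unit k l) (matrix_unit m n) g = 0.
Proof.
rewrite eq_sym => rs.
have := orthogonality (rep s g^-1%g) 1%:M 1%:M 1%:M n m l k rs.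
under eq_bigr => h _ do rewrite !mulmx1 mul1mx.
move=> orth; rewrite /group_conv /matrix_unit.
transitivity (((rdim r)%:R / order) * ((rdim s)%:R / order) *
  \sum_h (rep s g^-1%g *m rep s h) n m * rep r h^-1%g l k); last first.
  by rewrite orth mulr0.
rewrite mulr_sumr; apply: eq_bigr => h _.
rewrite mulrACA invMg invgK rep_mul; congr (_ * _); exact: mulrC.
Qed.

Lemma to_corner_e i : group_conv (to_corner i) corner = to_corner i.
Proof.
case: i => r k; apply/funext => g; rewrite /group_conv /corner /to_corner /=.
under eq_bigr do rewrite mulr_sumr.
rewrite exchange_big (bigD1 r) //= [X in _ + X]big1 ?addr0 => [|s sr].
  by have := matrix_unitM k (base_index r) (base_index r) (base_index r) g; rewrite eqxx mul1r; apply.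
by apply: matrix_unitM_neq; rewrite eq_sym.
Qed.

Lemma e_from_corner i : group_conv corner (from_corner i) = from_corner i.
Proof.
case: i => r k; apply/funext => g; rewrite /group_conv /corner /from_corner /=.
under eq_bigr do rewrite mulr_suml.
rewrite exchange_big (bigD1 r) //= [X in _ + X]big1 ?addr0 => [|s sr].
  by have := matrix_unitM (base_index r) (base_index r) (base_index r) k g; rewrite eqxx mul1r; apply.
exact: matrix_unitM_neq.
Qed.

Lemma corner_idem : group_conv corner corner = corner.
Proof.
apply/funext => g; rewrite /group_conv {1}/corner.
under eq_bigr do rewrite mulr_suml.
rewrite exchange_big; apply: eq_bigr => r _.
have := to_corner_e (Tagged (fun r => 'I_(rdim r)) (base_index r)).
by move=> /(congr1 (@^~ g)); apply.
Qed.

(** This is the fullness of the corner: the identity of the group algebra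
    factors through it. *)
Lemma sum_to_from_corner g :
  \sum_i group_conv (to_corner i) (from_corner i) g = (g == 1%g)%:R.
Proof.
rewrite -eq_invg1 -(sum_characters D).
transitivity (\sum_r \sum_k @matrix_unit r k k g); last first.
  by apply: eq_bigr => r _; rewrite /mxtrace mulr_sumr.
rewrite [RHS]sig_big_dep /=; apply: eq_bigr => i _.
by rewrite matrix_unitM eqxx mul1r.
Qed.

End MatrixUnits.

(** * Germs and sections of a sheaf of algebras *)

Section Germs.
Context {K : pzRingType} {M : topologicalType} (A : alg_sheaf (K := K) M).
Local Notation F := (germ_family A).
Implicit Types (x y : M) (f g : F).

Lemma tr_id x (v : stalk A x) : tr x v = v.
Proof.
by rewrite /tr; case: eqP => // e; rewrite (Prop_irrelevance e erefl).
Qed.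

Lemma tr_neq x y (v : stalk A x) : x <> y -> tr y v = 0.
Proof. by rewrite /tr; case: eqP. Qed.

Lemma trD x y (u v : stalk A x) : tr y (u + v) = tr y u + tr y v.
Proof.
have [<-|xy] := pselect (x = y); first by rewrite !tr_id.
by rewrite !tr_neq // addr0.
Qed.

Lemma trM x y (u v : stalk A x) : tr y (u * v) = tr y u * tr y v.
Proof.
have [<-|xy] := pselect (x = y); first by rewrite !tr_id.
by rewrite !tr_neq // mulr0.
Qed.

Lemma trZ x y (k : K) (v : stalk A x) : tr y (ascale k v) = ascale k (tr y v).
Proof.
have [<-|xy] := pselect (x = y); first by rewrite !tr_id.
by rewrite !tr_neq // /ascale mulr0.
Qed.

Lemma tr_tr x y z (v : stalk A x) : x = y -> tr z (tr y v) = tr z v.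
Proof. by move=> <-; rewrite tr_id. Qed.

Lemma tr_eq x y f : x = y -> tr y (f x) = f y.
Proof. by move=> <-; rewrite tr_id. Qed.

(** The product of all stalks serves as one common home for the values of
    sections; a value in the stalk at x is the family supported at x. *)
Definition germ x (v : stalk A x) : F := fun y => tr y v.

Definition pmul f g : F := fun y => f y * g y.

Lemma germ_family_ext f g : (forall x, f x = g x) -> f = g.
Proof. exact: functional_extensionality_dep. Qed.

Lemma germK x (v : stalk A x) : germ v x = v.
Proof. exact: tr_id. Qed.

Lemma gaddE f g x : (f + g) x = f x + g x. Proof. by []. Qed.
Lemma gscaleE (k : K) f x : (k *: f) x = ascale k (f x). Proof. by []. Qed.
Lemma gzeroE x : (0 : F) x = 0. Proof. by []. Qed.

Lemma germD x (u v : stalk A x) : germ (u + v) = germ u + germ v.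
Proof. by apply: germ_family_ext => y; exact: trD. Qed.
Lemma germZ x (k : K) (v : stalk A x) : germ (ascale k v) = k *: germ v.
Proof. by apply: germ_family_ext => y; exact: trZ. Qed.
Lemma germM x (u v : stalk A x) : germ (u * v) = pmul (germ u) (germ v).
Proof. by apply: germ_family_ext => y; exact: trM. Qed.
Lemma germ0 x : germ (0 : stalk A x) = 0.
Proof. by apply: (addrI (germ (0 : stalk A x))); rewrite -germD !addr0. Qed.

Lemma germ_tr x y (v : stalk A x) : x = y -> germ (tr y v) = germ v.
Proof. by move=> e; apply: germ_family_ext => z; exact: tr_tr. Qed.

Lemma pmulDl f1 f2 g : pmul (f1 + f2) g = pmul f1 g + pmul f2 g.
Proof. by apply: germ_family_ext => x; exact: mulrDl. Qed.
Lemma pmulDr f g1 g2 : pmul f (g1 + g2) = pmul f g1 + pmul f g2.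
Proof. by apply: germ_family_ext => x; exact: mulrDr. Qed.
Lemma pmulA f g h : pmul f (pmul g h) = pmul (pmul f g) h.
Proof. by apply: germ_family_ext => x; exact: mulrA. Qed.
Lemma pmul0l f : pmul 0 f = 0.
Proof. by apply: germ_family_ext => x; exact: mul0r. Qed.
Lemma pmul0r f : pmul f 0 = 0.
Proof. by apply: germ_family_ext => x; exact: mulr0. Qed.
Lemma pmulZl (k : K) f g : pmul (k *: f) g = k *: pmul f g.
Proof. by apply: germ_family_ext => x; rewrite /pmul !gscaleE /ascale mulrA. Qed.
Lemma pmulZr (k : K) f g : pmul f (k *: g) = k *: pmul f g.
Proof.
apply: germ_family_ext => x; rewrite /pmul !gscaleE /ascale !mulrA.
by rewrite ualg_central.
Qed.

Definition at_point x f := forall y, y <> x -> f y = 0.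

Lemma at_germ x (v : stalk A x) : at_point x (germ v).
Proof. by move=> y /nesym; exact: tr_neq. Qed.

Lemma at_pointE x f : at_point x f -> germ (f x) = f.
Proof.
move=> fx; apply: germ_family_ext => y; have [<-|xy] := pselect (x = y).
  exact: germK.
by rewrite at_germ ?fx //; exact: nesym.
Qed.

Lemma at_pointD x f g : at_point x f -> at_point x g -> at_point x (f + g).
Proof. by move=> fx gx y yx; rewrite gaddE fx // gx // addr0. Qed.
Lemma at_pointZ x k f : at_point x f -> at_point x (k *: f).
Proof. by move=> fx y yx; rewrite gscaleE fx // /ascale mulr0. Qed.
Lemma at_pointMl x f g : at_point x f -> at_point x (pmul f g).
Proof. by move=> fx y yx; rewrite /pmul fx // mul0r. Qed.
Lemma at_point_sum x (I : Type) (r : seq I) (P : pred I) (f : I -> F) :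
  (forall i, P i -> at_point x (f i)) -> at_point x (\sum_(i <- r | P i) f i).
Proof.
move=> h; elim/big_ind: _ => // u v; exact: at_pointD.
Qed.

Lemma gsum_at (I : Type) (r : seq I) (P : pred I) (f : I -> F) x :
  (\sum_(i <- r | P i) f i) x = \sum_(i <- r | P i) f i x.
Proof. by elim/big_rec2: _ => // i u v _ <-. Qed.

Lemma germ_sum x (I : Type) (r : seq I) (P : pred I) (v : I -> stalk A x) :
  germ (\sum_(i <- r | P i) v i) = \sum_(i <- r | P i) germ (v i).
Proof. by apply: (big_morph (@germ x)); [exact: germD | exact: germ0]. Qed.

End Germs.

Section Sections.
Context {K : pzRingType} {M : topologicalType} (A : alg_sheaf (K := K) M).
Local Notation F := (germ_family A).
Hypothesis shA : is_alg_sheaf A.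

Lemma sections_sub (U V : set M) (b : F) : open U -> open V -> V `<=` U ->
  sections A U b -> sections A V b.
Proof. by case: shA => h _ _ _ _ oU oV VU; apply: (h U V b b). Qed.

(** The sections of the pullback along s, phrased with values in the product
    of all stalks: no transport between stalks over equal points is left. *)
Definition sec (Y : topologicalType) (s : Y -> M) (f : Y -> F) :=
  forall y, exists V (b : F), [/\ open V, V (s y), sections A V b &
    \forall y' \near y, f y' = germ (b (s y'))].

Definition csec (Y : topologicalType) (s : Y -> M) (f : Y -> F) :=
  sec s f /\ compact (closure [set y | f y <> 0]).

Definition hat (Y : Type) (s : Y -> M) (a : forall y, stalk A (s y)) : Y -> F :=
  fun y => germ (a y).

Definition unhat (Y : Type) (s : Y -> M) (f : Y -> F) :
  forall y, stalk A (s y) := fun y => f y (s y).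

Lemma hatK (Y : Type) (s : Y -> M) (a : forall y, stalk A (s y)) :
  unhat s (hat a) = a.
Proof. by apply: functional_extensionality_dep => y; exact: germK. Qed.

Lemma unhatK (Y : Type) (s : Y -> M) (f : Y -> F) :
  (forall y, at_point (s y) (f y)) -> hat (unhat s f) = f.
Proof. by move=> h; apply/funext => y; exact: at_pointE. Qed.

Lemma germ_eq0 x (v : stalk A x) : germ v = 0 <-> v = 0.
Proof.
split=> [/(congr1 (fun f : F => f x))|->]; last exact: germ0.
by rewrite germK.
Qed.

Lemma supp_hat (Y : Type) (s : Y -> M) (a : forall y, stalk A (s y)) :
  [set y | a y <> 0] = [set y | hat a y <> 0].
Proof.
by apply/seteqP; split=> y /= h /germ_eq0.
Qed.

Lemma cpt_sections_hat (X1 : topologicalType) (G : groupoid M X1)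
    (a : cpt_sections G A) :
  carrier a <-> csec (src G) (hat (a : forall y, stalk A (src G y))).
Proof.
rewrite /carrier /= /csec supp_hat; split=> -[sa ca]; split=> // y.
  have [V [b [oV Vy Vb /= nb]]] := sa y I; exists V, b; split=> //.
  by apply: filterS nb => y' ab; congr germ.
move=> _; have [V [b [oV Vy Vb nb]]] := sa y; exists V, b; split=> //=.
apply: filterS nb => y' /(congr1 (fun f : F => f (src G y'))).
by rewrite /hat !germK.
Qed.

(** Finitely many local sections around x have a common open domain. *)
Lemma local_sum (I : finType) (kap : I -> K) (x : M) (V : I -> set M)
    (b : I -> F) :
  (forall i, [/\ open (V i), V i x & sections A (V i) (b i)]) ->
  exists W, [/\ open W, W x, (forall i, W `<=` V i) &
    sections A W (\sum_i kap i *: b i)].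
Proof.
move=> h; pose W := interior [set y | forall i, V i y].
have oW : open W by exact: open_interior.
have WV i : W `<=` V i by move=> y /interior_subset.
exists W; split=> //.
  have : \forall y \near x, forall i, V i y.
    by apply: filter_forall => i; apply: open_nbhs_nbhs; case: (h i).
  exact.
have [_ _ _ _ /(_ W oW)[s1 sD _]] := shA.
have s0 : sections A W (0 : F).
  have := sD (- 1) _ _ s1 s1.
  rewrite (_ : (fun x => _) = (0 : F)) //; apply: germ_family_ext => y.
  by rewrite gzeroE /ascale mulr1 rmorphN rmorph1 addNr.
elim/big_ind: _ => // [f g sf sg|i _].
  have := sD 1 _ _ sf sg; rewrite (_ : (fun x => _) = f + g) //.
  by apply: germ_family_ext => y; rewrite /ascale rmorph1 mul1r.
have sb : sections A W (b i) by apply: sections_sub (WV i) _ => //; case: (h i).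
have := sD (kap i) _ _ sb s0; rewrite (_ : (fun x => _) = kap i *: b i) //.
by apply: germ_family_ext => y; rewrite addr0.
Qed.

(** All operators that relate functions on H and on the dual groupoid, except
    the convolution, have this form. *)
Lemma sec_pull (X1 Y1 : topologicalType) (sx : X1 -> M) (sy : Y1 -> M)
    (I : finType) (kap : I -> X1 -> K) (th : I -> X1 -> Y1) (f : Y1 -> F) :
  continuous sx -> (forall i, continuous (th i)) ->
  (forall i x, sy (th i x) = sx x) ->
  (forall i x, \forall x' \near x, kap i x' = kap i x) ->
  sec sy f -> sec sx (fun x => \sum_i kap i x *: f (th i x)).
Proof.
move=> csx cth sth lkap sf x.
have /choice[V /choice[b hb]] : forall i, exists V (b : F),
    [/\ open V, V (sx x), sections A V b &
    \forall x' \near x, f (th i x') = germ (b (sx x'))].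
  move=> i; have [V [b [oV Vy Vb nb]]] := sf (th i x).
  exists V, b; split=> //; first by rewrite -(sth i).
  have nb' : \forall x' \near x, f (th i x') = germ (b (sy (th i x'))).
    exact: cth i x _ nb.
  by apply: filterS nb' => x' ->; rewrite sth.
have [|W [oW Wx WV Wb]] := @local_sum I (kap^~ x) (sx x) V b.
  by move=> i; case: (hb i).
exists W, (\sum_i kap i x *: b i); split=> //.
have near1 : \forall x' \near x, forall i, kap i x' = kap i x.
  exact: filter_forall (lkap^~ x).
have near2 : \forall x' \near x, forall i, f (th i x') = germ (b i (sx x')).
  by apply: filter_forall => i; case: (hb i).
near=> x'.
have k1 : forall i, kap i x' = kap i x by near: x'.
have k2 : forall i, f (th i x') = germ (b i (sx x')) by near: x'.
rewrite gsum_at germ_sum; apply: eq_bigr => i _.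
by rewrite k1 k2 -germZ.
Unshelve. all: by end_near.
Qed.

End Sections.

(** * Groupoids and their convolution *)

Section GroupoidLaws.
Context {X0 X1 : Type} (G : groupoid X0 X1).
Hypothesis isG : is_groupoid G.
Local Notation "k ** l" := (gmul G k l) (at level 40, left associativity).
Local Notation inv := (ginv G).
Implicit Types k l m h : X1.

Lemma src_unit x : src G (gunit G x) = x.
Proof. by case: isG => + _ _ _ _ => /(_ x)[]. Qed.
Lemma tgt_unit x : tgt G (gunit G x) = x.
Proof. by case: isG => + _ _ _ _ => /(_ x)[]. Qed.
Lemma src_mul k l : tgt G k = src G l -> src G (k ** l) = src G k.
Proof. by case: isG => _ + _ _ _ => /(_ k l)/[apply]-[]. Qed.
Lemma tgt_mul k l : tgt G k = src G l -> tgt G (k ** l) = tgt G l.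
Proof. by case: isG => _ + _ _ _ => /(_ k l)/[apply]-[]. Qed.
Lemma mul_assoc k l m : tgt G k = src G l -> tgt G l = src G m ->
  k ** (l ** m) = k ** l ** m.
Proof. by case: isG => _ _ + _ _ => /(_ k l m)/[apply]/[apply]. Qed.
Lemma unit_mul x k : x = src G k -> gunit G x ** k = k.
Proof. by move=> ->; case: isG => _ _ _ /(_ k)[]. Qed.
Lemma mul_unit x k : x = tgt G k -> k ** gunit G x = k.
Proof. by move=> ->; case: isG => _ _ _ /(_ k)[]. Qed.
Lemma src_inv k : src G (inv k) = tgt G k.
Proof. by case: isG => _ _ _ _ /(_ k)[]. Qed.
Lemma tgt_inv k : tgt G (inv k) = src G k.
Proof. by case: isG => _ _ _ _ /(_ k)[]. Qed.
Lemma mul_inv k : k ** inv k = gunit G (src G k).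
Proof. by case: isG => _ _ _ _ /(_ k)[]. Qed.
Lemma inv_mul k : inv k ** k = gunit G (tgt G k).
Proof. by case: isG => _ _ _ _ /(_ k)[]. Qed.

Lemma src_ldiv k l : src G k = src G l -> src G (inv k ** l) = tgt G k.
Proof. by move=> e; rewrite src_mul ?tgt_inv ?src_inv. Qed.
Lemma mul_ldiv k l : src G k = src G l -> k ** (inv k ** l) = l.
Proof.
by move=> e; rewrite mul_assoc ?src_inv ?tgt_inv // mul_inv unit_mul.
Qed.
Lemma ldiv_mul k l : tgt G k = src G l -> inv k ** (k ** l) = l.
Proof. by move=> e; rewrite mul_assoc ?tgt_inv // inv_mul unit_mul. Qed.

Lemma mul_cancel k l l' : tgt G k = src G l -> tgt G k = src G l' ->
  k ** l = k ** l' -> l = l'.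
Proof. by move=> kl kl' e; rewrite -(ldiv_mul kl) e ldiv_mul. Qed.

Lemma ldiv_ldiv k l h : src G k = src G h -> src G l = tgt G k ->
  inv l ** (inv k ** h) = inv (k ** l) ** h.
Proof.
move=> kh lk; have kl := esym lk.
have c1 : src G l = src G (inv k ** h) by rewrite src_ldiv.
rewrite -[in RHS](mul_ldiv kh) -[in RHS](mul_ldiv c1).
rewrite [k ** (_ ** _)]mul_assoc ?src_ldiv // ldiv_mul //.
by rewrite tgt_mul // src_ldiv.
Qed.

Lemma rdiv_mul k l : tgt G k = src G l -> k ** l ** inv l = k.
Proof. by move=> e; rewrite -mul_assoc ?src_inv // mul_inv mul_unit. Qed.

Lemma mul_rdiv k l : tgt G k = tgt G l -> k ** inv l ** l = k.
Proof.
by move=> e; rewrite -mul_assoc ?src_inv ?tgt_inv // inv_mul mul_unit.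
Qed.

Definition fibre (x : X0) : set X1 := [set k | src G k = x].

End GroupoidLaws.

Section FiniteSums.
Context {V : zmodType} {T T' : choiceType}.

Lemma fsum_morph (W : zmodType) (phi : V -> W) (S : set T) (f : T -> V) :
  finite_set S -> phi 0 = 0 -> {morph phi : u v / u + v} ->
  phi (\sum_(k \in S) f k) = \sum_(k \in S) phi (f k).
Proof. by move=> fS phi0 phiD; rewrite !fsbig_finite // (big_morph phi phiD phi0). Qed.

Lemma fsum_split (S : set T) (f g : T -> V) : finite_set S ->
  \sum_(k \in S) (f k + g k) = \sum_(k \in S) f k + \sum_(k \in S) g k.
Proof. by move=> fS; rewrite !fsbig_finite // big_split. Qed.

Lemma fsumT (I : finType) (f : I -> V) :
  \sum_(a \in [set: I]) f a = \sum_a f a.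
Proof.
rewrite (fsbigE (index_enum I)) ?index_enum_uniq // => [|a _]; last first.
  by rewrite mem_index_enum.
by apply: eq_bigl => a; rewrite mem_set.
Qed.

End FiniteSums.

Section Convolution.
Context {K : pzRingType} {M X1 : topologicalType} (A : alg_sheaf (K := K) M).
Variable G : groupoid M X1.
Hypothesis isG : is_groupoid G.
Local Notation F := (germ_family A).
Local Notation "k ** l" := (gmul G k l) (at level 40, left associativity).
Local Notation inv := (ginv G).

Variable al : X1 -> F -> F.
Hypothesis alD : forall k (f g : F), al k (f + g) = al k f + al k g.
Hypothesis alZ : forall k c (f : F), al k (c *: f) = c *: al k f.
Hypothesis alM : forall k f g, al k (pmul f g) = pmul (al k f) (al k g).
Hypothesis al_comp : forall k l f, tgt G k = src G l ->
  al (k ** l) f = al k (al l f).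

Let al0 k : al k (0 : F) = 0.
Proof. by apply: (@addrI F (al k 0)); rewrite -alD !addr0. Qed.

(** The convolution as a sum over the arrows with the source of h: one arrow
    k determines the other factor k^-1 h. The map al k is the action of k on
    germs. *)
Definition groupoid_conv (f g : X1 -> F) (h : X1) : F :=
  \sum_(k \in fibre G (src G h)) pmul (f k) (al k (g (inv k ** h))).

(** Makes all convolution sums finite; compactly supported sections on an etale
    groupoid satisfy it. *)
Definition fibre_finite (f : X1 -> F) :=
  forall x, finite_set (fibre G x `&` [set k | f k <> 0]).

Lemma groupoid_conv_on (S : set X1) (f g : X1 -> F) h : S `<=` fibre G (src G h) ->
  (forall k, src G k = src G h -> ~ S k -> f k = 0) ->
  groupoid_conv f g h = \sum_(k \in S) pmul (f k) (al k (g (inv k ** h))).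
Proof.
move=> sub f0; symmetry; apply: fsbig_widen => // k [kh nS] /=.
by rewrite f0 // pmul0l.
Qed.

Let supp_on (f : X1 -> F) h k : src G k = src G h ->
  ~ (fibre G (src G h) `&` [set k | f k <> 0]) k -> f k = 0.
Proof. by move=> kh /not_andP[//|/= /contrapT]. Qed.

Lemma groupoid_conv_linl (f f' g : X1 -> F) c h : fibre_finite f -> fibre_finite f' ->
  groupoid_conv (fun k => c *: f k + f' k) g h = c *: groupoid_conv f g h + groupoid_conv f' g h.
Proof.
move=> ff ff'; pose S := fibre G (src G h) `&` [set k | f k <> 0] `|`
  fibre G (src G h) `&` [set k | f' k <> 0].
have fS : finite_set S by rewrite finite_setU; split; [exact: ff | exact: ff'].
have sub : S `<=` fibre G (src G h) by move=> k [] [].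
have S0 k : src G k = src G h -> ~ S k -> f k = 0 /\ f' k = 0.
  by move=> kh /not_orP[h1 h2]; split; apply: supp_on; eassumption.
have S1 k kh nS := (S0 k kh nS).1; have S2 k kh nS := (S0 k kh nS).2.
rewrite !(groupoid_conv_on g sub) //; last first.
  by move=> k kh nS; rewrite S1 // S2 // scaler0 addr0.
rewrite (fsum_morph (phi := fun v => c *: v)) ?scaler0 //; last exact: scalerDr.
by rewrite -fsum_split //; apply: eq_fsbigr => k _; rewrite pmulDl pmulZl.
Qed.

Lemma groupoid_conv_linr (f g g' : X1 -> F) c h : fibre_finite f ->
  groupoid_conv f (fun k => c *: g k + g' k) h = c *: groupoid_conv f g h + groupoid_conv f g' h.
Proof.
move=> ff; have fS := ff (src G h).
rewrite !(@groupoid_conv_on (fibre G (src G h) `&` [set k | f k <> 0])) //;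
  do ?[by move=> k []|exact: supp_on].
rewrite (fsum_morph (phi := fun v => c *: v)) ?scaler0 //; last exact: scalerDr.
rewrite -fsum_split //; apply: eq_fsbigr => k _.
by rewrite alD alZ pmulDr pmulZr.
Qed.

(** Both sides are sums over pairs (l, p) of f(l) (l g(l^-1 p)) (p u(p^-1 h)),
    where p = l m. *)
Lemma groupoid_conv_assoc (f g u : X1 -> F) h : fibre_finite f -> fibre_finite g ->
  groupoid_conv f (groupoid_conv g u) h = groupoid_conv (groupoid_conv f g) u h.
Proof.
move=> ff fg; set x := src G h.
pose S1 := fibre G x `&` [set k | f k <> 0].
pose S2 l := fibre G (tgt G l) `&` [set k | g k <> 0].
pose W := \bigcup_(l in S1) [set l ** m | m in S2 l].
have fS1 : finite_set S1 by exact: ff.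
have fS2 l : finite_set (S2 l) by exact: fg.
have fW : finite_set W.
  by apply: bigcup_finite => // l _; exact: finite_image.
have S1x : S1 `<=` fibre G x by move=> k [].
have Wx : W `<=` fibre G x.
  by move=> _ [l [lx _] [m [ml _] <-]]; rewrite /fibre /= src_mul.
have fg_on p : src G p = x -> groupoid_conv f g p =
    \sum_(l \in S1) pmul (f l) (al l (g (inv l ** p))).
  by move=> px; apply: groupoid_conv_on; rewrite px // => k; exact: supp_on.
rewrite (groupoid_conv_on _ S1x) //; last by move=> k; exact: supp_on.
rewrite (groupoid_conv_on u Wx); last first.
  move=> p px nW; rewrite fg_on // fsbig1 // => l [lx fl].
  have [->|gl] := pselect (g (inv l ** p) = 0); first by rewrite al0 pmul0r.
  case: nW; exists l => //; exists (inv l ** p); last first.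
    by rewrite mul_ldiv // px lx.
  by split=> //=; rewrite /fibre /= src_ldiv // px lx.
(* W is a finite set of arrows p outside of which all terms vanish *)
transitivity (\sum_(l \in S1) \sum_(p \in W)
    pmul (pmul (f l) (al l (g (inv l ** p)))) (al p (u (inv p ** h)))).
  apply: eq_fsbigr => l /set_mem[lx fl].
  have lh : src G l = src G h by [].
  rewrite (@groupoid_conv_on (S2 l)); last 2 first.
  - by rewrite src_ldiv // => k [].
  - rewrite src_ldiv // => k kl /not_andP[//|/= /contrapT //].
  rewrite (fsum_morph (phi := al l)) ?al0 //.
  rewrite (fsum_morph (phi := pmul (f l))) ?pmul0r //; last exact: pmulDr.
  transitivity (\sum_(p \in [set l ** m | m in S2 l])
    pmul (pmul (f l) (al l (g (inv l ** p)))) (al p (u (inv p ** h)))).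
    rewrite fsbig_image; last first.
      move=> m m' /set_mem[mS _] /set_mem[mS' _].
      by apply: mul_cancel => //; rewrite ?mS ?mS'.
    apply: eq_fsbigr => m /set_mem[ml gm].
    by rewrite ldiv_mul // ldiv_ldiv // al_comp // alM pmulA.
  apply: fsbig_widen; first by move=> p hp; exists l.
  move=> p [Wp np] /=.
  have px : src G p = x by exact: Wx.
  have -> : g (inv l ** p) = 0.
    apply: contrapT => gl; apply: np; exists (inv l ** p).
      by split=> //=; rewrite /fibre /= src_ldiv // lx px.
    by rewrite mul_ldiv // lx px.
  by rewrite al0 pmul0r pmul0l.
rewrite exchange_fsbig //; apply: eq_fsbigr => p /set_mem Wp.
have px : src G p = x by exact: Wx.
rewrite fg_on // (fsum_morph (phi := fun v => pmul v (al p (u (inv p ** h))))) //.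
  exact: pmul0l.
by move=> v w; exact: pmulDl.
Qed.

End Convolution.

(** * Compactly supported sections *)

Section CompactSupport.
Context {K : pzRingType} {M : topologicalType} (A : alg_sheaf (K := K) M).
Local Notation F := (germ_family A).

Lemma closure_compact (X : topologicalType) (S C : set X) :
  hausdorff_space X -> compact C -> S `<=` C -> compact (closure S).
Proof.
move=> hX cC SC; have := compact_closed hX cC => clC.
apply: (@subclosed_compact _ _ C) => //; first exact: closed_closure.
by rewrite [X in _ `<=` X](closure_id C).1 //; exact: closureS.
Qed.

Lemma hausdorff_prod (X Y : topologicalType) :
  hausdorff_space X -> hausdorff_space Y -> hausdorff_space (X * Y)%type.
Proof.
move=> hX hY [x y] [x' y'] cl; congr pair.
  apply: hX => U V nU nV.
  have [||[u v] [/= [uU _] [uV _]]] := cl (U `*` setT) (V `*` setT).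
  - by exists (U, setT) => //; split=> //=; exact: filterT.
  - by exists (V, setT) => //; split=> //=; exact: filterT.
  by exists u.
apply: hY => U V nU nV.
have [||[u v] [/= [_ vU] [_ vV]]] := cl (setT `*` U) (setT `*` V).
- by exists (setT, U) => //; split=> //=; exact: filterT.
- by exists (setT, V) => //; split=> //=; exact: filterT.
by exists v.
Qed.

Lemma discrete_hausdorff (X : finType) : hausdorff_space (discrete_topology X).
Proof.
move=> x y cl; have [] := cl [set x] [set y]; try exact: discrete_set1.
by move=> z [-> ->].
Qed.

Lemma discrete_compact (X : finType) : compact [set: discrete_topology X].
Proof. by apply: finite_compact; exact: finite_finset. Qed.

Lemma near_comp (X Y : topologicalType) (u : X -> Y) (x : X) (P : set Y) :
  {for x, continuous u} -> (\forall y \near u x, P y) ->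
  \forall x' \near x, P (u x').
Proof. by move=> cu nP; exact: cu _ nP. Qed.

Lemma near_neq (X Y : topologicalType) (u v : X -> Y) (x : X) :
  hausdorff_space Y -> {for x, continuous u} -> {for x, continuous v} ->
  u x <> v x -> \forall x' \near x, u x' <> v x'.
Proof.
rewrite open_hausdorff => hY cu cv uv.
have /hY[[U V] /= [/set_mem Ux /set_mem Vx] [oU oV /eqP UV0]] : u x != v x.
  by apply/eqP.
have nU : \forall x' \near x, U (u x') by apply: cu; exact: open_nbhs_nbhs.
have nV : \forall x' \near x, V (v x') by apply: cv; exact: open_nbhs_nbhs.
near=> x'; move=> e.
have Ux' : U (u x') by near: x'.
have Vx' : V (v x') by near: x'.
have : (U `&` V) (u x') by split=> //; rewrite e.
by rewrite UV0.
Unshelve. all: by end_near.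
Qed.

(** Properness of the maps th i keeps supports compact. *)
Lemma csec_pull (X1 Y1 : topologicalType) (sx : X1 -> M) (sy : Y1 -> M)
    (I : finType) (kap : I -> X1 -> K) (th : I -> X1 -> Y1) (f : Y1 -> F) :
  is_alg_sheaf A -> hausdorff_space X1 ->
  continuous sx -> (forall i, continuous (th i)) ->
  (forall i x, sy (th i x) = sx x) ->
  (forall i x, \forall x' \near x, kap i x' = kap i x) ->
  (forall i C, compact C -> exists2 C', compact C' & th i @^-1` C `<=` C') ->
  csec sy f -> csec sx (fun x => \sum_i kap i x *: f (th i x)).
Proof.
move=> shA hX csx cth sth lkap pth [sf cf]; split; first exact: sec_pull sf.
have /choice[C' hC'] : forall i, exists C', compact C' /\
    th i @^-1` (closure [set y | f y <> 0]) `<=` C'.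
  by move=> i; have [C' ? ?] := pth i _ cf; exists C'.
apply: (@closure_compact _ _ (\big[setU/set0]_i C' i)) => //.
  by apply: bigsetU_compact => i _; case: (hC' i).
move=> x /= fx.
have [i fi] : exists i, f (th i x) <> 0.
  apply: contrapT => /forallNP f0; apply: fx; rewrite big1 // => i _.
  by have /contrapT -> := f0 i; rewrite scaler0.
rewrite (bigD1 i) //=; left; apply: (hC' i).2.
exact: (@subset_closure _ [set y | f y <> 0]).
Qed.

Lemma csec_lin (Y : topologicalType) (s : Y -> M) (k : K) (f g : Y -> F) :
  is_alg_sheaf A -> hausdorff_space Y -> csec s f -> csec s g ->
  csec s (fun y => k *: f y + g y).
Proof.
move=> shA hY [sf cf] [sg cg]; split=> [y|].
  have [V1 [b1 [oV1 V1y Vb1 nb1]]] := sf y.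
  have [V2 [b2 [oV2 V2y Vb2 nb2]]] := sg y.
  have [|W [oW Wy _ Wb]] := @local_sum _ _ _ shA bool
    (fun i => if i then k else 1) (s y) (fun i => if i then V1 else V2)
    (fun i => if i then b1 else b2); first by case.
  exists W, (k *: b1 + 1 *: b2); split=> //; first by rewrite big_bool in Wb.
  apply: filterS2 nb1 nb2 => z -> ->.
  by rewrite gaddE !gscaleE germD !germZ scale1r.
apply: (closure_compact hY (compactU cf cg)) => y /= fg.
have [f0|fy] := pselect (f y = 0); last first.
  by left; exact: (@subset_closure _ [set y | f y <> 0]).
right; apply: (@subset_closure _ [set y | g y <> 0]) => /= g0.
by apply: fg; rewrite f0 g0 scaler0 addr0.
Qed.

Lemma csec0 (Y : topologicalType) (s : Y -> M) :
  is_alg_sheaf A -> csec s (fun=> 0 : F).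
Proof.
move=> shA; split=> [y|].
  have [|W [oW Wy _ Wb]] := @local_sum _ _ _ shA 'I_0
    (fun=> 0) (s y) (fun=> setT) (fun=> 0); first by case.
  exists W, 0; split=> //; last by apply: nearW => z; rewrite germ0.
  by rewrite big_ord0 in Wb.
rewrite (_ : [set _ | _] = set0) ?closure0; first exact: compact0.
by apply/seteqP; split=> // y /= /(_ erefl).
Qed.

Lemma continuous_image_compact (X Y : topologicalType) (th : X -> Y) C :
  continuous th -> compact C -> compact (th @` C).
Proof. by move=> cth; apply: continuous_compact; exact: continuous_subspaceT. Qed.

End CompactSupport.

(** * Convolution on an etale groupoid *)

Section EtaleConvolution.
Context {K : pzRingType} {M X1 : topologicalType} (A : alg_sheaf (K := K) M).
Variable G : groupoid M X1.
Local Notation F := (germ_family A).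
Local Notation "k ** l" := (gmul G k l) (at level 40, left associativity).
Local Notation inv := (ginv G).
Variable al : X1 -> F -> F.

Hypothesis shA : is_alg_sheaf A.
Hypothesis isG : is_groupoid G.
Hypothesis hM : hausdorff_space M.
Hypothesis hX : hausdorff_space X1.
Hypothesis csrc : continuous (src G).
Hypothesis ctgt : continuous (tgt G).
Hypothesis cinv : continuous inv.
Hypothesis cmul : {within [set p : X1 * X1 | composable G p.1 p.2],
  continuous (fun p : X1 * X1 => p.1 ** p.2)}.
Hypothesis etale : forall k, exists U (s : M -> X1),
  [/\ open U, U k, open (src G @` U), (forall k', U k' -> s (src G k') = k') &
    forall x, (src G @` U) x -> {for x, continuous s}].
Hypothesis al0 : forall k, al k (0 : F) = 0.
Hypothesis al_loc : forall k (f g : F), f (tgt G k) = g (tgt G k) ->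
  al k f = al k g.
Hypothesis al_sec : forall V (b : F) k, open V -> sections A V b ->
  V (tgt G k) -> exists V' (b' : F), [/\ open V', V' (src G k),
    sections A V' b' & \forall k' \near k, al k' b = germ (b' (src G k'))].

Lemma mul_continuous_at (Z : topologicalType) (u v : Z -> X1) z :
  (\forall z' \near z, composable G (u z') (v z')) ->
  {for z, continuous u} -> {for z, continuous v} ->
  {for z, continuous (fun z' => u z' ** v z')}.
Proof.
move=> nc cu cv W nW.
have := (subspace_continuousP _ _).1 cmul (u z, v z) (nbhs_singleton nc) W nW.
move=> nW'.
have nW'' : \forall z' \near z, composable G (u z') (v z') -> W (u z' ** v z').
  have cp : (fun z' => (u z', v z')) @ z --> nbhs (u z, v z).
    exact: cvg_pair cu cv.
  exact: (cp _ nW').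
suff : \forall z' \near z, W (u z' ** v z') by [].
by apply: filterS2 nc nW'' => z' h; apply.
Qed.

(** Each point of C has a neighbourhood that meets the fibre at most once. *)
Lemma fibre_compact_finite C x : compact C -> finite_set (C `&` fibre G x).
Proof.
have /choice[U /choice[s hU]] := etale.
move=> cC.
(* index the covering by the filter of large finite sets *)
pose Fin : set_system (set X1) := [set Q | exists2 S0, finite_set S0 &
  forall S, S0 `<=` S -> Q S].
have FF : Filter Fin.
  split=> [|P Q [S0 f0 h0] [S1 f1 h1]|P Q PQ [S0 f0 h0]].
  - by exists set0.
  - exists (S0 `|` S1); first by rewrite finite_setU.
    by move=> S; rewrite subUset => -[? ?]; split; [exact: h0 | exact: h1].
  - by exists S0 => // S /h0/PQ.
have [|S0 f0 h0] := (compact_near_coveringP C).1 cC _ Fin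
  (fun S k => src G k = x -> S k) FF.
  move=> k Ck; exists (U k, [set S | S (s k x)]) => /=.
    split; first by apply: open_nbhs_nbhs; case: (hU k).
    by exists [set s k x]; [exact: finite_set1 | move=> S; apply].
  move=> [k' S] /= [Uk Sk] k'x.
  by have [_ _ _ h' _] := hU k; rewrite -(h' k') // k'x.
apply: sub_finite_set f0 => k [Ck kx].
exact: (h0 S0).
Qed.

(** The sheets of src through the points of C over x carry all of C over a
    neighbourhood of x: the tube lemma for the compact set C. *)
Lemma fibre_near C (s : X1 -> M -> X1) (U : X1 -> set X1) x : compact C ->
  (forall k, [/\ open (U k), U k k &
    forall k', U k k' -> s k (src G k') = k']) ->
  \forall x' \near x, forall k, C k -> src G k = x' ->
    exists2 n, (C `&` fibre G x) n & k = s n x'.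
Proof.
move=> cC hU.
pose P (x' : M) (k : X1) := src G k = x' ->
  exists2 n, (C `&` fibre G x) n & k = s n x'.
have : \forall x' \near x, C `<=` P x'; last first.
  by apply: filterS => x' h k /h.
apply: ((compact_near_coveringP C).1 cC M (nbhs x) P) => k Ck.
have [kx|kx] := pselect (src G k = x).
  exists (U k, setT) => /=.
    by split; [apply: open_nbhs_nbhs; case: (hU k) | exact: filterT].
  move=> [k' x'] /= [Uk _] k'x; exists k; first by [].
  by rewrite -k'x; case: (hU k) => _ _ ->.
have : \forall p \near (k, x), src G p.1 <> p.2.
  apply: (@near_neq _ _ (fun p : X1 * M => src G p.1) snd) => //.
    apply: (@continuous_comp _ _ _ fst (src G)); last exact: csrc.
    exact: cvg_fst.
  exact: cvg_snd.
by apply: filterS => -[k' x'] /= ne /ne.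
Qed.

Lemma csec_fibre_finite (f : X1 -> F) : csec (src G) f -> fibre_finite G f.
Proof.
move=> [_ cf] x; apply: sub_finite_set (fibre_compact_finite x cf).
by move=> k [kx fk]; split=> //; exact: subset_closure.
Qed.

(** Over x = src h the sum runs over the finitely many points n of the support
    of f. By fibre_near the same number of sheets s n carries the sum near h,
    and on each sheet the summand is a product of two sections of the sheaf. *)
Lemma sec_groupoid_conv (f g : X1 -> F) :
  csec (src G) f -> csec (src G) g -> sec (src G) (groupoid_conv G al f g).
Proof.
move=> cf cg h; set x := src G h.
have [sf cC] := cf; have [sg _] := cg.
set C := closure _ in cC.
have Cf k : f k <> 0 -> C k.
  by move=> fk; exact: (@subset_closure _ [set y | f y <> 0]).
have /choice[U /choice[s hU]] := etale.
pose N := C `&` fibre G x.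
have fN : finite_set N by exact: fibre_compact_finite.
have sx n : N n -> s n x = n.
  by move=> [_ nx]; have [_ Un _ h' _] := hU n; rewrite -[X in s _ X]nx h'.
have src_s n x' : (src G @` U n) x' -> src G (s n x') = x'.
  by move=> [k Uk <-]; have [_ _ _ h' _] := hU n; rewrite h'.
have xU n : N n -> \forall x' \near x, (src G @` U n) x'.
  move=> [_ nx]; apply: open_nbhs_nbhs; have [_ Un oU _ _] := hU n.
  by split=> //; exists n.
have cs n : N n -> {for x, continuous (s n)}.
  by move=> Nn; have [_ _ _ _ h'] := hU n; apply: h'; apply: nbhs_singleton;
     exact: xU.
(* each point n of the support over x contributes a section *)
have /choice[V /choice[b hb]] : forall n, exists V (b : F), N n ->
    [/\ open V, V x, sections A V b &
    \forall h' \near h, pmul (f (s n (src G h')))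
      (al (s n (src G h')) (g (inv (s n (src G h')) ** h'))) =
      germ (b (src G h'))].
  move=> n; have [Nn|nN] := pselect (N n); last by exists setT, 0.
  have nx : src G n = x by case: Nn.
  pose u h' := s n (src G h').
  have uh : u h = n by rewrite /u sx.
  have cu : {for h, continuous u}.
    by apply: continuous_comp; [exact: csrc | exact: cs].
  pose v h' := inv (u h') ** h'.
  have su : \forall h' \near h, src G (u h') = src G h'.
    have : \forall h' \near h, (src G @` U n) (src G h').
      exact: (near_comp (P := src G @` U n) (@csrc h) (xU _ Nn)).
    by apply: filterS => h' /src_s.
  have cv : {for h, continuous v}.
    apply: mul_continuous_at => //.
      by apply: filterS su => h' e; rewrite /composable tgt_inv.
    by apply: (@continuous_comp _ _ _ u inv) => //; exact: cinv.
  have vh : v h = inv n ** h by rewrite /v uh.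
  have [V1 [b1 [oV1 V1x Vb1 nb1]]] := sf n.
  have [V2 [b2 [oV2 V2x Vb2 nb2]]] := sg (inv n ** h).
  rewrite src_ldiv // in V2x.
  have [V3 [b3 [oV3 V3x Vb3 nb3]]] := al_sec oV2 Vb2 V2x.
  rewrite nx in V1x V3x.
  exists (V1 `&` V3), (pmul b1 b3) => _; split.
  - exact: openI.
  - by [].
  - have oV : open (V1 `&` V3) by exact: openI.
    case: shA => _ _ _ _ /(_ _ oV)[_ _ h']; apply: h'.
      by apply: sections_sub Vb1 => // y [].
    by apply: sections_sub Vb3 => // y [].
  have n1 : \forall h' \near h, f (u h') = germ (b1 (src G (u h'))).
    by apply: (near_comp (P := fun k => f k = germ (b1 (src G k))) cu); rewrite uh.
  have n2 : \forall h' \near h, g (v h') = germ (b2 (src G (v h'))).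
    by apply: (near_comp (P := fun k => g k = germ (b2 (src G k))) cv); rewrite vh.
  have n3 : \forall h' \near h, al (u h') b2 = germ (b3 (src G (u h'))).
    by apply: (near_comp (P := fun k => al k b2 = germ (b3 (src G k))) cu);
       rewrite uh.
  near=> h'.
  have su' : src G (u h') = src G h' by near: h'.
  have f' : f (u h') = germ (b1 (src G (u h'))) by near: h'.
  have g' : g (v h') = germ (b2 (src G (v h'))) by near: h'.
  have a' : al (u h') b2 = germ (b3 (src G (u h'))) by near: h'.
  rewrite -/(u h') -/(v h') f' (al_loc (g := b2)) ?a' ?su' -?germM //.
  by rewrite g' src_ldiv // germK.
pose I : finType := fset_sub_type (fset_set N).
have IN (i : I) : N (val i).
  by have := valP i; rewrite in_fset_set // => /set_mem.
have [|W [oW Wx WV Wb]] := @local_sum _ _ _ shA I (fun=> 1) x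
  (fun i => V (val i)) (fun i => b (val i)).
  by move=> i; case: (hb _ (IN i)).
exists W, (\sum_(i : I) 1 *: b (val i)); split=> //.
have nb : \forall h' \near h, forall i : I,
    pmul (f (s (val i) (src G h')))
      (al (s (val i) (src G h')) (g (inv (s (val i) (src G h')) ** h'))) =
    germ (b (val i) (src G h')).
  by apply: filter_forall => i; case: (hb _ (IN i)).
have nU : \forall h' \near h, forall i : I,
    (src G @` U (val i)) (src G h').
  by apply: filter_forall => i; 
     exact: (near_comp (P := src G @` U (val i)) (@csrc h) (xU _ (IN i))).
have nC : \forall h' \near h, forall k, C k -> src G k = src G h' ->
    exists2 n, N n & k = s n (src G h').
  apply: (near_comp (P := fun x' => forall k, C k -> src G k = x' ->
    exists2 n, N n & k = s n x') (@csrc h)); apply: (@fibre_near C s U x cC) => k.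
  by have [? ? _ ? _] := hU k.
(* the sheets through distinct points stay disjoint near x *)
have ninj : \forall h' \near h, forall i i' : I, i <> i' ->
    s (val i) (src G h') <> s (val i') (src G h').
  apply: filter_forall => i; apply: filter_forall => i'.
  have [->|ii'] := eqVneq i i'; first by near=> h' => /(_ erefl).
  have : \forall h' \near h, s (val i) (src G h') <> s (val i') (src G h').
    apply: (near_comp (P := fun x' => s (val i) x' <> s (val i') x') (@csrc h)).
    apply: near_neq => //; first exact: cs (IN i).
      exact: cs (IN i').
    by rewrite !sx //; move/val_inj/eqP; apply/negP.
  by apply: filterS.
near=> h'.
have hb' : forall i : I, pmul (f (s (val i) (src G h')))
      (al (s (val i) (src G h')) (g (inv (s (val i) (src G h')) ** h'))) =
    germ (b (val i) (src G h')) by near: h'.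
have hU' : forall i : I, (src G @` U (val i)) (src G h') by near: h'.
have hC' : forall k, C k -> src G k = (src G h') -> exists2 n, N n & k = s n (src G h').
  by near: h'.
have hinj' : forall i i' : I, i <> i' -> s (val i) (src G h') <> s (val i') (src G h').
  by near: h'.
set x' := src G h' in hb' hU' hC' hinj' *.
rewrite (@groupoid_conv_on _ _ _ _ G al ((fun n => s n x') @` N)); first last.
- move=> k kx' nN; apply: contrapT => /Cf Ck; apply: nN.
  by have [n Nn ->] := hC' k Ck kx'; exists n.
- move=> _ [n Nn <-]; have nI : n \in fset_set N by rewrite in_fset_set // mem_set.
  by apply: src_s; exact: (hU' [` nI]%fset).
have injN : set_inj N (fun n => s n x').
  move=> n n' /set_mem Nn /set_mem Nn' e; apply: contrapT => nn'.
  have nI : n \in fset_set N by rewrite in_fset_set // mem_set.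
  have nI' : n' \in fset_set N by rewrite in_fset_set // mem_set.
  by apply: (hinj' [` nI]%fset [` nI']%fset) => // /(congr1 val).
rewrite fsbig_image // fsbig_finite // big_seq_fsetE /= gsum_at germ_sum.
by apply: eq_bigr => i _; rewrite hb' scale1r.
Unshelve. all: by end_near.
Qed.

(** The support lies in the image, under the product, of the composable pairs
    of the two supports. *)
Lemma csec_groupoid_conv (f g : X1 -> F) :
  csec (src G) f -> csec (src G) g -> csec (src G) (groupoid_conv G al f g).
Proof.
move=> cf cg; split; first exact: sec_groupoid_conv.
have [[_ cC] [_ cD]] := (cf, cg).
set C := closure _ in cC; set D := closure _ in cD.
pose Z := [set p : X1 * X1 | composable G p.1 p.2] `&` (C `*` D).
have cZ : compact Z.
  rewrite /Z setIC; apply: compact_closedI; first exact: compact_setX.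
  rewrite -openC openE => p np.
  apply: (@near_neq _ _ (fun p : X1 * X1 => tgt G p.1)
    (fun p => src G p.2) p) => //.
    apply: (@continuous_comp _ _ _ fst (tgt G)); last exact: ctgt.
    exact: cvg_fst.
  apply: (@continuous_comp _ _ _ snd (src G)); last exact: csrc.
  exact: cvg_snd.
apply: (@closure_compact _ _ ((fun p : X1 * X1 => p.1 ** p.2) @` Z)) => //.
  apply: continuous_compact => //; apply: continuous_subspaceW cmul.
  by move=> p [].
move=> h /= fgh.
have [k kh fgk] : exists2 k, src G k = src G h &
    f k <> 0 /\ g (inv k ** h) <> 0.
  apply: contrapT => none; apply: fgh; apply: fsbig1 => k kh.
  have [->|fk] := pselect (f k = 0); first exact: pmul0l.
  have [->|gk] := pselect (g (inv k ** h) = 0); first by rewrite al0 pmul0r.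
  by case: none; exists k.
exists (k, inv k ** h); last by rewrite /= mul_ldiv.
split; first by rewrite /composable /= src_ldiv.
by case: fgk => fk gk; split;
  [exact: (@subset_closure _ [set y | f y <> 0])
  |exact: (@subset_closure _ [set y | g y <> 0])].
Qed.

End EtaleConvolution.

(** * Crossed products as convolution algebras *)

Section LieGroupoid.
Context {R : realType} {n : nat} {M X1 : topologicalType}.
Variables (AM : atlas 'rV[R]_n M) (AX : atlas 'rV[R]_n X1) (G : groupoid M X1).
Hypothesis LG : proper_etale_Lie_groupoid AM AX G.

Lemma Lie_groupoid : is_groupoid G. Proof. by case: LG. Qed.
Lemma base_hausdorff : hausdorff_space M. Proof. by case: LG => -[[]]. Qed.
Lemma arrows_hausdorff : hausdorff_space X1.
Proof. by case: LG => -[_ []]. Qed.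

Lemma smooth_continuous (E E' : normedModType R) (X Y : topologicalType)
    (B : atlas E X) (B' : atlas E' Y) (f : X -> Y) :
  smooth B B' f -> continuous f.
Proof. by move=> [cf _] x; exact: cf. Qed.

Lemma local_diffeo_continuous (E E' : normedModType R) (X Y : topologicalType)
    (B : atlas E X) (B' : atlas E' Y) (f : X -> Y) :
  local_diffeo B B' f -> continuous f.
Proof. by move=> lf x; have [U [g [[_ Ux] _ [cf _] _ _]]] := lf x; exact: cf. Qed.

Lemma src_continuous : continuous (src G).
Proof. by case: LG => _ _ [/local_diffeo_continuous + _] _ _. Qed.
Lemma tgt_continuous : continuous (tgt G).
Proof. by case: LG => _ _ [_ /local_diffeo_continuous +] _ _. Qed.
Lemma inv_continuous : continuous (ginv G).
Proof. by case: LG => _ _ _ [_ /smooth_continuous + _] _. Qed.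

Lemma mul_continuous : {within [set p : X1 * X1 | composable G p.1 p.2],
  continuous (fun p : X1 * X1 => gmul G p.1 p.2)}.
Proof.
apply/subspace_continuousP => p cp W nW.
case: LG => _ _ _ [_ _ /(_ p cp)[U [f [oU Up [cf _] fE]]]] _.
have nU : \forall y \near p, U y by exact: open_nbhs_nbhs.
have nf : \forall y \near p, W (f y).
  by apply: (cf p Up); rewrite /nbhs_simpl fE.
suff : \forall y \near p, composable G y.1 y.2 -> W (gmul G y.1 y.2) by [].
by apply: filterS2 nU nf => y Uy + cy; rewrite fE.
Qed.

Lemma src_etale k : exists U (s : M -> X1),
  [/\ open U, U k, open (src G @` U), (forall k', U k' -> s (src G k') = k') &
    forall x, (src G @` U) x -> {for x, continuous s}].
Proof.
case: LG => _ _ [/(_ k)[U [s [[oU Uk] oV _ [cs _] sE]]] _] _ _.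
by exists U, s.
Qed.

End LieGroupoid.

Section ArrowAction.
Context {K : pzRingType} {M X1 : topologicalType} (A : alg_sheaf (K := K) M).
Variables (G : groupoid M X1) (act : arrow_action G A).
Hypothesis shact : is_gsheaf act.
Local Notation F := (germ_family A).

(** The action of an arrow on germs, extended to the product of all stalks by
    looking only at the component over the target of k. *)
Definition push (k : X1) (f : F) : F := germ (act (f (tgt G k))).

Let act_lin k c (a b : stalk A (tgt G k)) :
  act (ascale c a + b) = ascale c (act a) + act b.
Proof. by case: shact => _ /(_ k)[_ + _] _ _ _; apply. Qed.

Let act0 k : act (0 : stalk A (tgt G k)) = 0.
Proof.
have := act_lin (- 1) (0 : stalk A (tgt G k)) 0.
by rewrite /ascale !rmorphN !rmorph1 !mulN1r oppr0 addr0 addNr.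
Qed.

Lemma pushD k (f g : F) : push k (f + g) = push k f + push k g.
Proof.
rewrite /push -germD; congr germ.
have := act_lin 1 (f (tgt G k)) (g (tgt G k)).
by rewrite /ascale !rmorph1 !mul1r.
Qed.

Lemma push0 k : push k (0 : F) = 0.
Proof. by apply/germ_eq0; exact: act0. Qed.

Lemma pushZ k c (f : F) : push k (c *: f) = c *: push k f.
Proof.
rewrite /push -germZ; congr germ; have := act_lin c (f (tgt G k)) 0.
by rewrite act0 !addr0.
Qed.

Lemma pushM k (f g : F) : push k (pmul f g) = pmul (push k f) (push k g).
Proof.
rewrite /push -germM; congr germ.
by case: shact => _ /(_ k)[_ _ +] _ _ _; apply.
Qed.

Lemma push_comp k l (f : F) : is_groupoid G -> tgt G k = src G l ->
  push (gmul G k l) f = push k (push l f).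
Proof.
move=> isG kl; have kl' : composable G k l by [].
case: shact => _ _ _ /(_ k l kl' (f (tgt G l))) + _.
rewrite tr_eq ?tgt_mul // => E.
rewrite /push -(germ_tr (y := src G k)) ?src_mul //.
by rewrite E.
Qed.

Lemma push_loc k (f g : F) : f (tgt G k) = g (tgt G k) -> push k f = push k g.
Proof. by rewrite /push => ->. Qed.

Lemma push_sec V (b : F) k : open V -> sections A V b -> V (tgt G k) ->
  exists V' (b' : F), [/\ open V', V' (src G k), sections A V' b' &
    \forall k' \near k, push k' b = germ (b' (src G k'))].
Proof.
move=> oV Vb Vk; case: shact => _ _ _ _ /(_ V b oV Vb k Vk).
move=> [V' [b' [oV' V'k Vb' nb]]]; exists V', b'; split=> //.
by apply: filterS nb => k' /= e; rewrite /push e.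
Qed.

End ArrowAction.

Section ConvolutionTransfer.
Context {K : pzRingType}.

(** A factorisation of h is determined by its first factor. *)
Lemma convolution_fibre (X0 X1 : topologicalType) (G : groupoid X0 X1)
    (A : alg_sheaf (K := K) X0) (act : arrow_action G A) (c : X1 -> X1 -> K)
    (a b : cpt_sections G A) h : is_groupoid G ->
  convolution act c a b h = \sum_(k \in fibre G (src G h))
    ascale (c k (gmul G (ginv G k) h))
      ((tr (src G h) (a k : stalk A (src G k)) : stalk A (src G h)) *
       tr (src G h) (@act k (tr (tgt G k)
         (b (gmul G (ginv G k) h) : stalk A (src G (gmul G (ginv G k) h)))))).
Proof.
move=> isG; rewrite /convolution.
apply: (reindex_fsbig (fun k => (k, gmul G (ginv G k) h))).
split=> [k kh|k k' _ _ [] //|[k l] /= [kl <-]].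
- by split; rewrite /= ?mul_ldiv // /composable src_ldiv.
- exists k; first by rewrite /fibre /= src_mul.
  by rewrite ldiv_mul.
Qed.

(** If infinitely many of the f k are nonzero then so are their values at x;
    then both sums are zero by convention. *)
Lemma fsum_at (M : topologicalType) (A : alg_sheaf (K := K) M)
    (T : choiceType) (S : set T) (f : T -> germ_family A) x :
  (forall k, S k -> at_point x (f k)) ->
  \sum_(k \in S) f k = germ (\sum_(k \in S) f k x).
Proof.
move=> fx; have [fin|inf] := pselect (finite_set (S `&` f @^-1` [set~ 0])).
  rewrite [in LHS]fsbig_supp [in RHS](_ : \sum_(k \in S) _ =
    \sum_(k \in S `&` f @^-1` [set~ 0]) f k x).
    rewrite !fsbig_finite // germ_sum big_seq [in RHS]big_seq.
    apply: eq_bigr => k; rewrite in_fset_set // => /set_mem[Sk _].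
    by rewrite at_pointE //; exact: fx.
  symmetry; apply: fsbig_widen => [k []//|k [Sk] /= /not_andP[//|]].
  by move=> /contrapT ->.
rewrite fsbig_dflt // fsbig_dflt ?germ0 // => fin; apply: inf.
apply: sub_finite_set fin => k [Sk fk]; split=> //= fk0; apply: fk.
by rewrite -(at_pointE (fx k Sk)) fk0 germ0.
Qed.

Section Extension.
Context {M H Q : topologicalType} (A : alg_sheaf (K := K) M).
Variables (GH : groupoid M H) (GQ : groupoid M Q) (j : H -> Q).
Variable act : arrow_action GQ A.
Hypothesis isGH : is_groupoid GH.
Hypothesis src_j : forall h, src GQ (j h) = src GH h.

Lemma hat_crossed_product (a b : crossed_product (action_via (GH := GH) j act)) :
  hat (amul a b : forall h, stalk A (src GH h)) =
  groupoid_conv GH (fun h => push act (j h))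
    (hat (a : forall h, stalk A (src GH h)))
    (hat (b : forall h, stalk A (src GH h))).
Proof.
apply/funext => h; rewrite /hat /groupoid_conv.
rewrite (@fsum_at _ _ _ _ _ (src GH h)) => [|k kh]; last first.
  by rewrite -kh; apply: at_pointMl; exact: at_germ.
congr germ; rewrite [LHS]convolution_fibre //.
apply: eq_fsbigr => k /set_mem kh.
rewrite /ascale rmorph1 mul1r /pmul /push; congr (_ * _).
rewrite /germ /action_via tr_tr ?src_j //.
by rewrite [X in act X]tr_tr // src_ldiv.
Qed.

End Extension.

Section Dual.
Context {R : realType} {gT : finGroupType} {M Q : topologicalType}.
Variables (A : alg_sheaf (K := K) M) (GQ : groupoid M Q).
Variable D : unitary_dual R gT.
Variables (qact : Q -> D -> D) (act : arrow_action GQ A).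
Local Notation GD := (dual_groupoid GQ qact).
Local Notation DQ := (discrete_topology D * Q)%type.
Local Notation DM := (discrete_topology D * M)%type.
Local Notation F := (germ_family A).

(** The stalks of the dual sheaf are those of A, so transport in the discrete
    coordinate is invisible. *)
Lemma tr_dual (x y : DM) (v : stalk (dual_sheaf D A) x) : x.1 = y.1 ->
  @tr _ _ (dual_sheaf D A) x y v = @tr _ _ A x.2 y.2 v.
Proof.
case: x y v => r x [r' y] /= v <-; have [xy|xy] := pselect (x = y).
  by case: y / xy; rewrite !tr_id.
by rewrite !tr_neq // => -[].
Qed.

Definition dual_hat (b : forall y : DQ, stalk (dual_sheaf D A) (src GD y)) :
    DQ -> F :=
  @hat _ _ A DQ (fun y => src GQ y.2) b.

Hypothesis isGQ : is_groupoid GQ.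
Hypothesis qact_mul : forall r q q', tgt GQ q = src GQ q' ->
  qact (gmul GQ q q') r = qact q' (qact q r).
Hypothesis qact_unit : forall r x, qact (gunit GQ x) r = r.

Lemma dual_is_groupoid : is_groupoid GD.
Proof.
split=> [[r x]|[r q] [r' q']|[r q] [r' q'] [r'' q'']|[r q]|[r q]];
  rewrite /composable /=.
- by rewrite qact_unit src_unit // tgt_unit.
- by move=> [<- e]; rewrite qact_mul // src_mul // tgt_mul.
- by move=> [_ e] [_ e']; rewrite mul_assoc.
- by rewrite unit_mul // mul_unit.
- rewrite src_inv // tgt_inv // mul_inv // inv_mul //; split=> //.
  by rewrite -qact_mul ?src_inv // mul_inv // qact_unit.
Qed.

(** In a product of the dual groupoid only the second coordinates are
    independent: the class in the first factor determines all others. *)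
Lemma dual_hat_mul (c : D -> Q -> Q -> K)
    (b b' : cpt_sections GD (dual_sheaf D A)) r q :
  dual_hat (convolution (dual_action (qact := qact) act)
    (fun y y' => c y.1 y.2 y'.2) b b') (r, q) =
  \sum_(k \in fibre GQ (src GQ q)) c r k (gmul GQ (ginv GQ k) q) *:
    pmul (dual_hat b (r, k))
      (push act k (dual_hat b' (qact k r, gmul GQ (ginv GQ k) q))).
Proof.
rewrite (@fsum_at _ _ _ _ _ (src GQ q)) => [|k kq]; last first.
  by rewrite -kq; apply/at_pointZ/at_pointMl; exact: at_germ.
rewrite /dual_hat /hat; congr germ.
rewrite convolution_fibre; last exact: dual_is_groupoid.
rewrite (reindex_fsbig (fun k => (r, k)) (fibre GQ (src GQ q))); last first.
  split=> [k kq|k k' _ _ [] //|[r' k] [-> kq]]; last by exists k.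
  by rewrite /fibre /= kq.
apply: eq_fsbigr => k /set_mem kq.
rewrite gscaleE /pmul; congr (ascale _ (_ * _)).
  by rewrite tr_dual.
by rewrite tr_dual // /push /germ /dual_action tr_dual.
Qed.

Lemma dual_carrier (b : cpt_sections GD (dual_sheaf D A)) :
  continuous (src GQ) ->
  carrier b <-> csec (fun y : DQ => src GQ y.2) (dual_hat b).
Proof.
move=> csrc; rewrite /carrier /= /csec /dual_hat -supp_hat.
split=> -[sb cb]; split=> //.
  move=> [r q].
  have [V [b1 [oV Vq Vb1 nb1]]] := sb (r, q) I.
  have [V2 [b2 [oV2 V2q Vb2 nb2]]] := Vb1 _ Vq.
  exists V2, b2; split=> //.
  have cs : {for (r, q) : DQ, continuous (src GD)}.
    have c1 : (fun y : DQ => y.1) @ nbhs ((r, q) : DQ) -->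
      nbhs (r : discrete_topology D) by exact: cvg_fst.
    have c2 : {for ((r, q) : DQ), continuous (fun y : DQ => src GQ y.2)}.
      apply: (@continuous_comp _ _ _ snd (src GQ)); last exact: csrc.
      exact: cvg_snd.
    exact: (cvg_pair c1 c2).
  have nb2' := near_comp (P := fun z : DM => b1 z = b2 z.2) cs nb2.
  by apply: filterS2 nb1 nb2' => y /= e1 e2; rewrite /hat e1 e2.
move=> [r q] _; have [V [b1 [oV Vq Vb1 nb1]]] := sb (r, q).
exists (snd @^-1` V), (fun z : DM => b1 z.2); split=> //.
- by apply: open_comp oV => z _; exact: cvg_snd.
- by move=> z Vz; exists V, b1; split=> //; near=> z'.
apply: filterS nb1 => y /= /(congr1 (fun f : F => f (src GQ y.2))).
by rewrite /hat !germK.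
Unshelve. all: by end_near.
Qed.

End Dual.
End ConvolutionTransfer.

(** * Arithmetic of the extension *)

Section ExtensionAlgebra.
Context {R : realType} {n : nat} {gT : finGroupType} {M H Q : topologicalType}.
Variables (AM : atlas 'rV[R]_n M) (AH : atlas 'rV[R]_n H)
  (AQ : atlas 'rV[R]_n Q).
Variables (GH : groupoid M H) (GQ : groupoid M Q).
Variables (iota : M -> gT -> H) (j : H -> Q) (sigma : Q -> H).
Hypothesis LH : proper_etale_Lie_groupoid AM AH GH.
Hypothesis LQ : proper_etale_Lie_groupoid AM AQ GQ.
Hypothesis ext : is_extension AM AH AQ GH GQ iota j.
Hypothesis sec_sigma : is_section AH AQ GH GQ j sigma.

Local Notation "k ** l" := (gmul GH k l) (at level 40, left associativity).
Local Notation isGH := (Lie_groupoid LH).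
Local Notation isGQ := (Lie_groupoid LQ).
Local Notation tau := (tau GH GQ iota sigma).
Local Notation Ad := (Ad GH GQ iota sigma).

Lemma src_iota x g : src GH (iota x g) = x.
Proof. by case: ext => -[/(_ x g)[]]. Qed.
Lemma tgt_iota x g : tgt GH (iota x g) = x.
Proof. by case: ext => -[/(_ x g)[]]. Qed.
Lemma iotaM x g h : iota x (g * h)%g = iota x g ** iota x h.
Proof. by case: ext => -[_ + _ _] _ _; apply. Qed.
Lemma iota_inj x : injective (iota x).
Proof. by case: ext => -[_ _ + _] _ _; apply. Qed.
Lemma iota_continuous g : continuous (iota^~ g).
Proof. by case: ext => -[_ _ _ /(_ g)/smooth_continuous +] _ _; apply. Qed.
Lemma src_j h : src GQ (j h) = src GH h.
Proof. by case: ext => _ -[/(_ h)[]]. Qed.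
Lemma tgt_j h : tgt GQ (j h) = tgt GH h.
Proof. by case: ext => _ -[/(_ h)[]]. Qed.
Lemma j_unit x : j (gunit GH x) = gunit GQ x.
Proof. by case: ext => _ -[_ + _ _ _] _; apply. Qed.
Lemma j_mul h k : tgt GH h = src GH k -> j (h ** k) = gmul GQ (j h) (j k).
Proof. by case: ext => _ -[_ _ + _ _] _; apply. Qed.
Lemma j_continuous : continuous j.
Proof. by case: ext => _ -[_ _ _ /smooth_continuous + _] _. Qed.
Lemma j_ker h : (exists x, j h = gunit GQ x) -> exists x g, h = iota x g.
Proof. by case: ext => _ _ /(_ h)[]. Qed.
Lemma j_iota x g : exists y, j (iota x g) = gunit GQ y.
Proof. by case: ext => _ _ /(_ (iota x g))[_ +]; apply; exists x, g. Qed.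
Lemma sigma_continuous : continuous sigma.
Proof. by case: sec_sigma => /smooth_continuous. Qed.
Lemma j_sigma q : j (sigma q) = q. Proof. by case: sec_sigma. Qed.
Lemma sigma_unit x : sigma (gunit GQ x) = gunit GH x.
Proof. by case: sec_sigma. Qed.
Lemma src_sigma q : src GH (sigma q) = src GQ q.
Proof. by rewrite -src_j j_sigma. Qed.
Lemma tgt_sigma q : tgt GH (sigma q) = tgt GQ q.
Proof. by rewrite -tgt_j j_sigma. Qed.

Lemma jiota x g : j (iota x g) = gunit GQ x.
Proof.
have [y e] := j_iota x g; rewrite e; congr gunit.
by have := src_j (iota x g); rewrite e src_unit ?src_iota //; exact: isGQ.
Qed.

Lemma iota1 x : iota x 1%g = gunit GH x.
Proof.
have := iotaM x 1 1; rewrite mulg1 => e.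
apply: (@mul_cancel _ _ _ isGH (iota x 1%g)).
- by rewrite src_iota tgt_iota.
- by rewrite tgt_iota src_unit //; exact: isGH.
by rewrite -e mul_unit ?tgt_iota //; exact: isGH.
Qed.

Lemma fiber_iota x g : fiber_elt GH iota (iota x g) = g.
Proof.
rewrite /fiber_elt src_iota; apply: (@iota_inj x).
by apply: (@xgetPex _ 1%g [set g0 | iota x g0 = iota x g]); exists g.
Qed.

Lemma fiber_eltK h : (exists x g, h = iota x g) ->
  iota (src GH h) (fiber_elt GH iota h) = h.
Proof. by move=> [x [g ->]]; rewrite fiber_iota src_iota. Qed.

(** Every arrow of the extension is uniquely of the form lift g q: these are
    the coordinates in which all later formulas are computed. *)
Definition lift (g : gT) (q : Q) : H := iota (src GQ q) g ** sigma q.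
Definition gpart (h : H) : gT :=
  fiber_elt GH iota (h ** ginv GH (sigma (j h))).

Lemma src_lift g q : src GH (lift g q) = src GQ q.
Proof. by rewrite src_mul ?src_iota ?tgt_iota ?src_sigma //; exact: isGH. Qed.
Lemma tgt_lift g q : tgt GH (lift g q) = tgt GQ q.
Proof. by rewrite tgt_mul ?tgt_iota ?src_sigma ?tgt_sigma //; exact: isGH. Qed.
Lemma j_lift g q : j (lift g q) = q.
Proof.
rewrite j_mul ?tgt_iota ?src_sigma // j_sigma jiota unit_mul //; exact: isGQ.
Qed.
Lemma gpart_lift g q : gpart (lift g q) = g.
Proof.
rewrite /gpart j_lift rdiv_mul ?fiber_iota //; first exact: isGH.
by rewrite tgt_iota src_sigma.
Qed.
Lemma lift_gpart h : lift (gpart h) (j h) = h.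
Proof.
have hs : tgt GH h = tgt GH (sigma (j h)) by rewrite tgt_sigma tgt_j.
have e : src GH (h ** ginv GH (sigma (j h))) = src GH h.
  by rewrite src_mul ?src_inv //; exact: isGH.
rewrite /lift /gpart src_j -e fiber_eltK ?mul_rdiv //; first exact: isGH.
apply: j_ker; exists (src GH h).
have js : j (ginv GH (sigma (j h))) = ginv GQ (j h).
  apply: (@mul_cancel _ _ _ isGQ (j h)).
  - by rewrite src_j src_inv ?tgt_sigma //; exact: isGH.
  - by rewrite src_inv //; exact: isGQ.
  rewrite mul_inv; last exact: isGQ.
  rewrite -[X in gmul _ X _]j_sigma -j_mul; last by rewrite (src_inv isGH).
  rewrite mul_inv; last exact: isGH.
  by rewrite j_unit src_sigma.
rewrite j_mul ?src_inv //; last exact: isGH.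
by rewrite js mul_inv ?src_j //; exact: isGQ.
Qed.

Lemma lift_inj g g' q q' : lift g q = lift g' q' -> g = g' /\ q = q'.
Proof.
by move=> e; rewrite -(gpart_lift g q) e gpart_lift -(j_lift g q) e j_lift.
Qed.

Lemma sigmaE q : sigma q = lift 1%g q.
Proof.
by rewrite /lift iota1 unit_mul ?src_sigma //; exact: isGH.
Qed.

Lemma iota_lift x g g' q : x = src GQ q ->
  iota x g ** lift g' q = lift (g * g')%g q.
Proof.
move=> ->; rewrite /lift iotaM (mul_assoc isGH) ?tgt_iota ?src_iota //.
by rewrite src_sigma.
Qed.

Lemma sigma_iota q g :
  sigma q ** iota (tgt GQ q) g = lift (Ad q g) q.
Proof.
have c1 : tgt GH (sigma q) = src GH (iota (tgt GQ q) g).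
  by rewrite tgt_sigma src_iota.
have := lift_gpart (sigma q ** iota (tgt GQ q) g).
rewrite j_mul // jiota (mul_unit isGQ) ?j_sigma //.
by rewrite /gpart j_mul // jiota (mul_unit isGQ) ?j_sigma.
Qed.

Lemma lift_iota g q g' x : x = tgt GQ q ->
  lift g q ** iota x g' = lift (g * Ad q g')%g q.
Proof.
move=> ->; rewrite {1}/lift -(mul_assoc isGH) ?tgt_iota ?src_sigma //.
  by rewrite sigma_iota iota_lift.
by rewrite tgt_sigma src_iota.
Qed.

Lemma sigma_sigma q q' : tgt GQ q = src GQ q' ->
  sigma q ** sigma q' = lift (tau q q') (gmul GQ q q').
Proof.
move=> qq'; have c1 : tgt GH (sigma q) = src GH (sigma q').
  by rewrite tgt_sigma src_sigma.
have := lift_gpart (sigma q ** sigma q').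
by rewrite /gpart j_mul // !j_sigma => ->.
Qed.

Lemma lift_mul g g' q q' : tgt GQ q = src GQ q' ->
  lift g q ** lift g' q' = lift (g * Ad q g' * tau q q')%g (gmul GQ q q').
Proof.
move=> qq'; rewrite {2}/lift (mul_assoc isGH) ?src_iota ?tgt_iota ?src_sigma//;
  last by rewrite tgt_lift.
rewrite lift_iota // {1}/lift -(mul_assoc isGH) ?tgt_iota ?src_sigma ?tgt_sigma//.
by rewrite sigma_sigma // iota_lift // (src_mul isGQ).
Qed.

Lemma AdM q g g' : Ad q (g * g')%g = (Ad q g * Ad q g')%g.
Proof.
have : lift (Ad q (g * g')%g) q = lift (Ad q g * Ad q g')%g q.
  rewrite -(@lift_iota _ _ _ (tgt GQ q)) // -!sigma_iota iotaM (mul_assoc isGH) //.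
    by rewrite tgt_sigma src_iota.
  by rewrite tgt_iota src_iota.
by case/lift_inj.
Qed.

Lemma Ad1 q : Ad q 1%g = 1%g.
Proof. by apply: (mulgI (Ad q 1%g)); rewrite -AdM !mulg1. Qed.

Lemma AdV q g : Ad q g^-1%g = (Ad q g)^-1%g.
Proof. by apply: (mulgI (Ad q g)); rewrite -AdM !mulgV Ad1. Qed.

Lemma Ad_inj q : injective (Ad q).
Proof.
move=> g g' e; apply: (@iota_inj (tgt GQ q)).
apply: (@mul_cancel _ _ _ isGH (sigma q)); rewrite ?tgt_sigma ?src_iota //.
by rewrite !sigma_iota e.
Qed.

Lemma Ad_unit x g : Ad (gunit GQ x) g = g.
Proof.
have : lift (Ad (gunit GQ x) g) (gunit GQ x) = lift g (gunit GQ x).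
  rewrite -sigma_iota /lift sigma_unit tgt_unit ?src_unit //; try exact: isGQ.
  by rewrite unit_mul ?mul_unit ?src_iota ?tgt_iota //; exact: isGH.
by case/lift_inj.
Qed.

(** Ad is multiplicative only up to conjugation by tau: both sides are the
    group part of sigma(q) sigma(q') g. *)
Lemma Ad_Ad q q' g : tgt GQ q = src GQ q' ->
  (Ad q (Ad q' g) * tau q q')%g = (tau q q' * Ad (gmul GQ q q') g)%g.
Proof.
move=> qq'.
have : lift (Ad q (Ad q' g) * tau q q')%g (gmul GQ q q') =
       lift (tau q q' * Ad (gmul GQ q q') g)%g (gmul GQ q q').
  rewrite -(@lift_iota _ _ _ (tgt GQ q')); last by rewrite tgt_mul //; exact: isGQ.
  rewrite -sigma_sigma // -(mul_assoc isGH) ?tgt_sigma ?src_sigma ?src_iota //.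
  by rewrite sigma_iota sigmaE lift_mul // mul1g.
by case/lift_inj.
Qed.

Lemma lift_continuous g : continuous (lift g).
Proof.
move=> q; apply: (mul_continuous_at (mul_continuous LH)).
- by near=> q'; rewrite /composable tgt_iota src_sigma.
- apply: (@continuous_comp _ _ _ (src GQ) (iota^~ g)).
    exact: (src_continuous LQ).
  exact: iota_continuous.
- exact: sigma_continuous.
Unshelve. all: by end_near.
Qed.

(** The map g sigma(j -) agrees with the identity at any h with group part g;
    since src is locally injective, it agrees with it near h. *)
Lemma gpart_locally_constant h : \forall h' \near h, gpart h' = gpart h.
Proof.
have [U [s [oU Uh _ sE _]]] := src_etale LH h.
have nU : \forall h' \near h, U h' by exact: open_nbhs_nbhs.
have cl : {for h, continuous (fun h' => lift (gpart h) (j h'))}.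
  apply: (@continuous_comp _ _ _ j (lift (gpart h))); first exact: j_continuous.
  exact: lift_continuous.
have nU' : \forall h' \near h, U (lift (gpart h) (j h')).
  by apply: (near_comp (P := U) cl); rewrite lift_gpart; exact: open_nbhs_nbhs.
apply: filterS2 nU nU' => h' Uh' Ul.
have : lift (gpart h) (j h') = h'.
  by rewrite -(sE _ Ul) src_lift src_j sE.
by rewrite -{2}(lift_gpart h') => /lift_inj[].
Qed.

(** * The action on the dual and the cocycle *)

Variables (D : unitary_dual R gT) (qact : Q -> D -> D).
Variable T : forall (q : Q) (r r' : D), 'M[R[i]]_(rdim r', rdim r).
Variable c : D -> Q -> Q -> R[i].
Hypothesis intT : is_intertwiner GH GQ iota sigma qact T.
Hypothesis coc : is_cocycle_of GH GQ iota sigma qact T c.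

Local Notation C := R[i].
Local Notation order := (#|gT|%:R : C).
Local Notation Tm q r := (T q r (qact q r)).
Implicit Types (r s : D) (q : Q) (g : gT).

Lemma T_adjr q r : Tm q r *m (Tm q r)^t* = 1%:M.
Proof. by case: intT. Qed.
Lemma T_adjl q r : (Tm q r)^t* *m Tm q r = 1%:M.
Proof. by case: intT. Qed.

Lemma rep_Ad q r g :
  rep r (Ad q g) = (Tm q r)^t* *m rep (qact q r) g *m Tm q r.
Proof. by case: intT. Qed.

Lemma T_intertwines q r g :
  Tm q r *m rep r (Ad q g) = rep (qact q r) g *m Tm q r.
Proof. by rewrite rep_Ad !mulmxA T_adjr mul1mx. Qed.

Lemma T_intertwines_adj q r g :
  rep r (Ad q g) *m (Tm q r)^t* = (Tm q r)^t* *m rep (qact q r) g.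
Proof. by rewrite rep_Ad -!mulmxA T_adjr mulmx1. Qed.

(** Representatives of the classes are equal as soon as they are isomorphic. *)
Lemma rep_iso r s (B : 'M[C]_(rdim r, rdim s)) B' :
  B *m B' = 1%:M -> B' *m B = 1%:M ->
  (forall g, rep r g *m B = B *m rep s g) -> r = s.
Proof.
move=> BB' B'B hom; apply: rep_inj.
have free m p (X : 'M[C]_(m, p)) X' : X *m X' = 1%:M -> row_free X.
  by move=> e; apply/row_freeP; exists X'.
have fB := free _ _ _ _ BB'; have fB' := free _ _ _ _ B'B.
exists B => //; apply/eqP; rewrite eqn_leq -{1}(eqP fB) rank_leq_col.
by rewrite -(eqP fB') rank_leq_col.
Qed.

Lemma rdim_qact q r : rdim (qact q r) = rdim r.
Proof.
have free m p (X : 'M[C]_(m, p)) X' : X *m X' = 1%:M -> row_free X.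
  by move=> e; apply/row_freeP; exists X'.
have f1 := free _ _ _ _ (T_adjr q r); have f2 := free _ _ _ _ (T_adjl q r).
apply/eqP; rewrite eqn_leq -{1}(eqP f1) rank_leq_col.
by rewrite -(eqP f2) rank_leq_col.
Qed.

(** T identifies the class of q([r]) with r o Ad_q, and Ad_q is a bijection. *)
Lemma qact_inj q : injective (qact q).
Proof.
move=> r r' e.
have [adl adr] : (T q r' (qact q r))^t* *m T q r' (qact q r) = 1%:M /\
    T q r' (qact q r) *m (T q r' (qact q r))^t* = 1%:M.
  by rewrite e; split; [exact: T_adjl | exact: T_adjr].
have homr' g : rep r' (Ad q g) =
    (T q r' (qact q r))^t* *m rep (qact q r) g *m T q r' (qact q r).
  by rewrite e; exact: rep_Ad.
apply: (@rep_iso r r' ((Tm q r)^t* *m T q r' (qact q r))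
  ((T q r' (qact q r))^t* *m Tm q r)).
- by rewrite mulmxA -[_ *m _ *m (T q r' _)^t*]mulmxA adr mulmx1 T_adjl.
- by rewrite mulmxA -[_ *m _ *m (Tm q r)^t*]mulmxA T_adjr mulmx1 adl.
have [f _ fK] := injF_bij (@Ad_inj q).
move=> g; rewrite -(fK g) mulmxA T_intertwines_adj homr'.
by rewrite -!mulmxA [T q r' _ *m (_ *m _)]mulmxA adr mul1mx.
Qed.

Lemma qact_unit r x : qact (gunit GQ x) r = r.
Proof.
symmetry; apply: (rep_iso (T_adjl _ _) (T_adjr _ _)) => g.
rewrite -T_intertwines_adj.
by rewrite Ad_unit.
Qed.

(** By Ad_Ad the composite T T rho(tau) intertwines both representations. *)
Lemma qact_mul r q q' : tgt GQ q = src GQ q' ->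
  qact (gmul GQ q q') r = qact q' (qact q r).
Proof.
move=> qq'; set q'' := gmul GQ q q'.
pose N := Tm q' (qact q r) *m Tm q r *m rep r (tau q q').
pose N' := rep r (tau q q')^-1%g *m (Tm q r)^t* *m (Tm q' (qact q r))^t*.
have NN' : N *m N' = 1%:M.
  rewrite /N /N' !mulmxA -[_ *m rep r _ *m rep r _]mulmxA -rep_mul mulgV rep1.
  by rewrite mulmx1 -[_ *m Tm q r *m _]mulmxA T_adjr mulmx1 T_adjr.
have N'N : N' *m N = 1%:M.
  rewrite /N /N' !mulmxA -[_ *m _^t* *m Tm q' _]mulmxA T_adjl mulmx1.
  by rewrite -[_ *m _^t* *m Tm q _]mulmxA T_adjl mulmx1 -rep_mul mulVg rep1.
have homN g : rep (qact q' (qact q r)) g *m N = N *m rep r (Ad q'' g).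
  rewrite /N !mulmxA -T_intertwines -[_ *m rep _ _ *m Tm q r]mulmxA.
  rewrite -T_intertwines -!mulmxA -!rep_mul.
  by rewrite Ad_Ad.
move: N N' NN' N'N homN => N N' NN' N'N homN.
apply: (@rep_iso _ _ (Tm q'' r *m N') (N *m (Tm q'' r)^t*)).
- by rewrite mulmxA -[_ *m N' *m N]mulmxA N'N mulmx1 T_adjr.
- by rewrite mulmxA -[_ *m _^t* *m Tm q'' r]mulmxA T_adjl mulmx1 NN'.
move=> g; rewrite mulmxA -T_intertwines -!mulmxA; congr (_ *m _).
transitivity (N' *m (N *m rep r (Ad q'' g)) *m N').
  by rewrite mulmxA N'N mul1mx.
by rewrite -homN -!mulmxA NN' mulmx1.
Qed.

Lemma cocycleE r q q' : tgt GQ q = src GQ q' ->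
  Tm q' (qact q r) *m Tm q r *m rep r (tau q q') =
  c r q q' *: T (gmul GQ q q') r (qact q' (qact q r)).
Proof.
move=> qq'; have [_ ->] := coc r qq'; rewrite -scalemxAl; congr (_ *: _).
by rewrite mulmxKV // repr_mx_unit // inE.
Qed.

(** Matrix coefficients that embed functions on the dual groupoid into functions
    on the extension, by Fourier inversion, and that recover them. *)
Definition phi_coef g q r : C :=
  (rdim r)%:R / order *
  (Tm q r *m rep r g^-1%g) (base_index (qact q r)) (base_index r).

Definition psi_coef g q r : C :=
  (rep r g *m (Tm q r)^t*) (base_index r) (base_index (qact q r)).

(** Orthogonality, in the case where the middle factor is T T^* = 1. *)
Lemma psi_phi_coef q r s :
  \sum_g psi_coef g q r * phi_coef g q s = (r == s)%:R.
Proof.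
rewrite /psi_coef /phi_coef; under eq_bigr => g _.
  rewrite mulrCA -[rep r g](mul1mx) -[_ *m rep s _]mulmx1; over.
rewrite -mulr_sumr; have [->|rs] := eqVneq r s; last first.
  by rewrite orthogonality // mulr0.
rewrite orthogonality_eq T_adjr mul1mx !mxE !eqxx !mulr1.
by rewrite mulrA divfK ?order_neq0 // divff ?rdim_neq0.
Qed.

(** The kernel of the compression by the corner idempotent on both sides. The
    sum over y is an orthogonality sum for the representation q([r]), since
    r o Ad_q is conjugate to it by T. *)
Lemma phi_psi_coef q a g :
  \sum_y corner D (a * Ad q y^-1 * g^-1)%g * corner D y =
  \sum_r phi_coef a q r * psi_coef g q r.
Proof.
rewrite /corner /matrix_unit.
under eq_bigr => y _ do rewrite mulr_suml.
rewrite exchange_big; apply: eq_bigr => r _ /=.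
under eq_bigr => y _ do rewrite mulr_sumr.
have E s y : (rdim r)%:R / order *
      rep r (a * Ad q y^-1 * g^-1)^-1%g (base_index r) (base_index r) *
      ((rdim s)%:R / order * rep s y^-1%g (base_index s) (base_index s)) =
    (rdim r)%:R / order * ((rdim s)%:R / order) *
    ((rep r g *m (Tm q r)^t* *m rep (qact q r) y *m (Tm q r *m rep r a^-1%g))
       (base_index r) (base_index r) *
     (1%:M *m rep s y^-1%g *m 1%:M) (base_index s) (base_index s)).
  rewrite mulrACA; congr (_ * _); rewrite mul1mx mulmx1; congr (_ * _).
  congr (fun_of_matrix _ _ _).
  rewrite !invMg invgK AdV invgK !rep_mul rep_Ad.
  by rewrite !mulmxA.
rewrite exchange_big (bigD1 (qact q r)) //= [X in _ + X]big1 ?addr0; last first.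
  move=> s sr; under eq_bigr => y _ do rewrite E.
  by rewrite -mulr_sumr orthogonality ?mulr0 // eq_sym.
under eq_bigr => y _ do rewrite E.
rewrite -mulr_sumr orthogonality_eq mul1mx mulmx1.
rewrite /phi_coef /psi_coef; set x := _ (base_index _) (base_index _); set y := (_ *m _^t*) _ _.
have : order / (rdim (qact q r))%:R * ((rdim (qact q r))%:R / order) = 1 :> C.
  by rewrite mulrA divfK ?rdim_neq0 // divff ?order_neq0.
set u := order / _; set v := (rdim (qact q r))%:R / order => uv.
by rewrite -[RHS]mul1r -uv; ring.
Qed.

(** The multiplicativity of phi in coordinates. With b the group part of the
    quotient, Ad_q(b^-1) = tau g^-1 a; writing s' = q([r]), the coefficient of
    b at s' becomes one of a at r, conjugated by T. Orthogonality then forces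
    r = s and leaves T T rho(tau) rho(g^-1), where T T rho(tau) is c T. *)
Lemma convolution_coef q q' s s' g : tgt GQ q = src GQ q' ->
  \sum_a phi_coef a q s *
    phi_coef (gpart
      (gmul GH (ginv GH (lift a q))
               (lift g (gmul GQ q q')))) q' s' =
  (s' == qact q s)%:R * (c s q q' * phi_coef g (gmul GQ q q') s).
Proof.
move=> qq'; pose gp := gpart.
(* the group part b of the quotient, from g = a Ad(b) tau *)
have AdE a : Ad q (gp (gmul GH (ginv GH (lift a q))
    (lift g (gmul GQ q q'))))^-1%g = (tau q q' * g^-1 * a)%g.
  set b := gp _.
  have sl : src GH (lift a q) = src GH (lift g (gmul GQ q q')).
    by rewrite !src_lift (src_mul isGQ).
  have jd : j (gmul GH (ginv GH (lift a q)) (lift g (gmul GQ q q'))) = q'.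
    apply: (mul_cancel isGQ (k := q)) => //.
      by rewrite src_j (src_ldiv isGH sl) tgt_lift.
    rewrite -{1}(j_lift a q) -j_mul.
      by rewrite (mul_ldiv isGH sl) j_lift.
    by rewrite (src_ldiv isGH sl).
  have := mul_ldiv isGH sl.
  rewrite -[X in gmul _ _ X]lift_gpart jd.
  rewrite lift_mul //.
  move=> /lift_inj[<- _].
  rewrite AdV !invMg.
  by rewrite !mulgA mulgV mul1g mulgKV.
have [f _ fK] := injF_bij (@qact_inj q).
rewrite -(fK s') (inj_eq (@qact_inj q)); move: (f s') => r {f fK}.
have E a : phi_coef a q s * phi_coef (gp (gmul GH (ginv GH (lift a q))
    (lift g (gmul GQ q q')))) q' (qact q r) =
  (rdim s)%:R / order * ((rdim (qact q r))%:R / order) *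
  ((Tm q' (qact q r) *m Tm q r *m rep r (tau q q') *m rep r g^-1%g *m rep r a *m
      (Tm q r)^t*) (base_index _) (base_index _) *
   (Tm q s *m rep s a^-1%g *m 1%:M) (base_index _) (base_index _)).
  rewrite /phi_coef mulrACA mulmx1 [X in _ = _ * X]mulrC.
  congr (_ * _); congr (_ * _); congr (fun_of_matrix _ _ _).
  rewrite -[LHS]mulmx1 -(T_adjr q r) mulmxA -[_ *m Tm q r]mulmxA.
  rewrite -T_intertwines AdE !rep_mul !mulmxA.
  by [].
under eq_bigr => a _ do rewrite E.
rewrite -mulr_sumr; have [->|rs] := eqVneq r s; last first.
  by rewrite orthogonality // mulr0 mul0r.
rewrite orthogonality_eq T_adjr mulmx1 cocycleE // mul1r.
have -> : (rdim (qact q s))%:R = (rdim s)%:R :> C by rewrite rdim_qact.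
rewrite -scalemxAl /phi_coef -(qact_mul s qq') !mxE !eqxx.
have : order / (rdim s)%:R * ((rdim s)%:R / order) = 1 :> C.
  by rewrite mulrA divfK ?rdim_neq0 // divff ?order_neq0.
set u := order / _; set v := (rdim s)%:R / order => uv.
set x := \sum_j0 _; have -> : true%:R = 1 :> C by [].
by rewrite mulr1 -[RHS]mul1r -uv; ring.
Qed.


(** * The corner of the crossed product *)

Variables (A : alg_sheaf (K := R[i]) M) (act : arrow_action GQ A).
Hypothesis shact : is_gsheaf act.
Local Notation F := (germ_family A).
Local Notation DQ := (discrete_topology D * Q)%type.
Local Notation al := (fun h : H => push act (j h)).
Local Notation conv := (groupoid_conv GH al).
Implicit Types (f u : H -> F) (b : DQ -> F) (x y : gT -> C).

(** Translation of arrows by the kernel; it changes neither source and target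
    nor the image in Q. *)
Definition shiftl g h : H := iota (src GH h) g ** h.
Definition shiftr h g : H := h ** iota (tgt GH h) g.

Lemma shiftl_lift g a q : shiftl g (lift a q) = lift (g * a)%g q.
Proof. by rewrite /shiftl iota_lift // src_lift. Qed.
Lemma shiftr_lift g a q : shiftr (lift a q) g = lift (a * Ad q g)%g q.
Proof. by rewrite /shiftr lift_iota // tgt_lift. Qed.
Lemma src_shiftl g h : src GH (shiftl g h) = src GH h.
Proof. by rewrite -(lift_gpart h) shiftl_lift !src_lift. Qed.
Lemma tgt_shiftl g h : tgt GH (shiftl g h) = tgt GH h.
Proof. by rewrite -(lift_gpart h) shiftl_lift !tgt_lift. Qed.
Lemma src_shiftr g h : src GH (shiftr h g) = src GH h.
Proof. by rewrite -(lift_gpart h) shiftr_lift !src_lift. Qed.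
Lemma tgt_shiftr g h : tgt GH (shiftr h g) = tgt GH h.
Proof. by rewrite -(lift_gpart h) shiftr_lift !tgt_lift. Qed.
Lemma j_shiftl g h : j (shiftl g h) = j h.
Proof. by rewrite -(lift_gpart h) shiftl_lift !j_lift. Qed.
Lemma j_shiftr g h : j (shiftr h g) = j h.
Proof. by rewrite -(lift_gpart h) shiftr_lift !j_lift. Qed.
Lemma shiftlM g g' h : shiftl g (shiftl g' h) = shiftl (g * g')%g h.
Proof. by rewrite -(lift_gpart h) !shiftl_lift mulgA. Qed.
Lemma shiftrM g g' h : shiftr (shiftr h g) g' = shiftr h (g * g')%g.
Proof. by rewrite -(lift_gpart h) !shiftr_lift AdM mulgA. Qed.
Lemma shiftl1 h : shiftl 1 h = h.
Proof. by rewrite -(lift_gpart h) shiftl_lift mul1g. Qed.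
Lemma shiftr1 h : shiftr h 1 = h.
Proof. by rewrite -(lift_gpart h) shiftr_lift Ad1 mulg1. Qed.

Lemma shiftl_mul g k l : tgt GH k = src GH l -> shiftl g k ** l = shiftl g (k ** l).
Proof.
move=> kl; rewrite /shiftl (src_mul isGH kl) (mul_assoc isGH) //.
by rewrite tgt_iota.
Qed.
Lemma mul_shiftr g k l : tgt GH k = src GH l -> k ** shiftr l g = shiftr (k ** l) g.
Proof.
move=> kl; rewrite /shiftr (tgt_mul isGH kl) (mul_assoc isGH) //.
by rewrite src_iota.
Qed.
Lemma shiftr_mul g k l : tgt GH k = src GH l -> shiftr k g ** l = k ** shiftl g l.
Proof.
move=> kl; rewrite /shiftr /shiftl (mul_assoc isGH) ?kl ?src_iota //.
by rewrite tgt_iota.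
Qed.

Lemma ldiv_shiftl g k h : src GH k = src GH h ->
  ginv GH (shiftl g k) ** shiftl g h = ginv GH k ** h.
Proof.
move=> kh; rewrite -{1}(mul_ldiv isGH kh) -shiftl_mul ?(src_ldiv isGH kh) //.
by rewrite (ldiv_mul isGH) // tgt_shiftl (src_ldiv isGH kh).
Qed.
Lemma ldiv_shiftr g k h : src GH k = src GH h ->
  ginv GH (shiftr k g) ** h = shiftl g^-1%g (ginv GH k ** h).
Proof.
move=> kh; set z := ginv GH k ** h.
have kz : tgt GH k = src GH z by rewrite (src_ldiv isGH kh).
have -> : h = shiftr k g ** shiftl g^-1%g z.
  by rewrite shiftr_mul ?src_shiftl // shiftlM mulgV shiftl1 (mul_ldiv isGH kh).
by rewrite (ldiv_mul isGH) // tgt_shiftr src_shiftl.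
Qed.

Lemma shiftl_fibre_bij g z : set_bij (fibre GH z) (fibre GH z) (shiftl g).
Proof.
split=> [k kz|k k' _ _ e|k kz]; first by rewrite /fibre /= src_shiftl.
  by rewrite -(shiftl1 k) -(mulVg g) -shiftlM e shiftlM mulVg shiftl1.
exists (shiftl g^-1%g k); first by rewrite /fibre /= src_shiftl.
by rewrite shiftlM mulgV shiftl1.
Qed.
Lemma shiftr_fibre_bij g z : set_bij (fibre GH z) (fibre GH z) (shiftr^~ g).
Proof.
split=> [k kz|k k' _ _ e|k kz]; first by rewrite /fibre /= src_shiftr.
  by rewrite -(shiftr1 k) -(mulgV g) -shiftrM e shiftrM mulgV shiftr1.
exists (shiftr k g^-1%g); first by rewrite /fibre /= src_shiftr.
by rewrite shiftrM mulVg shiftr1.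
Qed.

(** The group algebra acts on functions on H by convolution along the
    kernel. *)
Definition act_left x f : H -> F := fun h => \sum_g x g *: f (shiftl g^-1%g h).
Definition act_right f x : H -> F := fun h => \sum_g x g *: f (shiftr h g^-1%g).

(** Fourier inversion of the (base_index, base_index) matrix coefficients. *)
Definition phi b : H -> F :=
  fun h => \sum_r phi_coef (gpart h) (j h) r *: b (r, j h).
(** The corresponding coefficient of the Fourier transform. *)
Definition psi f : DQ -> F :=
  fun y : DQ => \sum_g psi_coef g y.2 y.1 *: f (lift g y.2).

Definition twisted_conv b b' : DQ -> F :=
  fun y : DQ => \sum_(k \in fibre GQ (src GQ y.2))
    c y.1 k (gmul GQ (ginv GQ k) y.2) *:
    pmul (b (y.1, k)) (push act k (b' (qact k y.1, gmul GQ (ginv GQ k) y.2))).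

Lemma act_left_lift x f a q :
  act_left x f (lift a q) = \sum_g x g *: f (lift (g^-1 * a)%g q).
Proof.
by apply: eq_bigr => g _; rewrite shiftl_lift.
Qed.

Lemma act_right_lift x f a q :
  act_right f x (lift a q) = \sum_g x g *: f (lift (a * Ad q g^-1)%g q).
Proof.
by apply: eq_bigr => g _; rewrite shiftr_lift.
Qed.

Lemma phi_lift b a q :
  phi b (lift a q) = \sum_r phi_coef a q r *: b (r, q).
Proof. by rewrite /phi gpart_lift j_lift. Qed.

Lemma eq_on_lifts f u : (forall a q, f (lift a q) = u (lift a q)) -> f = u.
Proof. by move=> fu; apply/funext => h; rewrite -(lift_gpart h). Qed.

Lemma act_left_conv x y f : act_left (group_conv x y) f = act_left x (act_left y f).
Proof.
apply: eq_on_lifts => a q; rewrite !act_left_lift /group_conv.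
under eq_bigr => g _ do rewrite scaler_suml.
rewrite exchange_big; apply: eq_bigr => g _.
rewrite act_left_lift scaler_sumr (reindex_inj (mulgI g)).
by apply: eq_bigr => h _; rewrite mulKg scalerA invMg mulgA.
Qed.

Lemma act_right_conv x y f : act_right f (group_conv x y) = act_right (act_right f x) y.
Proof.
apply: eq_on_lifts => a q; rewrite !act_right_lift /group_conv.
under eq_bigr => g _ do rewrite scaler_suml.
under [RHS]eq_bigr => g _ do rewrite act_right_lift scaler_sumr.
rewrite exchange_big [RHS]exchange_big; apply: eq_bigr => g _ /=.
rewrite (reindex_inj (mulgI g)); apply: eq_bigr => h _.
by rewrite mulKg scalerA mulrC invMg AdM mulgA.
Qed.

Lemma act_left_act_right x y f : act_left x (act_right f y) = act_right (act_left x f) y.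
Proof.
apply: eq_on_lifts => a q; rewrite act_left_lift act_right_lift.
under eq_bigr => g _ do rewrite act_right_lift scaler_sumr.
under [RHS]eq_bigr => g _ do rewrite act_left_lift scaler_sumr.
rewrite exchange_big; apply: eq_bigr => g _; apply: eq_bigr => h _.
by rewrite !scalerA mulrC mulgA.
Qed.

Lemma psi_phi b : psi (phi b) = b.
Proof.
apply/funext => -[r q]; rewrite /psi /=.
under eq_bigr => g _ do rewrite phi_lift scaler_sumr.
rewrite exchange_big (bigD1 r) //= [X in _ + X]big1 ?addr0.
  under eq_bigr => g _ do rewrite scalerA.
  by rewrite -scaler_suml psi_phi_coef eqxx scale1r.
move=> s sr; under eq_bigr => g _ do rewrite scalerA.
by rewrite -scaler_suml psi_phi_coef eq_sym (negPf sr) scale0r.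
Qed.

Lemma phi_psi f : phi (psi f) = act_left (corner D) (act_right f (corner D)).
Proof.
apply: eq_on_lifts => a q; rewrite phi_lift act_left_lift.
transitivity (\sum_g (\sum_r phi_coef a q r * psi_coef g q r) *: f (lift g q)).
  under eq_bigr => r _ do rewrite scaler_sumr.
  rewrite exchange_big; apply: eq_bigr => g _.
  by rewrite scaler_suml; apply: eq_bigr => r _; rewrite scalerA.
under [RHS]eq_bigr => g _ do rewrite act_right_lift scaler_sumr.
rewrite [RHS]exchange_big /=.
under eq_bigr => g _ do rewrite -phi_psi_coef scaler_suml.
rewrite exchange_big; apply: eq_bigr => y _.
(* g = x^-1 a Ad(y^-1) *)
rewrite [RHS](reindex_inj (h := fun g => a * Ad q y^-1 * g^-1)%g); last first.
  by move=> g g' /mulgI/invg_inj.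
apply: eq_bigr => g _; rewrite scalerA; congr (_ *: f (lift _ q)).
by rewrite !invMg invgK !mulgA !mulgKV.
Qed.

Lemma sum_corner_units f h :
  \sum_(i : {r : D & 'I_(rdim r)})
    act_left (group_conv (to_corner i) (from_corner i)) f h = f h.
Proof.
rewrite -(lift_gpart h); move: (gpart h) (j h) => a q.
under eq_bigr => i _ do rewrite act_left_lift.
rewrite exchange_big (bigD1 1%g) //= [X in _ + X]big1 ?addr0.
  by rewrite -scaler_suml sum_to_from_corner eqxx scale1r invg1 mul1g.
move=> g g1; rewrite -scaler_suml sum_to_from_corner.
by rewrite (negPf g1) scale0r.
Qed.

Let alD k (f g : F) : al k (f + g) = al k f + al k g.
Proof. exact: pushD. Qed.
Let alZ k (a : R[i]) (f : F) : al k (a *: f) = a *: al k f.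
Proof. exact: pushZ. Qed.
Let push_sum q (I : finType) (v : I -> F) :
  push act q (\sum_i v i) = \sum_i push act q (v i).
Proof. by apply: big_morph; [exact: pushD | exact: push0]. Qed.

Let pmul_suml (I : finType) (v : I -> F) w :
  pmul (\sum_i v i) w = \sum_i pmul (v i) w.
Proof.
by apply: (big_morph (fun v => pmul v w)); [move=> *; exact: pmulDl | exact: pmul0l].
Qed.
Let pmul_sumr (I : finType) (v : I -> F) w :
  pmul w (\sum_i v i) = \sum_i pmul w (v i).
Proof.
by apply: (big_morph (pmul w)); [exact: pmulDr | exact: pmul0r].
Qed.

Lemma fibre_finiteZ (a : R[i]) f : fibre_finite GH f ->
  fibre_finite GH (fun h => a *: f h).
Proof.
move=> ff z; apply: sub_finite_set (ff z) => k [kz fk]; split=> // f0.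
by apply: fk; rewrite /= f0 scaler0.
Qed.

Lemma fibre_finiteD f u : fibre_finite GH f -> fibre_finite GH u ->
  fibre_finite GH (fun h => f h + u h).
Proof.
move=> ff fu z; have := conj (ff z) (fu z); rewrite -finite_setU.
apply: sub_finite_set => k [kz fuk].
have [f0|fk] := pselect (f k = 0); [right|by left].
by split=> // u0; apply: fuk; rewrite f0 u0 addr0.
Qed.

Lemma conv_suml (I : finType) (a : I -> R[i]) (v : I -> H -> F) f h :
  (forall i, fibre_finite GH (v i)) ->
  conv (fun k => \sum_i a i *: v i k) f h = \sum_i a i *: conv (v i) f h.
Proof.
move=> fv; rewrite /index_enum; elim: (Finite.enum I) => [|i s IH] /=.
  rewrite big_nil /groupoid_conv fsbig1 // => k _; by rewrite big_nil pmul0l.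
rewrite big_cons -IH -groupoid_conv_linl //; last first.
  elim: s {IH} => [|i' s IH].
    move=> z; apply: (@sub_finite_set _ _ set0) => // k [_ /=].
    by rewrite big_nil.
  rewrite (_ : (fun k => _) = fun k => a i' *: v i' k +
      \sum_(j0 <- s) a j0 *: v j0 k); last by apply/funext => k; rewrite big_cons.
  exact: fibre_finiteD (fibre_finiteZ (a i') (fv i')) IH.
by congr (groupoid_conv _ _ _ _ _); apply/funext => k; rewrite big_cons.
Qed.

Lemma conv_sumr (I : finType) (a : I -> R[i]) (v : I -> H -> F) f h :
  fibre_finite GH f ->
  conv f (fun k => \sum_i a i *: v i k) h = \sum_i a i *: conv f (v i) h.
Proof.
move=> ff; rewrite /index_enum; elim: (Finite.enum I) => [|i s IH] /=.
  rewrite big_nil /groupoid_conv fsbig1 // => k _.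
  by rewrite big_nil push0 // pmul0r.
rewrite big_cons -IH -(groupoid_conv_linr alD alZ) //.
by congr (groupoid_conv _ _ _ _ _); apply/funext => k; rewrite big_cons.
Qed.

Lemma fibre_finite_comp (th th' : H -> H) f : cancel th th' ->
  (forall k, src GH (th k) = src GH k) ->
  fibre_finite GH f -> fibre_finite GH (f \o th).
Proof.
move=> thK sth ff z; apply: sub_finite_set (finite_image th' (ff z)).
by move=> k [kz fk]; exists (th k) => //; split=> //; rewrite /fibre /= sth.
Qed.

Lemma act_left_mul x f u : fibre_finite GH f ->
  act_left x (conv f u) = conv (act_left x f) u.
Proof.
move=> ff; apply/funext => h.
rewrite (conv_suml x (v := fun g => f \o shiftl g^-1%g)); last first.
  move=> g; apply: (fibre_finite_comp (th' := shiftl g)) ff => k.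
    by rewrite shiftlM mulgV shiftl1.
  exact: src_shiftl.
apply: eq_bigr => g _; congr (_ *: _).
rewrite /groupoid_conv src_shiftl.
rewrite (reindex_fsbig _ _ _ _ (shiftl_fibre_bij g^-1%g (src GH h))).
by apply: eq_fsbigr => k /set_mem kh; rewrite /= j_shiftl ldiv_shiftl.
Qed.

Lemma act_right_mul x f u : fibre_finite GH f ->
  act_right (conv f u) x = conv f (act_right u x).
Proof.
move=> ff; apply/funext => h.
rewrite (conv_sumr x (fun g k => u (shiftr k g^-1%g))) //.
apply: eq_bigr => g _; congr (_ *: _); rewrite /groupoid_conv src_shiftr.
by apply: eq_fsbigr => k /set_mem kh; rewrite mul_shiftr // (tgt_inv isGH).
Qed.

(** Right translation of the first factor by g is left translation of the second
    one, as the kernel acts trivially on germs. *)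
Lemma act_left_act_right_mul x f u : fibre_finite GH f ->
  conv (act_right f x) u = conv f (act_left x u).
Proof.
move=> ff; apply/funext => h.
rewrite (conv_suml x (v := fun g k => f (shiftr k g^-1%g))); last first.
  move=> g.
  apply: (@fibre_finite_comp (shiftr^~ g^-1%g) (shiftr^~ g)) ff => k.
    by rewrite shiftrM mulVg shiftr1.
  exact: src_shiftr.
rewrite (conv_sumr x (fun g => u \o shiftl g^-1%g)) //.
apply: eq_bigr => g _; congr (_ *: _); rewrite /groupoid_conv.
rewrite (reindex_fsbig _ _ _ _ (shiftr_fibre_bij g (src GH h))).
apply: eq_fsbigr => k /set_mem kh.
by rewrite /= shiftrM mulgV shiftr1 j_shiftr ldiv_shiftr.
Qed.

Lemma j_ldiv_lift a g q q' : tgt GQ q = src GQ q' ->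
  j (ginv GH (lift a q) ** lift g (gmul GQ q q')) = q'.
Proof.
move=> qq'; have sl : src GH (lift a q) = src GH (lift g (gmul GQ q q')).
  by rewrite !src_lift (src_mul isGQ).
apply: (mul_cancel isGQ (k := q)) => //.
  by rewrite src_j (src_ldiv isGH sl) tgt_lift.
rewrite -{1}(j_lift a q) -j_mul ?(mul_ldiv isGH sl) ?j_lift //.
by rewrite (src_ldiv isGH sl).
Qed.

(** Every arrow over x is lift a k, so the convolution is a sum over k in Q of
    sums over a in G; the latter are evaluated by convolution_coef. *)
Lemma phi_mul b b' : fibre_finite GH (phi b) ->
  phi (twisted_conv b b') = conv (phi b) (phi b').
Proof.
move=> fb; apply: eq_on_lifts => g q.
pose S := fibre GQ (src GQ q) `&` [set k | exists r, b (r, k) <> 0].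
(* b is recovered from phi b, whose support is finite in the fibres *)
have fS : finite_set S.
  apply: sub_finite_set (finite_image j (fb (src GQ q))) => k [kq [r bk]].
  have [a pa] : exists a, phi b (lift a k) <> 0.
    apply: contrapT => /forallNP p0; apply: bk; rewrite -(psi_phi b).
    by rewrite /psi big1 // => a _; have /contrapT -> := p0 a; rewrite scaler0.
  by exists (lift a k); [split=> //; rewrite /fibre /= src_lift | rewrite j_lift].
pose SL := (fun p : gT * Q => lift p.1 p.2) @` ([set: gT] `*` S).
have SLsub : SL `<=` fibre GH (src GH (lift g q)).
  by move=> _ [[a k] [_ [kq _]] <-]; rewrite /fibre /= !src_lift.
rewrite (groupoid_conv_on _ _ SLsub); last first.
  move=> k; rewrite -(lift_gpart k) !src_lift; move: (gpart k) (j k) => a q' kq nS.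
  rewrite phi_lift big1 // => r _.
  have -> : b (r, q') = 0; last exact: scaler0.
  apply: contrapT => bk; apply: nS; exists (a, q') => //=.
  by split=> //; split=> //; exists r.
rewrite fsbig_image; last first.
  by move=> [a k] [a' k'] _ _ /= /lift_inj[-> ->].
rewrite -(@pair_fsbig _ _ _ _ _ [set: gT] S (fun a k => pmul (phi b (lift a k))
  (al (lift a k) (phi b' (ginv GH (lift a k) ** lift g q))))) //;
  last exact: finite_finset.
rewrite exchange_fsbig //; last exact: finite_finset.
rewrite phi_lift.
transitivity (\sum_(k \in S) \sum_r phi_coef g q r *:
  (c r k (gmul GQ (ginv GQ k) q) *: pmul (b (r, k))
     (push act k (b' (qact k r, gmul GQ (ginv GQ k) q))))).
  rewrite fsbig_finite // exchange_big; apply: eq_bigr => r _.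
  rewrite -scaler_sumr -fsbig_finite //; congr (_ *: _).
  symmetry; apply: fsbig_widen => [k []//|k [kq nS] /=].
  have -> : b (r, k) = 0; last by rewrite pmul0l scaler0.
  by apply: contrapT => bk; apply: nS; split=> //; exists r.
apply: eq_fsbigr => k /set_mem[kq _].
set q' := gmul GQ (ginv GQ k) q.
have kq' : tgt GQ k = src GQ q' by rewrite (src_ldiv isGQ).
have qE : q = gmul GQ k q' by rewrite (mul_ldiv isGQ).
rewrite fsumT.
transitivity (\sum_a \sum_(s : D) \sum_(s' : D)
    pmul (phi_coef a k s *: b (s, k)) (push act k
      (phi_coef (gpart (ginv GH (lift a k) ** lift g (gmul GQ k q'))) q' s' *:
        b' (s', q')))); last first.
  apply: eq_bigr => a _.
  rewrite phi_lift j_lift [phi b' _]/phi qE j_ldiv_lift // push_sum pmul_suml.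
  by apply: eq_bigr => s _; rewrite pmul_sumr.
rewrite [RHS]exchange_big; apply: eq_bigr => s _ /=.
rewrite [RHS]exchange_big /=.
transitivity (\sum_(s' : D) (\sum_a phi_coef a k s *
    phi_coef (gpart (ginv GH (lift a k) ** lift g (gmul GQ k q'))) q' s') *:
    pmul (b (s, k)) (push act k (b' (s', q')))); last first.
  apply: eq_bigr => s' _; rewrite scaler_suml; apply: eq_bigr => a _.
  by rewrite pushZ // pmulZl pmulZr scalerA.
rewrite (bigD1 (qact k s)) //= [X in _ + X]big1 ?addr0 => [|s' ne].
  by rewrite convolution_coef // -qE eqxx mul1r scalerA mulrC.
by rewrite convolution_coef // (negPf ne) mul0r scale0r.
Qed.


(** * Supports, and the Morita equivalence *)

Let shA : is_alg_sheaf A. Proof. by case: shact. Qed.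
Let hH := arrows_hausdorff LH.
Let hQ := arrows_hausdorff LQ.
Let csrcH := src_continuous LH.
Let csrcQ := src_continuous LQ.
Local Notation csecH := (csec (src GH)).
Local Notation csecD := (csec (fun y : DQ => src GQ y.2)).

Let hDQ : hausdorff_space DQ.
Proof. by apply: hausdorff_prod hQ; exact: discrete_hausdorff. Qed.

Lemma shiftl_continuous g : continuous (shiftl g).
Proof.
move=> h; apply: (mul_continuous_at (mul_continuous LH)).
- by near=> h'; rewrite /composable tgt_iota.
- apply: (@continuous_comp _ _ _ (src GH) (iota^~ g)); first exact: csrcH.
  exact: iota_continuous.
- exact: cvg_id.
Unshelve. all: by end_near.
Qed.

Lemma shiftr_continuous g : continuous (shiftr^~ g).
Proof.
move=> h; apply: (mul_continuous_at (mul_continuous LH)).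
- by near=> h'; rewrite /composable src_iota.
- exact: cvg_id.
- apply: (@continuous_comp _ _ _ (tgt GH) (iota^~ g)).
    exact: (tgt_continuous LH).
  exact: iota_continuous.
Unshelve. all: by end_near.
Qed.

Lemma csec_act_left x f : csecH f -> csecH (act_left x f).
Proof.
move=> cf; apply: (csec_pull (th := fun g => shiftl g^-1%g)
  (kap := fun g _ => x g)) cf => //.
- by move=> g; exact: shiftl_continuous.
- by move=> g h; exact: src_shiftl.
- by move=> g h; near=> h'.
- move=> g C cC; exists (shiftl g @` C).
    by apply: continuous_image_compact cC; exact: shiftl_continuous.
  by move=> h Ch; exists (shiftl g^-1%g h); rewrite // shiftlM mulgV shiftl1.
Unshelve. all: by end_near.
Qed.

Lemma csec_act_right x f : csecH f -> csecH (act_right f x).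
Proof.
move=> cf; apply: (csec_pull (th := fun g h => shiftr h g^-1%g)
  (kap := fun g _ => x g)) cf => //.
- by move=> g; exact: shiftr_continuous.
- by move=> g h; exact: src_shiftr.
- by move=> g h; near=> h'.
- move=> g C cC; exists ((shiftr^~ g) @` C).
    by apply: continuous_image_compact cC; exact: shiftr_continuous.
  by move=> h Ch; exists (shiftr h g^-1%g); rewrite // shiftrM mulVg shiftr1.
Unshelve. all: by end_near.
Qed.

Lemma phi_coef_near a q r : \forall q' \near q, phi_coef a q' r = phi_coef a q r.
Proof.
case: intT => _ _ _ /(_ q r) + _; apply: filterS => q' [e eT].
by rewrite /phi_coef e eT.
Qed.

Lemma psi_coef_near a q r : \forall q' \near q, psi_coef a q' r = psi_coef a q r.
Proof.
case: intT => _ _ _ /(_ q r) + _; apply: filterS => q' [e eT].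
by rewrite /psi_coef e eT.
Qed.

Lemma csec_phi b : csecD b -> csecH (phi b).
Proof.
move=> cb; apply: (csec_pull (th := fun (r : D) h => (r, j h) : DQ)
  (kap := fun r h => phi_coef (gpart h) (j h) r)) cb => //.
- move=> r h.
  have c1 : (fun=> r : discrete_topology D) @ nbhs h -->
    nbhs (r : discrete_topology D) by exact: cvg_cst.
  have c2 : j @ nbhs h --> nbhs (j h) by exact: j_continuous.
  exact: (cvg_pair c1 c2).
- by move=> r h /=; exact: src_j.
- move=> r h; have n1 := gpart_locally_constant h.
  have n2 := near_comp (P := fun q' => phi_coef (gpart h) q' r =
    phi_coef (gpart h) (j h) r) (@j_continuous h) (phi_coef_near _ _ _).
  by apply: filterS2 n1 n2 => h' -> ->.
- move=> r C cC.
  exists (\big[setU/set0]_(a : gT) (lift a @` (snd @` C))).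
    apply: bigsetU_compact => a _; apply: continuous_image_compact.
      exact: lift_continuous.
    apply: continuous_image_compact cC => y; exact: cvg_snd.
  move=> h Ch; rewrite (bigD1 (gpart h)) //=; left.
  by exists (j h); [exists (r, j h) | exact: lift_gpart].
Qed.

Lemma csec_psi f : csecH f -> csecD (psi f).
Proof.
move=> cf; apply: (csec_pull (th := fun g (y : DQ) => lift g y.2)
  (kap := fun g (y : DQ) => psi_coef g y.2 y.1)) cf => //.
- move=> y; apply: (@continuous_comp _ _ _ snd (src GQ)); last exact: csrcQ.
  exact: cvg_snd.
- move=> g y; apply: (@continuous_comp _ _ _ snd (lift g)).
    exact: cvg_snd.
  exact: lift_continuous.
- by move=> g y /=; exact: src_lift.
- move=> g [r q].
  exists ([set r], [set q' | psi_coef g q' r = psi_coef g q r]) => /=.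
    by split; [exact: discrete_set1 | exact: psi_coef_near].
  by move=> [r' q'] /= [-> ->].
- move=> g C cC; exists (setT `*` (j @` C)).
    apply: compact_setX; first exact: discrete_compact.
    by apply: continuous_image_compact cC; exact: j_continuous.
  by move=> [r q] Cl; split=> //; exists (lift g q) => //=; rewrite j_lift.
Qed.

Lemma csec_conv f u : csecH f -> csecH u -> csecH (conv f u).
Proof.
apply: csec_groupoid_conv => //.
- exact: isGH.
- exact: base_hausdorff LH.
- exact: tgt_continuous LH.
- exact: inv_continuous LH.
- exact: mul_continuous LH.
- exact: src_etale LH.
- by move=> k; exact: push0.
- by move=> k v w e; apply: push_loc; rewrite tgt_j.
- move=> V b k oV Vb Vk.
  have Vk' : V (tgt GQ (j k)) by rewrite tgt_j.
  have [V' [b' [oV' V'k Vb' nb']]] := push_sec shact oV Vb Vk'.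
  exists V', b'; split=> //; first by rewrite -src_j.
  have := near_comp (P := fun q => push act q b = germ (b' (src GQ q)))
    (@j_continuous k) nb'.
  by apply: filterS => k'; rewrite src_j.
Qed.

Lemma csecH_finite f : csecH f -> fibre_finite GH f.
Proof. by move=> cf; apply: csec_fibre_finite cf; exact: src_etale LH. Qed.

(** The algebras consist of functions with values in varying stalks; hatA and
    hatB translate them to functions with values in the product of stalks. *)
Local Notation CA := (crossed_product (action_via (GH := GH) j act)).
Local Notation CB := (twisted_crossed_product
  (dual_action (qact := qact) act) (dual_cocycle c)).

Let hatA (a : CA) : H -> F := hat (a : forall h, stalk A (src GH h)).
Let hatB (b : CB) : DQ -> F := dual_hat b.
Let mkA (f : H -> F) : CA := unhat (src GH) f.
Let mkB (b : DQ -> F) : CB := fun y : DQ => b y (src GQ y.2).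

Let carA (a : CA) : carrier a <-> csecH (hatA a).
Proof. exact: cpt_sections_hat. Qed.
Let carB (b : CB) : carrier b <-> csecD (hatB b).
Proof. exact: (dual_carrier _ csrcQ). Qed.

Let hatA_inj (a a' : CA) : hatA a = hatA a' -> a = a'.
Proof.
move=> e; rewrite -[LHS](hatK (s := src GH)) -[RHS](hatK (s := src GH)).
exact: (congr1 (unhat (src GH)) e).
Qed.
Let hatB_inj (b b' : CB) : hatB b = hatB b' -> b = b'.
Proof.
move=> e; apply: functional_extensionality_dep => y.
have := congr1 (fun f : DQ -> F => f y (src GQ y.2)) e.
by rewrite /hatB /dual_hat /hat !germK.
Qed.

Let hat_mkA f : (forall h, at_point (src GH h) (f h)) -> hatA (mkA f) = f.
Proof. exact: unhatK. Qed.
Let hat_mkB b : (forall y : DQ, at_point (src GQ y.2) (b y)) -> hatB (mkB b) = b.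
Proof. by move=> h; apply/funext => y; exact: at_pointE. Qed.

Let hatA_at (a : CA) h : at_point (src GH h) (hatA a h).
Proof. exact: at_germ. Qed.
Let hatB_at (b : CB) (y : DQ) : at_point (src GQ y.2) (hatB b y).
Proof. exact: at_germ. Qed.

Let hatA_lin (k : R[i]) (a a' : CA) :
  hatA (k *: a + a') = fun h => k *: hatA a h + hatA a' h.
Proof. by apply/funext => h; rewrite /hatA /hat germD germZ. Qed.
Let hatB_lin (k : R[i]) (b b' : CB) :
  hatB (k *: b + b') = fun y : DQ => k *: hatB b y + hatB b' y.
Proof. by apply/funext => y; rewrite /hatB /dual_hat /hat germD germZ. Qed.

Let LA x (a : CA) : CA := mkA (act_left x (hatA a)).
Let RA (a : CA) x : CA := mkA (act_right (hatA a) x).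
Let phiA (b : CB) : CA := mkA (phi (hatB b)).
Let psiA (a : CA) : CB := mkB (psi (hatA a)).

Let hat_LA x (a : CA) : hatA (LA x a) = act_left x (hatA a).
Proof.
apply: hat_mkA => h; apply: at_point_sum => g _; apply: at_pointZ.
by rewrite -(src_shiftl g^-1%g); exact: hatA_at.
Qed.
Let hat_RA x (a : CA) : hatA (RA a x) = act_right (hatA a) x.
Proof.
apply: hat_mkA => h; apply: at_point_sum => g _; apply: at_pointZ.
by rewrite -(src_shiftr g^-1%g); exact: hatA_at.
Qed.
Let hat_phiA (b : CB) : hatA (phiA b) = phi (hatB b).
Proof.
apply: hat_mkA => h; apply: at_point_sum => r _; apply: at_pointZ.
by rewrite -src_j; exact: (@hatB_at b (r, j h)).
Qed.
Let hat_psiA (a : CA) : hatB (psiA a) = psi (hatA a).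
Proof.
apply: hat_mkB => y; apply: at_point_sum => g _; apply: at_pointZ.
by rewrite -(src_lift g); exact: hatA_at.
Qed.
Let hat_mulA (a a' : CA) : hatA (amul a a') = conv (hatA a) (hatA a').
Proof. by apply: hat_crossed_product; [exact: isGH | exact: src_j]. Qed.
Let hat_mulB (b b' : CB) : hatB (amul b b') = twisted_conv (hatB b) (hatB b').
Proof.
apply/funext => -[r q]; apply: dual_hat_mul.
- exact: isGQ.
- by move=> *; exact: qact_mul.
- exact: qact_unit.
Qed.

Let linear_sum (X Y : Type) (I : finType) (kap : I -> Y -> R[i])
    (th : I -> Y -> X) (f g : X -> F) (k : R[i]) :
  (fun z : Y => \sum_i kap i z *: (k *: f (th i z) + g (th i z))) =
  (fun z : Y => k *: (\sum_i kap i z *: f (th i z)) + \sum_i kap i z *: g (th i z)).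
Proof.
apply/funext => z; rewrite scaler_sumr -big_split; apply: eq_bigr => i _ /=.
by rewrite scalerDr !scalerA mulrC.
Qed.

Let linLA x : linear_on (LA x).
Proof.
split=> [a /carA ca|k a a' _ _]; first by apply/carA; rewrite hat_LA; exact: csec_act_left.
by apply: hatA_inj; rewrite hatA_lin !hat_LA hatA_lin; exact: linear_sum.
Qed.
Let linRA x : linear_on (RA^~ x).
Proof.
split=> [a /carA ca|k a a' _ _]; first by apply/carA; rewrite hat_RA; exact: csec_act_right.
apply: hatA_inj; rewrite hatA_lin !hat_RA hatA_lin.
exact: (linear_sum _ (fun g h => shiftr h g^-1%g)).
Qed.
Let linphiA : linear_on phiA.
Proof.
split=> [b /carB cb|k b b' _ _]; first by apply/carA; rewrite hat_phiA; exact: csec_phi.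
apply: hatA_inj; rewrite hatA_lin !hat_phiA hatB_lin.
exact: (linear_sum _ (fun (r : D) h => (r, j h))).
Qed.
Let linpsiA : linear_on psiA.
Proof.
split=> [a /carA ca|k a a' _ _]; first by apply/carB; rewrite hat_psiA; exact: csec_psi.
apply: hatB_inj; rewrite hatB_lin !hat_psiA hatA_lin.
exact: (linear_sum _ (fun g (y : DQ) => lift g y.2)).
Qed.

Let spaceA : is_space CA.
Proof.
split=> [|k a a' /carA ca /carA ca']; apply/carA; last first.
  by rewrite hatA_lin; exact: csec_lin.
rewrite (_ : hatA 0 = fun=> 0); first exact: csec0.
by apply/funext => h; exact: germ0.
Qed.
Let spaceB : is_space CB.
Proof.
split=> [|k b b' /carB cb /carB cb']; apply/carB; last first.
  by rewrite hatB_lin; exact: csec_lin.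
rewrite (_ : hatB 0 = fun=> 0); first exact: csec0.
by apply/funext => y; exact: germ0.
Qed.

Let finA (a : CA) : carrier a -> fibre_finite GH (hatA a).
Proof. by move=> /carA; exact: csecH_finite. Qed.

Lemma crossed_product_is_algebra : is_algebra CA.
Proof.
have cM (a a' : CA) : carrier a -> carrier a' -> carrier (amul a a').
  by move=> /carA ca /carA ca'; apply/carA; rewrite hat_mulA; exact: csec_conv.
split=> //.
  split=> [a ca|a ca]; split=> [a' ca'|k a1 a2 c1 c2].
  - exact: cM.
  - apply: hatA_inj; rewrite hatA_lin !hat_mulA hatA_lin; apply/funext => h.
    by apply: (groupoid_conv_linr alD alZ); exact: finA.
  - exact: cM.
  - apply: hatA_inj; rewrite hatA_lin !hat_mulA hatA_lin; apply/funext => h.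
    by apply: groupoid_conv_linl; exact: finA.
move=> a a1 a2 ca c1 c2; apply: hatA_inj; rewrite !hat_mulA; apply/funext => h.
apply: groupoid_conv_assoc; [exact: isGH|exact: alD| | |exact: finA|exact: finA].
- by move=> k f g; exact: pushM.
- by move=> k l f kl; rewrite j_mul // push_comp ?src_j ?tgt_j //; exact: isGQ.
Qed.

Lemma crossed_product_morita : self_induced CA -> morita_equivalent CA CB.
Proof.
move=> siA.
apply: (@corner_morita _ CA CB (gT -> R[i]) group_conv LA RA (corner D)
  {r : D & 'I_(rdim r)} (@to_corner _ _ D) (@from_corner _ _ D) phiA psiA) => //.
- exact: crossed_product_is_algebra.
- by move=> x y a _; apply: hatA_inj; rewrite !hat_LA act_left_conv.
- by move=> x y a _; apply: hatA_inj; rewrite !hat_RA act_right_conv.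
- by move=> x y a _; apply: hatA_inj; rewrite !(hat_LA, hat_RA) act_left_act_right.
- move=> x a a' ca _; apply: hatA_inj; rewrite !(hat_LA, hat_mulA).
  by rewrite act_left_mul //; exact: finA.
- move=> x a a' ca _; apply: hatA_inj; rewrite !(hat_RA, hat_mulA).
  by rewrite act_right_mul //; exact: finA.
- move=> x a a' ca _; apply: hatA_inj; rewrite !(hat_LA, hat_RA, hat_mulA).
  by rewrite act_left_act_right_mul //; exact: finA.
- exact: corner_idem.
- exact: to_corner_e.
- exact: e_from_corner.
- move=> a _; apply: hatA_inj; apply/funext => h.
  rewrite (big_morph (fun a' : CA => hatA a' h) (id1 := 0) (op1 := +%R)).
  + by under eq_bigr do rewrite hat_LA; exact: sum_corner_units.
  + by move=> a1 a2; exact: germD.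
  + exact: germ0.
- by move=> b _; apply: hatB_inj; rewrite hat_psiA hat_phiA psi_phi.
- by move=> a _; apply: hatA_inj; rewrite hat_phiA hat_psiA hat_LA hat_RA phi_psi.
- move=> b b' cb cb'; apply: hatB_inj.
  rewrite hat_psiA hat_mulA !hat_phiA -phi_mul ?psi_phi ?hat_mulB //.
  by rewrite -hat_phiA; apply: finA; exact: linphiA.1.
Qed.

End ExtensionAlgebra.

Theorem theorem1p2 (R : realType) (n : nat) (gT : finGroupType)
  (M H Q : topologicalType)
  (AM : atlas 'rV[R]_n M) (AH : atlas 'rV[R]_n H) (AQ : atlas 'rV[R]_n Q)
  (GH : groupoid M H) (GQ : groupoid M Q)
  (iota : M -> gT -> H) (j : H -> Q) (sigma : Q -> H)
  (D : unitary_dual R gT) (qact : Q -> D -> D)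
  (T : forall (q : Q) (r r' : D), 'M[R[i]]_(rdim r', rdim r))
  (c : D -> Q -> Q -> R[i])
  (A : alg_sheaf (K := R[i]) M) (act : arrow_action GQ A) :
  proper_etale_Lie_groupoid AM AH GH ->
  proper_etale_Lie_groupoid AM AQ GQ ->
  good_nerve R GQ ->
  is_extension AM AH AQ GH GQ iota j ->
  is_section AH AQ GH GQ j sigma ->
  is_intertwiner GH GQ iota sigma qact T ->
  is_cocycle_of GH GQ iota sigma qact T c ->
  is_gsheaf act ->
  self_induced (crossed_product (action_via (GH := GH) j act)) ->
  morita_equivalent
    (crossed_product (action_via (GH := GH) j act))
    (twisted_crossed_product (dual_action (qact := qact) act)
                             (dual_cocycle c)).
Proof.
move=> LH LQ _ ext sec_sigma intT coc shact.
exact: (crossed_product_morita LH LQ ext sec_sigma intT coc shact).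
Qed.
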